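(* Let $w=w^\mu\partial_\mu$ be a solution of the Frauendiener–Walton form of the relativistic Euler equations satisfying assumptions (A.1)–(A.7) listed in the context (a dynamical compact liquid body), and let $\phi$, the frame $e_i$, and all Lagrangian quantities be constructed from $w$ as in the context. Then $\phi=(\phi^\mu)$ and $\tilde\theta^0=(\tilde\theta^0_\mu)$ satisfy the system of non-linear wave equations $$\bar\partial_\alpha\big(\tilde A^{\alpha\beta}\bar\partial_\beta\tilde\theta^0_\nu+\tilde L^\alpha_\nu\big)=\tilde F_\nu\quad\text{in }\Omega_T,\qquad \bar\partial_0\phi^\mu=\tilde\gamma_{00}\,\tilde g^{\mu\nu}\tilde\theta^0_\nu\quad\text{in }\Omega_T,$$ where $\tilde\sigma_i{}^k{}_j(\bar x^0,\bar x^\Lambda)=\sigma_i{}^k{}_j(0,\bar x^\Lambda)$ is independent of $\bar x^0$, together with the acoustic boundary condition $$\bar\theta^3_\alpha\big(\tilde A^{\alpha\beta}\bar\partial_\beta\tilde\theta^0_\nu+\tilde L^\alpha_\nu\big)\Big|_{\Gamma_T}=-\frac{\det(J)}{\tilde f\,\tilde\gamma_{00}}\,\mathcal D_0\big(|\tilde\theta^3|_{\tilde g}\,\hat\psi_\nu\big),\qquad \hat\psi_\nu=\frac{\psi_\nu}{|\psi|_{\tilde m}},\quad \psi_\nu=\bar\partial_0\tilde\theta^0_\nu+\beta^\lambda_\nu\tilde\theta^0_\lambda,$$ where $\mathcal D_0\xi_\nu=\bar\partial_0\xi_\nu+\beta^\lambda_\nu\xi_\lambda$ and $\hat\psi_\nu$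 is well defined on $\Gamma_T$.
   Context: Greek indices run over $0,\dots,3$, frame indices $i,j,k$ over $0,\dots,3$, and $I,J,L,M$ and $\Lambda$ over $1,2,3$. Spacetime indices are raised and lowered with $g$. Equation of state: $\rho=\rho(p)$, $\rho\in C^\infty([0,\infty),[\rho_0,\rho_1])$, $\rho(0)=\rho_0$, $\rho'(p)>0$, constants $0<\rho_0<\rho_1$. The function $p=p(\zeta)$ solves $dp/d\zeta=(\rho(p)+p)/\zeta$, $p(1)=0$, and $s^2(\zeta)=1/\rho'(p(\zeta))$. For timelike $w$: $w^2=-g_{\mu\nu}w^\mu w^\nu>0$, $\zeta=(w^2)^{-1/2}$; the fluid variables are $v^\mu=\zeta w^\mu$, $\rho=\rho(p(\zeta))$. The Frauendiener–Walton–Euler equations are $A_{\mu\nu}{}^\gamma\nabla_\gamma w^\nu=0$ with $A_{\mu\nu}{}^\gamma=(3+\frac1{s^2})\frac{w_\mu w_\nu}{w^2}w^\gamma+\delta^\gamma_\nu w_\mu+\delta^\gamma_\mu w_\nu+w^\gamma g_{\mu\nu}$. Assumptions. (A.1) $(x^\mu)$ are global Cartesian coordinates on $\mathbb R^4$, $g$ is a smooth Lorentzian metric of signature $(-,+,+,+)$ on $\mathbb R^4$, with Levi-Civita connection $\nabla$, Christoffel symbols $\Gamma^\gamma_{\alpha\beta}$ and Ricci tensor $R_{\mu\gamma}=R_{\mu\nu\gamma}{}^\nu$, where $\nabla_\mu\nabla_\nu\lambda_\gamma-\nabla_\nu\nabla_\mu\lambda_\gamma=R_{\mu\nu\gamma}{}^\sigma\lambda_\sigma$.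 (A.2) $U\subset\mathbb R^4$ is open, bounded, diffeomorphic to a timelike cylinder with base $\Omega_0=\{0\}\times\Omega$, $\Omega\subset\mathbb R^3$ bounded and open with smooth boundary. (A.3) $w$ is timelike, $w^\mu\in C^k(\overline U)$ with $k\ge8$, and solves the Frauendiener–Walton–Euler equations on $U$. (A.4) $U$ is invariant under the flow $\mathcal F_\tau$ of $w$; $T>0$ is such that $U_T:=\bigcup_{0\le\tau\le T}\mathcal F_\tau(\{0\}\times\Omega)\subset U$. (A.5) $w$ is tangent to the timelike boundary $B_T:=\bigcup_{0\le\tau\le T}\mathcal F_\tau(\{0\}\times\partial\Omega)$. (A.6) $0<c_s^-\le s^2\le c_s^+<1$ in $U$ for constants $c_s^\pm$. (A.7) $p|_{B_T}=0$ and $-\nabla_np\ge c_p>0$ on $B_T$ (Taylor sign condition), $n$ the outward unit normal to $B_T$. Lagrangian coordinates: $\Omega_T=[0,T]\times\Omega$, $\Gamma_T=[0,T]\times\partial\Omega$, $\phi^\mu(\bar x^0,\bar x^\Lambda)=\mathcal F^\mu_{\bar x^0}(0,\bar x^\Lambda)$, $\bar\partial_\mu=\partial/\partial\bar x^\mu$, $J=(J^\mu_\nu)=(\bar\partial_\nu\phi^\mu)$, $(\check J^\mu_\nu)=J^{-1}$. Frame: $e_0=w$, and $e_I$ solve $[e_0,e_I]=0$ in $U_T$, with $C^k$ initial data on $\Omega_0$ such that, with $\gamma_{ij}=g(e_i,e_j)$, on $\Omega_0$: $\gamma_{0J}=0$ and $\det(\gamma_{IJ})=F((-\gamma_{00})^{-1/2})^2$,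 where $F'(\zeta)=-F(\zeta)/(\zeta s^2(\zeta))$, $F(1)=1$; and such that the pulled-back frame $\bar e_i=\phi^*e_i$ (for which $\bar e_0=\bar\partial_0$ and all components are $\bar x^0$-independent) has $\bar e_0,\bar e_1,\bar e_2$ spanning $T\Gamma_T$ on $\Gamma_T$ and $\bar e_3$ outward pointing there. $(\theta^i_\mu)=(e_i^\mu)^{-1}$ and $(\bar\theta^i_\mu)=(\bar e^\mu_i)^{-1}$ are the dual frames; $\sigma_i{}^k{}_j=\theta^k([e_i,e_j])$. A tilde denotes evaluation in Lagrangian coordinates: $\tilde\theta^i_\mu=\theta^i_\mu\circ\phi$, $\tilde e^\mu_i=e^\mu_i\circ\phi$, $\tilde g_{\mu\nu}=g_{\mu\nu}\circ\phi$, $\tilde g^{\mu\nu}=g^{\mu\nu}\circ\phi$, $\tilde\Gamma=\Gamma\circ\phi$, $\tilde R_\nu{}^\lambda=R_\nu{}^\lambda\circ\phi$, $\tilde\sigma=\sigma\circ\phi$, $\tilde\gamma_{ij}=\gamma_{ij}\circ\phi$, $\tilde s^2=s^2((-\tilde\gamma_{00})^{-1/2})$, $\tilde f=f((-\tilde\gamma_{00})^{-1/2})$ with $f(\zeta)=-\zeta F(\zeta)$. Further, $\tilde a^{\mu\nu}=\tilde g^{\mu\nu}-\frac1{\tilde\gamma_{00}}(1-\frac1{\tilde s^2})\tilde e_0^\mu\tilde e_0^\nu$, $\bar a^{\alpha\beta}=\check J^\alpha_\mu\check J^\beta_\nu\tilde a^{\mu\nu}$, and $$\tilde A^{\alpha\beta}=-\frac{\det(J)}{\tilde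 f}\bar a^{\alpha\beta},\qquad \tilde L^\alpha_\nu=-\frac{\det(J)}{\tilde f}\bar a^{\alpha\beta}\big(-J^\omega_\beta\tilde\Gamma^\gamma_{\omega\nu}\tilde\theta^0_\gamma+\tilde\sigma_M{}^0{}_L\bar\theta^M_\beta\tilde\theta^L_\nu\big),$$ $$\tilde F_\nu=-\det(J)\Big(-\tilde\Gamma^\alpha_{\alpha\gamma}\tilde Y^\gamma_\nu+\tilde\Gamma^\gamma_{\alpha\nu}\tilde Y^\alpha_\gamma+\frac1{\tilde f}\tilde R_\nu{}^\lambda\tilde\theta^0_\lambda\Big),\qquad \tilde Y^\alpha_\nu=\frac1{\tilde f}\tilde a^{\alpha\beta}\big[\check J^\gamma_\beta\bar\partial_\gamma\tilde\theta^0_\nu-\tilde\Gamma^\gamma_{\beta\nu}\tilde\theta^0_\gamma+\tilde\sigma_M{}^0{}_L\tilde\theta^M_\beta\tilde\theta^L_\nu\big],$$ $\beta^\lambda_\nu=-\tilde e_0^\gamma\tilde\Gamma^\lambda_{\gamma\nu}$, $\tilde m^{\alpha\beta}=\tilde g^{\alpha\beta}-\frac2{\tilde\gamma_{00}}\tilde e_0^\alpha\tilde e_0^\beta$, $|\psi|_{\tilde m}=(\tilde m^{\alpha\beta}\psi_\alpha\psi_\beta)^{1/2}$, $|\tilde\theta^3|_{\tilde g}=(\tilde g^{\alpha\beta}\tilde\theta^3_\alpha\tilde\theta^3_\beta)^{1/2}$. *)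

(* Defs.v *)
From HB Require Import structures.
From mathcomp Require Export all_boot all_order all_algebra.
From mathcomp Require Export all_classical all_reals all_analysis.

Set Implicit Arguments.
Unset Strict Implicit.
Unset Printing Implicit Defensive.

Import Order.TTheory GRing.Theory Num.Theory.
Import numFieldNormedType.Exports.

Local Open Scope classical_set_scope.
Local Open Scope ring_scope.

(* Indices 0,...,3 live in 'I_4.  A spatial index 1,2,3 is represented by
   K : 'I_3, and [sp K] is the corresponding element of 'I_4. *)
Definition sp (K : 'I_3) : 'I_4 := lift ord0 K.

Section Calculus.
Variable R : realType.

(* Classes C^k and C^oo on an open set.  In finite dimension, asking for all
   directional derivatives amounts to asking for the partial derivatives. *)
Fixpoint Ck_on (k : nat) (V W : normedModType R) (N : set V) (f : V -> W) : Prop :=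
  match k with
  | 0 => forall x, N x -> {for x, continuous f}
  | k'.+1 => (forall x, N x -> differentiable f x) /\
             (forall v : V, Ck_on k' N (fun x => 'D_v f x))
  end.

Definition smooth_on (V W : normedModType R) (N : set V) (f : V -> W) : Prop :=
  forall k, Ck_on k N f.

(* Classes C^k(A) and C^oo(A) for A not open, e.g. the closure of an open set:
   f agrees with, and here is, a map of that class near A.  One-sided
   derivatives at boundary points are thereby ordinary derivatives, whose
   values do not depend on the extension. *)
Definition Ck_closed (k : nat) (V W : normedModType R) (A : set V) (f : V -> W) : Prop :=
  exists N : set V, [/\ open N, A `<=` N & Ck_on k N f].

Definition smooth_closed (V W : normedModType R) (A : set V) (f : V -> W) : Prop :=
  exists N : set V, [/\ open N, A `<=` N & smooth_on N f].

Definition pd (mu : 'I_4) (f : 'rV[R]_4 -> R) (x : 'rV[R]_4) : R :=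
  'D_(delta_mx ord0 mu) f x.

Definition pt (t : R) (y : 'rV[R]_3) : 'rV[R]_4 :=
  \row_mu (if unlift ord0 mu is Some K then y ord0 K else t).

Definition space (x : 'rV[R]_4) : 'rV[R]_3 := \row_K x ord0 (sp K).

(* h is a local defining function of the open set Omega at y:
   near y, Omega = {h < 0}, with dh(y) <> 0. *)
Definition boundary_defining (Omega : set 'rV[R]_3) (y : 'rV[R]_3)
    (h : 'rV[R]_3 -> R) : Prop :=
  (exists u, 'D_u h y != 0) /\
  exists N : set 'rV[R]_3, [/\ open N, N y, smooth_on N h &
    forall z, N z -> (Omega z <-> h z < 0)].

Definition bd (Omega : set 'rV[R]_3) : set 'rV[R]_3 :=
  closure Omega `\` interior Omega.

Definition smooth_boundary (Omega : set 'rV[R]_3) : Prop :=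
  forall y, bd Omega y -> exists h, boundary_defining Omega y h.

Definition tangent_bd (Omega : set 'rV[R]_3) (y u : 'rV[R]_3) : Prop :=
  forall h, boundary_defining Omega y h -> 'D_u h y = 0.

Definition outward_bd (Omega : set 'rV[R]_3) (y u : 'rV[R]_3) : Prop :=
  forall h, boundary_defining Omega y h -> 0 < 'D_u h y.

Definition lie_bracket (X Y : 'rV[R]_4 -> 'rV[R]_4) (x : 'rV[R]_4) : 'rV[R]_4 :=
  'D_(X x) Y x - 'D_(Y x) X x.

Definition minkowski : 'M[R]_4 :=
  \matrix_(mu, nu) (if mu == nu then (if mu == ord0 then -1 else 1) else 0).

End Calculus.

(* The data entering the construction.  Functions on spacetime, and rho, p, F
   are total; only their values on (a neighbourhood of) the relevant domains
   are constrained. *)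
Record body (R : realType) := Body {
  Omega : set 'rV[R]_3;
  U : set 'rV[R]_4;
  T : R;
  k : nat;
  g : 'rV[R]_4 -> 'M[R]_4;
  rho : R -> R;
  rho0 : R;
  rho1 : R;
  p : R -> R;
  F : R -> R;
  w : 'rV[R]_4 -> 'rV[R]_4;
  flow_dom : set (R * 'rV[R]_4);
  flow : R * 'rV[R]_4 -> 'rV[R]_4;
  e_sp : 'I_3 -> 'rV[R]_4 -> 'rV[R]_4   (* the fields e_1, e_2, e_3 *)
}.

(* Arguments of tensor components are ordered as the indices are read off from
   left to right, the upper index first for Christoffel symbols:
   Gam c a b = Gamma^c_{ab}, Acoef mu nu c = A_{mu nu}^c,
   sigma i l j = sigma_i^l_j, beta lam nu = beta^lam_nu. *)
Section Body.
Variables (R : realType) (X : body R).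
Notation pt4 := 'rV[R]_4.

Definition ginv (y : pt4) : 'M[R]_4 := invmx (g X y).

Definition gprod (y u v : pt4) : R :=
  \sum_mu \sum_nu g X y mu nu * u ord0 mu * v ord0 nu.

Definition Gam (c a b : 'I_4) (y : pt4) : R :=
  2^-1 * \sum_d ginv y c d *
    (pd a (fun z => g X z d b) y + pd b (fun z => g X z d a) y
     - pd d (fun z => g X z a b) y).

(* nabla_nu lambda_c and nabla_mu nabla_nu lambda_c, for a covector field. *)
Definition nabla1 (lam : 'I_4 -> pt4 -> R) (nu c : 'I_4) (y : pt4) : R :=
  pd nu (lam c) y - \sum_s Gam s nu c y * lam s y.

Definition nabla2 (lam : 'I_4 -> pt4 -> R) (mu nu c : 'I_4) (y : pt4) : R :=
  pd mu (nabla1 lam nu c) y - \sum_s Gam s mu nu y * nabla1 lam s c y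
  - \sum_s Gam s mu c y * nabla1 lam nu s y.

(* R_{mu nu c}^s, read off from
     nabla_mu nabla_nu lambda_c - nabla_nu nabla_mu lambda_c
       = R_{mu nu c}^s lambda_s
   by taking lambda = dx^s; both sides are tensorial in lambda. *)
Definition Riem (mu nu c s : 'I_4) (y : pt4) : R :=
  let dx := fun (c' : 'I_4) (_ : pt4) => (c' == s)%:R : R in
  nabla2 dx mu nu c y - nabla2 dx nu mu c y.

Definition Ric (mu c : 'I_4) (y : pt4) : R := \sum_nu Riem mu nu c nu y.

Definition Ric_mixed (nu lam : 'I_4) (y : pt4) : R :=
  \sum_c Ric nu c y * ginv y c lam.

Definition lorentzian : Prop :=
  smooth_on setT (g X) /\
  forall y, (g X y)^T = g X y /\
    exists2 P : 'M[R]_4, P \in unitmx & P *m g X y *m P^T = minkowski R.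

Definition equation_of_state : Prop :=
  [/\ 0 < rho0 X, rho0 X < rho1 X, smooth_closed (`[0, +oo[ : set R) (rho X),
      rho X 0 = rho0 X &
      forall q : R, 0 <= q -> rho0 X <= rho X q <= rho1 X /\ 0 < derive1 (rho X) q].

(* Square of the sound speed, as a function of zeta. *)
Definition s2 (z : R) : R := (derive1 (rho X) (p X z))^-1.

(* Both equations are posed on [1, +oo[, i.e. p >= 0, and, as for Ck_closed,
   continue to hold near zeta = 1. *)
Definition pressure_function : Prop :=
  p X 1 = 0 /\
  exists N : set R, [/\ open N, `[1, +oo[ `<=` N &
    forall z, N z -> is_derive z 1 (p X) ((rho X (p X z) + p X z) / z)].

Definition F_function : Prop :=
  F X 1 = 1 /\
  exists N : set R, [/\ open N, `[1, +oo[ `<=` N &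
    forall z, N z -> is_derive z 1 (F X) (- F X z / (z * s2 z))].

Definition f (z : R) : R := - (z * F X z).

Definition w2 (y : pt4) : R := - gprod y (w X y) (w X y).

Definition zeta (y : pt4) : R := (Num.sqrt (w2 y))^-1.

Definition w_low (y : pt4) (mu : 'I_4) : R := \sum_nu g X y mu nu * w X y ord0 nu.

Definition Acoef (mu nu c : 'I_4) (y : pt4) : R :=
  (3 + (s2 (zeta y))^-1) * (w_low y mu * w_low y nu / w2 y) * w X y ord0 c
  + (c == nu)%:R * w_low y mu + (c == mu)%:R * w_low y nu
  + w X y ord0 c * g X y mu nu.

Definition nabla_w (c nu : 'I_4) (y : pt4) : R :=
  pd c (fun z => w X z ord0 nu) y + \sum_a Gam nu c a y * w X y ord0 a.

Definition FWE_on (A : set pt4) : Prop :=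
  forall y, A y -> forall mu,
    \sum_c \sum_nu Acoef mu nu c y * nabla_w c nu y = 0.

(* w is timelike where it is defined, and zeta >= 1 on U, so that
   p(zeta) lies in the domain [0, +oo[ of rho. *)
Definition fluid_solution : Prop :=
  [/\ (8 <= k X)%N, Ck_closed (k X) (closure (U X)) (w X),
      forall y, closure (U X) y -> 0 < w2 y,
      forall y, U X y -> 1 <= zeta y
    & FWE_on (U X)].

Definition sound_speed_bounds (cm cp : R) : Prop :=
  [/\ 0 < cm, cp < 1 & forall y, U X y -> cm <= s2 (zeta y) <= cp].

Definition slice (A : set 'rV[R]_3) : set pt4 := [set pt 0 y | y in A].

(* U is diffeomorphic to a cylinder ]a, b[ x Omega: the diffeomorphism Psi is
   the identity on the base {0} x Omega and has timelike generators. *)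
Definition timelike_cylinder : Prop :=
  exists (a b : R) (Psi Psi' : pt4 -> pt4),
    let C := [set x : pt4 | a < x ord0 ord0 < b /\ Omega X (space x)] in
    [/\ a < 0 < b,
        smooth_on C Psi /\ smooth_on (U X) Psi',
        (forall x, C x -> U X (Psi x) /\ Psi' (Psi x) = x) /\
        (forall y, U X y -> C (Psi' y) /\ Psi (Psi' y) = y),
        forall y, Omega X y -> Psi (pt 0 y) = pt 0 y &
        forall x, C x -> let v := 'D_(delta_mx ord0 ord0) Psi x in
          gprod (Psi x) v v < 0].

Definition cylinder_domain : Prop :=
  [/\ open (Omega X), bounded_set (Omega X) & smooth_boundary (Omega X)] /\
  [/\ open (U X), bounded_set (U X) & timelike_cylinder].

(* (flow_dom, flow) is a C^k local flow of w; it need not be the maximal one. *)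
Definition is_flow : Prop :=
  [/\ open (flow_dom X), Ck_on (k X) (flow_dom X) (flow X),
      (forall x, U X x -> flow_dom X (0, x)),
      (forall t x, flow_dom X (t, x) ->
         forall s, 0 <= s <= 1 -> flow_dom X (s * t, x)) &
      (forall t x, flow_dom X (t, x) ->
         flow X (0, x) = x /\
         is_derive t 1 (fun s : R => flow X (s, x)) (w X (flow X (t, x))))].

Definition U_T : set pt4 :=
  \bigcup_(t in `[0, T X]) [set flow X (t, x) | x in slice (Omega X)].

Definition flow_invariant : Prop :=
  [/\ is_flow,
      forall t x, flow_dom X (t, x) -> U X x -> U X (flow X (t, x)),
      0 < T X,
      forall t y, 0 <= t <= T X -> closure (Omega X) y -> flow_dom X (t, pt 0 y) &
      U_T `<=` U X].

Definition Omega_T : set pt4 :=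
  [set x : pt4 | 0 <= x ord0 ord0 <= T X /\ Omega X (space x)].

Definition Gamma_T : set pt4 :=
  [set x : pt4 | 0 <= x ord0 ord0 <= T X /\ bd (Omega X) (space x)].

Definition phi (x : pt4) : pt4 := flow X (x ord0 ord0, pt 0 (space x)).

(* [J x mu nu] is J^mu_nu, the derivative of phi^mu along coordinate nu. *)
Definition J (x : pt4) : 'M[R]_4 :=
  \matrix_(mu, nu) pd nu (fun z => phi z ord0 mu) x.

Definition Jinv (x : pt4) : 'M[R]_4 := invmx (J x).

(* phi is a change of coordinates: J is invertible up to the boundary. *)
Definition lagrangian_coordinates : Prop :=
  forall x, Omega_T x \/ Gamma_T x -> J x \in unitmx.

Definition push (x u : pt4) : pt4 := u *m (J x)^T.

Definition TGamma (x : pt4) : set pt4 :=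
  [set u | tangent_bd (Omega X) (space x) (space u)].

(* Tangent space of B_T = phi(Gamma_T) at phi(x). *)
Definition TB (x : pt4) : set pt4 := [set push x u | u in TGamma x].

(* B_T is swept out by the flow; its tangent spaces being images of those of
   Gamma_T, they contain the timelike vector w. *)
Definition w_tangent : Prop :=
  forall x, Gamma_T x -> TB x (w X (phi x)).

Definition outward_unit_normal (x n : pt4) : Prop :=
  [/\ forall v, TB x v -> gprod (phi x) n v = 0,
      gprod (phi x) n n = 1 &
      exists2 u, outward_bd (Omega X) (space x) (space u) & n = push x u].

Definition taylor_sign (cp : R) : Prop :=
  [/\ 0 < cp,
      forall x, Gamma_T x -> p X (zeta (phi x)) = 0 &
      forall x n, Gamma_T x -> outward_unit_normal x n ->
        cp <= - 'D_n (fun y => p X (zeta y)) (phi x)].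

Definition e (i : 'I_4) : pt4 -> pt4 :=
  if unlift ord0 i is Some K then e_sp X K else w X.

(* Column i of [E y] is e_i(y), so row i of its inverse is theta^i(y). *)
Definition E (y : pt4) : 'M[R]_4 := \matrix_(mu, i) e i y ord0 mu.

Definition theta (y : pt4) : 'M[R]_4 := invmx (E y).

Definition gamma (y : pt4) (i j : 'I_4) : R := gprod y (e i y) (e j y).

Definition sigma (i l j : 'I_4) (y : pt4) : R :=
  \sum_mu theta y l mu * lie_bracket (e i) (e j) y ord0 mu.

(* Column i is the pulled-back field phi^* e_i. *)
Definition Ebar (x : pt4) : 'M[R]_4 := Jinv x *m E (phi x).

Definition ebar (i : 'I_4) (x : pt4) : pt4 := (col i (Ebar x))^T.

Definition theta_bar (x : pt4) : 'M[R]_4 := invmx (Ebar x).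

(* The transported fields lose one derivative with respect to their C^k initial
   data.  That e_0 pulls back to the coordinate field of x^0 and that the ebar_i
   do not depend on x^0 are consequences, hence not listed. *)
Definition adapted_frame : Prop :=
  [/\ forall K, Ck_closed (k X).-1 (closure U_T) (e_sp X K) /\
        Ck_closed (k X) (closure (Omega X)) (fun y => e_sp X K (pt 0 y)),
      forall K y, U_T y -> lie_bracket (e ord0) (e (sp K)) y = 0,
      forall y, slice (Omega X) y ->
        (forall K, gamma y ord0 (sp K) = 0) /\
        \det (\matrix_(K < 3, L < 3) gamma y (sp K) (sp L))
          = (F X ((Num.sqrt (- gamma y ord0 ord0))^-1)) ^+ 2 &
      forall x, Gamma_T x ->
        (forall v, TGamma x v <->
           exists c : 'I_4 -> R, c ord_max = 0 /\ v = \sum_i c i *: ebar i x) /\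
        outward_bd (Omega X) (space x) (space (ebar ord_max x))].

(* From here on x is a point of the Lagrangian domain, and the suffix _t stands
   for a tilde, i.e. evaluation at phi(x). *)

Definition theta_t (i nu : 'I_4) (x : pt4) : R := theta (phi x) i nu.
Definition e0_t (mu : 'I_4) (x : pt4) : R := e ord0 (phi x) ord0 mu.
Definition ginv_t (mu nu : 'I_4) (x : pt4) : R := ginv (phi x) mu nu.
Definition Gam_t (c a b : 'I_4) (x : pt4) : R := Gam c a b (phi x).
Definition Ric_t (nu lam : 'I_4) (x : pt4) : R := Ric_mixed nu lam (phi x).
Definition sigma_t (i l j : 'I_4) (x : pt4) : R := sigma i l j (phi x).
Definition gamma_t (i j : 'I_4) (x : pt4) : R := gamma (phi x) i j.
Definition s2_t (x : pt4) : R := s2 ((Num.sqrt (- gamma_t ord0 ord0 x))^-1).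
Definition f_t (x : pt4) : R := f ((Num.sqrt (- gamma_t ord0 ord0 x))^-1).

Definition a_t (mu nu : 'I_4) (x : pt4) : R :=
  ginv_t mu nu x
  - (gamma_t ord0 ord0 x)^-1 * (1 - (s2_t x)^-1) * e0_t mu x * e0_t nu x.

Definition a_bar (al be : 'I_4) (x : pt4) : R :=
  \sum_mu \sum_nu Jinv x al mu * Jinv x be nu * a_t mu nu x.

Definition A_t (al be : 'I_4) (x : pt4) : R :=
  - (\det (J x) / f_t x) * a_bar al be x.

Definition L_t (al nu : 'I_4) (x : pt4) : R :=
  - (\det (J x) / f_t x) * \sum_be a_bar al be x *
    (- (\sum_om \sum_c J x om be * Gam_t c om nu x * theta_t ord0 c x)
     + \sum_(M < 3) \sum_(L < 3)
         sigma_t (sp M) ord0 (sp L) x * theta_bar x (sp M) be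
           * theta_t (sp L) nu x).

Definition Y_t (al nu : 'I_4) (x : pt4) : R :=
  (f_t x)^-1 * \sum_be a_t al be x *
    (\sum_c Jinv x c be * pd c (theta_t ord0 nu) x
     - \sum_c Gam_t c be nu x * theta_t ord0 c x
     + \sum_(M < 3) \sum_(L < 3)
         sigma_t (sp M) ord0 (sp L) x * theta_t (sp M) be x
           * theta_t (sp L) nu x).

Definition F_t (nu : 'I_4) (x : pt4) : R :=
  - \det (J x) *
    (- (\sum_al \sum_c Gam_t al al c x * Y_t c nu x)
     + \sum_al \sum_c Gam_t c al nu x * Y_t al c x
     + (f_t x)^-1 * \sum_lam Ric_t nu lam x * theta_t ord0 lam x).

Definition beta (lam nu : 'I_4) (x : pt4) : R :=
  - \sum_c e0_t c x * Gam_t lam c nu x.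

Definition D0 (xi : 'I_4 -> pt4 -> R) (nu : 'I_4) (x : pt4) : R :=
  pd ord0 (xi nu) x + \sum_lam beta lam nu x * xi lam x.

Definition psi : 'I_4 -> pt4 -> R := D0 (theta_t ord0).

Definition m_t (al be : 'I_4) (x : pt4) : R :=
  ginv_t al be x - 2 / gamma_t ord0 ord0 x * e0_t al x * e0_t be x.

Definition psi_sq (x : pt4) : R :=
  \sum_al \sum_be m_t al be x * psi al x * psi be x.

Definition psi_hat (nu : 'I_4) (x : pt4) : R := psi nu x / Num.sqrt (psi_sq x).

Definition theta3_norm (x : pt4) : R :=
  Num.sqrt (\sum_al \sum_be
    ginv_t al be x * theta_t ord_max al x * theta_t ord_max be x).

End Body.

(* Main.v *)
Require Import Defs.
From HB Require Import structures.
From mathcomp Require Import perm ring lra.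

Import Order.TTheory GRing.Theory Num.Theory.
Import numFieldNormedType.Exports.

Local Open Scope classical_set_scope.
Local Open Scope ring_scope.

(** Two obstacles shape the proof. First, [pd] is a two-sided derivative, whereas transported
    identities such as [theta^0_mu = w_mu / gamma_00] are known only on the closed fluid region. All
    objects are therefore shown to be regular on open neighbourhoods [N] and [M]. Since the
    functions compared are differentiable there, an identity on the cylinder alone still fixes their
    derivatives, through one-sided increments that stay inside; continuity then carries it to the
    lateral boundary. Second, the frame has to be shown invertible: the initial normalization gives
    the Gram determinant [gamma_00 F^2], and [F] cannot vanish because [F (rho + p) / zeta] is
    constantly [rho_0]. The factor f comes from [df / f = (1 - 1/s^2) dzeta / zeta]. This is what
    turns the Euler equations contracted with w into div l = 0, and the same term, absorbed into the
    inverse metric, gives the acoustic metric. *)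

(** The orthogonality gamma_0J = 0 and [e_0, e_J] = 0 are transported from the
    initial slice along the flow, so that theta^0_mu = w_mu / gamma_00 on the
    closed fluid region.  Put l^a = theta^{0 a} / f.  The equations of motion say
    that theta^0 is Lie-transported by w and that div l = 0.  The structure equation
    for d theta^0 exchanges the two indices of nabla theta^0 at the cost of the sigma
    terms, and turns Y^a_nu into nabla_nu l^a, whose divergence is R_nu^c l_c by the
    Ricci identity and div l = 0; the Piola identity carries this over to the
    Lagrangian coordinates and gives the wave equation.

    On the free boundary p vanishes while p >= 0 inside, so dp annihilates
    e_0, e_1, e_2 there and dp = e_3(p) theta^3, with e_3(p) < 0 by the Taylor sign
    condition.  Since psi is dp / rho_0, it is a negative multiple of theta^3, which
    is orthogonal to w, and |theta^3| psi-hat = - theta^3.  As theta^3 is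
    Lie-transported by w, D_0 of this is theta^3_c nabla_nu w^c, which up to the factor
    is the conormal component of the flux det(J) Y. *)

(** * Directional derivatives, one-sided increments, symmetry of second derivatives *)

Section Calculus.
Set Implicit Arguments.
Unset Strict Implicit.
Variable R : realType.
Implicit Types V W : normedModType R.

Lemma near_eq_differentiable V W (f h : V -> W) x :
  (\forall z \near x, f z = h z) -> differentiable f x -> differentiable h x.
Proof.
move=> fh /diff_locallyP [cd fE].
have hx : f x = h x by exact: nbhs_singleton fh.
have fh0 : \forall z \near (0:V), f (z + x) = h (z + x).
  by move: fh; rewrite (near_shift 0) /= ; apply: filterS => z; rewrite /= subr0.
have E : h \o shift x = cst (h x) + 'd f x +o_ 0 id.
  apply/eqaddoP => e e0.
  move/eqaddoP : fE => /(_ e e0) fE; near=> z.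
  have -> : (h \o shift x - (cst (h x) + 'd f x)) z = (f \o shift x - (cst (f x) + 'd f x)) z.
    by rewrite /= !fctE /= -hx; congr (_ - _); symmetry; near: z.
  by near: z.
apply/diff_locallyP.
have dE : 'd h x = 'd f x :> (V -> W) by apply: diff_unique.
by rewrite dE; split.
Unshelve. all: by end_near. Qed.

Lemma differentiable_eps V W (f : V -> W) x : differentiable f x ->
  forall e, 0 < e -> \forall z \near (0:V), `|f (x + z) - f x - 'D_z f x| <= e * `|z|.
Proof.
move=> df e e0; have /diff_locallyP [_ /eqaddoP/(_ e e0)] := df.
by apply: filterS => z /=; rewrite !fctE /= opprD addrA addrC (addrC z) deriveE // addrC.
Qed.

Lemma diffble_cst V W (c : W) x : differentiable (fun _ : V => c) x.
Proof. exact: differentiable_cst. Qed.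
Lemma diffble_add V (f h : V -> R) x : differentiable f x -> differentiable h x ->
  differentiable (fun z => f z + h z) x.
Proof. exact: differentiableD. Qed.
Lemma diffble_opp V (f : V -> R) x : differentiable f x ->
  differentiable (fun z => - f z) x.
Proof. exact: differentiableN. Qed.
Lemma diffble_mul V (f h : V -> R) x : differentiable f x -> differentiable h x ->
  differentiable (fun z => f z * h z) x.
Proof. exact: differentiableM. Qed.
Lemma diffble_inv V (f : V -> R) x : differentiable f x -> f x != 0 ->
  differentiable (fun z => (f z)^-1) x.
Proof. exact: differentiableV. Qed.
Lemma diffble_sum V (I : Type) (r : seq I) (F : I -> V -> R) x :
  (forall i, differentiable (F i) x) ->
  differentiable (fun z => \sum_(i <- r) F i z) x.
Proof.
move=> dF; elim: r => [|i r IH].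
  by under eq_fun do rewrite big_nil; exact: diffble_cst.
by under eq_fun do rewrite big_cons; exact: diffble_add.
Qed.
Lemma diffble_comp V W (f : W -> R) (u : V -> W) x : differentiable u x ->
  differentiable f (u x) -> differentiable (fun z => f (u z)) x.
Proof. exact: differentiable_comp. Qed.

Lemma dcst V W (c : W) (x v : V) : 'D_v (fun _ : V => c) x = 0.
Proof. exact: derive_cst. Qed.
Lemma dadd V (f h : V -> R) x v : differentiable f x -> differentiable h x ->
  'D_v (fun z => f z + h z) x = 'D_v f x + 'D_v h x.
Proof. by move=> df dh; rewrite -deriveD //; exact: diff_derivable. Qed.
Lemma dopp V (f : V -> R) x v : differentiable f x ->
  'D_v (fun z => - f z) x = - 'D_v f x.
Proof. by move=> df; rewrite -deriveN //; exact: diff_derivable. Qed.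
Lemma dsub V (f h : V -> R) x v : differentiable f x -> differentiable h x ->
  'D_v (fun z => f z - h z) x = 'D_v f x - 'D_v h x.
Proof. by move=> df dh; rewrite dadd ?dopp //; exact: diffble_opp. Qed.
Lemma dmul V (f h : V -> R) x v : differentiable f x -> differentiable h x ->
  'D_v (fun z => f z * h z) x = 'D_v f x * h x + f x * 'D_v h x.
Proof.
move=> df dh; transitivity ('D_v (f * h) x); first by [].
by rewrite deriveM; [rewrite addrC; congr (_ + _); exact: mulrC|exact: diff_derivable..].
Qed.
Lemma dinv V (f : V -> R) x v : differentiable f x -> f x != 0 ->
  'D_v (fun z => (f z)^-1) x = - ('D_v f x * (f x)^-1 ^+ 2).
Proof.
move=> df f0; rewrite deriveV //; last exact: diff_derivable.
by rewrite /GRing.scale /= mulNr mulrC exprVn.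
Qed.
Lemma dsum V (I : Type) (r : seq I) (F : I -> V -> R) x v :
  (forall i, differentiable (F i) x) ->
  'D_v (fun z => \sum_(i <- r) F i z) x = \sum_(i <- r) 'D_v (F i) x.
Proof.
move=> dF; elim: r => [|i r IH].
  by under eq_fun do rewrite big_nil; rewrite dcst big_nil.
under eq_fun do rewrite big_cons.
by rewrite dadd // ?IH ?big_cons//; exact: diffble_sum.
Qed.
Lemma dcomp V W W' (f : W -> W') (u : V -> W) x v : differentiable u x ->
  differentiable f (u x) -> 'D_v (fun z => f (u z)) x = 'D_('D_v u x) f (u x).
Proof.
move=> du df; have dfu : differentiable (f \o u) x by exact: differentiable_comp.
by rewrite !deriveE // diff_comp.
Qed.
Lemma dcomp1 V (f : R -> R) (u : V -> R) x v f' : differentiable u x ->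
  is_derive (u x) 1 f f' -> 'D_v (fun z => f (u z)) x = f' * 'D_v u x.
Proof.
move=> du [df <-]; have df' : differentiable f (u x) by exact/derivable1_diffP.
by rewrite dcomp // deriveE // diff1E // derive1E mulrC.
Qed.
Lemma diffble_comp1 V (f : R -> R) (u : V -> R) x : differentiable u x ->
  derivable f (u x) 1 -> differentiable (fun z => f (u z)) x.
Proof. by move=> du df; apply: diffble_comp => //; exact/derivable1_diffP. Qed.

Lemma dlin V W (f : V -> W) x (c : R) u v : differentiable f x ->
  'D_(c *: u + v) f x = c *: 'D_u f x + 'D_v f x.
Proof. by move=> df; rewrite !deriveE // linearP. Qed.
Lemma dlinZ V (f : V -> R) x (c : R) v : differentiable f x ->
  'D_(c *: v) f x = c * 'D_v f x.
Proof. by move=> df; rewrite !deriveE // linearZ. Qed.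
Lemma dlinN V W (f : V -> W) x v : differentiable f x ->
  'D_(- v) f x = - 'D_v f x.
Proof. by move=> df; rewrite !deriveE // linearN. Qed.
Lemma dlinB V W (f : V -> W) x u v : differentiable f x ->
  'D_(u - v) f x = 'D_u f x - 'D_v f x.
Proof. by move=> df; rewrite !deriveE // linearB. Qed.
Lemma dlin_sum V W (f : V -> W) x (I : Type) (r : seq I) (c : I -> R) (u : I -> V) :
  differentiable f x ->
  'D_(\sum_(i <- r) c i *: u i) f x = \sum_(i <- r) c i *: 'D_(u i) f x.
Proof.
move=> df; rewrite deriveE // linear_sum; apply: eq_bigr => i _.
by rewrite linearZ deriveE.
Qed.
Lemma dlin_row n W (f : 'rV[R]_n -> W) x v : differentiable f x ->
  'D_v f x = \sum_i v ord0 i *: 'D_(delta_mx ord0 i) f x.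
Proof. by move=> df; rewrite {1}[v]row_sum_delta dlin_sum. Qed.

Lemma diffble_coord V m n (u : V -> 'M[R]_(m, n)) x i j : differentiable u x ->
  differentiable (fun z => u z i j) x.
Proof.
move=> du; apply: (@diffble_comp _ _ (fun M : 'M[R]_(m, n) => M i j) u) => //.
exact: differentiable_coord.
Qed.
Lemma dcoord V m n (u : V -> 'M[R]_(m, n)) x v i j : differentiable u x ->
  'D_v (fun z => u z i j) x = 'D_v u x i j.
Proof. by move=> du; rewrite derive_mx ?mxE //; exact: diff_derivable. Qed.

(** For a differentiable function the increments in the direction v from one side already determine
    the derivative. This extracts derivatives at points where the sign or value of f is known only
    on one side: the ends of the time interval and the free boundary. *)
Lemma onesided_ge0 V (f : V -> R) x v : differentiable f x -> f x = 0 ->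
  (\forall h \near (0:R)^'+, 0 <= f (x + h *: v)) -> 0 <= 'D_v f x.
Proof.
move=> df fx0 fge.
apply/ler_addgt0Pl => e e0.
(* The summand 1 keeps the denominator positive when [v = 0]. *)
have e1 : 0 < e / (`|v| + 1) by rewrite divr_gt0 // ltr_wpDl.
have Hd := differentiable_eps df e1.
have Hh : \forall h \near (0:R)^'+, `|f (x + h *: v) - f x - 'D_(h *: v) f x| <= e / (`|v| + 1) * `|h *: v|.
  have c0 : (fun h : R => h *: v) @ 0^'+ --> (0 : V).
    apply: cvg_at_right_filter; rewrite -[X in _ --> X](scale0r v).
    by apply: cvgZ; [exact: cvg_id|exact: cvg_cst].
  exact: c0 Hd.
near (0:R)^'+ => h.
have h0 : 0 < h by near: h; exact: nbhs_right_gt.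
have H1 : 0 <= f (x + h *: v) by near: h.
have : `|f (x + h *: v) - f x - 'D_(h *: v) f x| <= e / (`|v| + 1) * `|h *: v| by near: h.
rewrite fx0 subr0 dlinZ // normrZ gtr0_norm //.
move=> /ler_normlP [_ H3].
have H4 : e / (`|v| + 1) * (h * `|v|) <= e * h.
  rewrite -mulrA ler_pM2l // mulrCA -[leRHS]mulr1 ler_pM2l //.
  by rewrite mulrC ler_pdivrMr ?mul1r ?lerDl // ltr_wpDl.
have H5 : 0 <= h * (e + 'D_v f x) by lra.
by rewrite pmulr_rge0 in H5.
Unshelve. all: by end_near. Qed.

Lemma onesided_eq0 V (f : V -> R) x v : differentiable f x -> f x = 0 ->
  (\forall h \near (0:R)^'+, f (x + h *: v) = 0) -> 'D_v f x = 0.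
Proof.
move=> df fx0 fe; apply/eqP; rewrite eq_le; apply/andP; split.
  rewrite -oppr_ge0 -dopp //; apply: onesided_ge0; rewrite ?fx0 ?oppr0 //.
    exact: diffble_opp.
  by apply: filterS fe => h ->; rewrite oppr0.
by apply: onesided_ge0 => //; apply: filterS fe => h ->.
Qed.

Lemma nbhs_norm V (P : V -> Prop) x : (\forall z \near x, P z) ->
  exists2 d, 0 < d & forall z, `|z - x| < d -> P z.
Proof.
move=> /nbhs_ballP [d /= d0 H]; exists d => // z zx; apply: H.
by rewrite -ball_normE /= distrC.
Qed.

Lemma right_ex (P : R -> Prop) : (\forall h \near (0:R)^'+, P h) ->
  exists2 h, 0 < h & P h.
Proof.
move=> H; near (0:R)^'+ => h; exists h; near: h => //; exact: nbhs_right_gt.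
Unshelve. all: by end_near. Qed.

Lemma is_derive_line V (f : V -> R) x u s : differentiable f (x + s *: u) ->
  is_derive s 1 (fun t : R => f (x + t *: u)) ('D_u f (x + s *: u)).
Proof.
move=> df; have dl : is_diff s (fun t : R => x + t *: u) (fun t : R => t *: u).
  by apply: is_diff_eq; rewrite add0r.
have dl' : differentiable (fun t : R => x + t *: u) s by [].
apply: DeriveDef; first by apply/derivable1_diffP; exact: diffble_comp.
rewrite (@dcomp _ _ _ f (fun t : R => x + t *: u)) //.
suff -> : 'D_1 (fun t : R => x + t *: u) s = u by [].
by rewrite deriveE // diff_val scale1r.
Qed.

Let ler_dist_sub (a1 a2 b l1 l2 r1 r2 r : R) : `|a1 - b - l1| <= r1 ->
  `|a2 - b - l2| <= r2 -> r1 + r2 <= r -> `|a1 - a2 - (l1 - l2)| <= r.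
Proof.
move=> h1 h2 h3; have -> : a1 - a2 - (l1 - l2) = (a1 - b - l1) - (a2 - b - l2) by ring.
apply: le_trans h3; apply: (le_trans (ler_normB _ _)); exact: lerD.
Qed.

(* Both mixed derivatives are limits of the same second difference quotient. *)
Lemma young_eps V (f : V -> R) x u v : (\forall z \near x, differentiable f z) ->
  differentiable ('D_u f) x -> forall e, 0 < e -> \forall h \near (0:R)^'+,
  `|f (x + h *: u + h *: v) - f (x + h *: u) - f (x + h *: v) + f x
    - h ^+ 2 * 'D_v ('D_u f) x| <= e * h ^+ 2.
Proof.
move=> /nbhs_norm [d1 d10 df] du e e0.
(* The derivative of ['D_u f] will be used at the two increments [c u + h v] and [c u] with
   [c <= h], whose norms add up to at most [h (2|u| + |v|)]; the summand 1 keeps [M] positive. *)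
pose M := 2 * `|u| + `|v| + 1.
have M0 : 0 < M by rewrite /M ltr_wpDl // addr_ge0 // mulr_ge0.
have eM : 0 < e / M by rewrite divr_gt0.
have [d2 d20 Hd] := nbhs_norm (differentiable_eps du eM).
near=> h.
have h0 : 0 < h by near: h; exact: nbhs_right_gt.
have hM1 : h < d1 / M by near: h; apply: nbhs_right_lt; rewrite divr_gt0.
have hM2 : h < d2 / M by near: h; apply: nbhs_right_lt; rewrite divr_gt0.
rewrite ltr_pdivlMr // in hM1; rewrite ltr_pdivlMr // in hM2.
have bnd s b : 0 <= s <= h -> 0 <= b <= h -> `|s *: u + b *: v| < h * M.
  move=> /andP[s0 sh] /andP[b0 bh]; apply: (le_lt_trans (ler_normD _ _)).
  rewrite !normrZ !ger0_norm //.
  apply: (@le_lt_trans _ _ (h * `|u| + h * `|v|)).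
    by apply: lerD; apply: ler_wpM2r.
  rewrite -mulrDr ltr_pM2l // /M; have := normr_ge0 u; lra.
have dfs s b : 0 <= s <= h -> 0 <= b <= h -> differentiable f (x + b *: v + s *: u).
  move=> hs hb; apply: df.
  have -> : x + b *: v + s *: u - x = s *: u + b *: v.
    by rewrite -[x + _ + _]addrA [x + _]addrC addrK addrC.
  exact: lt_trans (bnd _ _ hs hb) hM1.
pose G s := f (x + h *: v + s *: u) - f (x + s *: u).
pose dG s := 'D_u f (x + h *: v + s *: u) - 'D_u f (x + s *: u).
have hh : 0 <= h <= h by rewrite lexx ltW.
have h00 : (0:R) <= 0 <= h by rewrite lexx ltW.
have dfs' s : 0 <= s <= h -> differentiable f (x + s *: u).
  by move=> hs; have := dfs s 0 hs h00; rewrite scale0r addr0.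
have GD s : 0 <= s <= h -> is_derive s 1 G (dG s).
  move=> hs; apply: is_deriveB; first by apply: is_derive_line; exact: dfs.
  by apply: is_derive_line; exact: dfs'.
have Gc : {within `[0, h], continuous G}.
  apply: derivable_within_continuous => s; rewrite in_itv /= => hs.
  by have [] := GD s hs.
(* The mean value theorem in the u-direction turns the second difference into one difference of
   ['D_u f], for which differentiability at the single point x suffices. *)
have [c ch GE] : exists2 c, c \in `]0, h[%R & G h - G 0 = dG c * (h - 0).
  apply: MVT => // s; rewrite in_itv /= => /andP[s0 sh].
  by apply: GD; rewrite !ltW.
have hc : 0 <= c <= h by move: ch; rewrite in_itv /= => /andP[? ?]; rewrite !ltW.
have r1 := Hd (c *: u + h *: v); have r2 := Hd (c *: u + 0 *: v).
rewrite subr0 in r1; rewrite subr0 in r2.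
have {}r1 := r1 (lt_trans (bnd _ _ hc hh) hM2).
have {}r2 := r2 (lt_trans (bnd _ _ hc h00) hM2).
have n1 : e / M * `|c *: u + h *: v| + e / M * `|c *: u + 0 *: v| <= e * h.
  rewrite -mulrDr -mulrA ler_pM2l // mulrC ler_pdivrMr //.
  move: hc => /andP[c0 c1]; rewrite scale0r addr0.
  have n0 : `|c *: u| <= h * `|u| by rewrite normrZ ger0_norm // ler_wpM2r.
  have n2 : `|c *: u + h *: v| <= h * `|u| + h * `|v|.
    by apply: (le_trans (ler_normD _ _)); rewrite lerD // normrZ gtr0_norm.
  apply: (le_trans (lerD n2 n0)).
  have -> : h * `|u| + h * `|v| + h * `|u| = h * (2 * `|u| + `|v|) by ring.
  by rewrite ler_pM2l // /M lerDl.
rewrite addrA in r1.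
have l1 : 'D_(c *: u + h *: v) ('D_u f) x - 'D_(c *: u + 0 *: v) ('D_u f) x = h * 'D_v ('D_u f) x.
  by rewrite -dlinB // opprD addrACA subrr add0r scale0r subr0 dlinZ.
have dGE : `|dG c - h * 'D_v ('D_u f) x| <= e * h.
  rewrite scale0r addr0 in l1 n1 r2.
  rewrite /dG -l1 [x + h *: v + c *: u]addrAC; exact: ler_dist_sub r1 r2 n1.
have -> : f (x + h *: u + h *: v) - f (x + h *: u) - f (x + h *: v) + f x
    - h ^+ 2 * 'D_v ('D_u f) x = h * (dG c - h * 'D_v ('D_u f) x).
  have := GE; rewrite /G subr0 !scale0r !addr0 [x + h *: v + h *: u]addrAC => GE'.
  by rewrite mulrBr [h * dG c]mulrC -GE'; ring.
rewrite normrM (gtr0_norm h0) expr2 mulrCA ler_pM2l //.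
Unshelve. all: by end_near. Qed.

Lemma young V (f : V -> R) x u v : (\forall z \near x, differentiable f z) ->
  differentiable ('D_u f) x -> differentiable ('D_v f) x ->
  'D_u ('D_v f) x = 'D_v ('D_u f) x.
Proof.
move=> df du dv; apply/eqP; rewrite -subr_eq0 -normr_le0.
apply/ler_addgt0Pl => e e0.
have e2 : 0 < e / 2 by rewrite divr_gt0.
have H1 := young_eps v df du e2; have H2 := young_eps u df dv e2.
have [h h0 [A1 A2]] := right_ex (filterI H1 H2).
rewrite [x + h *: v + h *: u]addrAC [X in `|X + _ - _|]addrAC in A2.
set S := _ + f x in A1 A2.
have h2 : 0 < h ^+ 2 by rewrite exprn_gt0.
rewrite addr0 -(ler_pM2l h2) -[X in X * `|_|]gtr0_norm // -normrM.
have -> : h ^+ 2 * ('D_u ('D_v f) x - 'D_v ('D_u f) x)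
   = (S - h ^+ 2 * 'D_v ('D_u f) x) - (S - h ^+ 2 * 'D_u ('D_v f) x).
  by rewrite mulrBr opprB [RHS]addrC addrA subrK.
apply: (le_trans (ler_normB _ _)); apply: (le_trans (lerD A1 A2)).
by rewrite -mulrDl -splitr mulrC.
Qed.
End Calculus.

(** * Closure properties of the classes C^k; determinants and inverse matrices *)

Section CkCalculus.
Set Implicit Arguments.
Unset Strict Implicit.
Variable R : realType.
Implicit Types V W : normedModType R.

Lemma Ck_split n V W (N : set V) (f : V -> W) : Ck_on n.+1 N f ->
  (forall x, N x -> differentiable f x) /\ (forall v, Ck_on n N ('D_v f)).
Proof. by []. Qed.

Lemma Ck_ext n V W (N : set V) (f h : V -> W) : open N ->
  (forall x, N x -> f x = h x) -> Ck_on n N f -> Ck_on n N h.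
Proof.
move=> oN; elim: n f h => [|n IH] f h fh /=.
  move=> cf x Nx; have fhx : \forall z \near x, h z = f z.
    by apply: filterS (open_nbhs_nbhs (conj oN Nx)) => z /fh.
  have := cf x Nx; rewrite /prop_for /continuous_at (fh x Nx) => H.
  by apply: cvg_trans H; apply: near_eq_cvg; apply: filterS fhx => z ->.
move=> [df Df]; split=> [x Nx|v].
  apply: near_eq_differentiable (df x Nx).
  by apply: filterS (open_nbhs_nbhs (conj oN Nx)) => z /fh.
apply: IH (Df v) => x Nx; apply: near_eq_derive.
by apply: filterS (open_nbhs_nbhs (conj oN Nx)) => z /fh.
Qed.

Lemma Ck_extR n V (N : set V) (f h : V -> R) : open N ->
  (forall x, N x -> f x = h x) -> Ck_on n N f -> Ck_on n N h.
Proof. exact: Ck_ext. Qed.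

Lemma Ck_sub n V W (N N' : set V) (f : V -> W) : N `<=` N' ->
  Ck_on n N' f -> Ck_on n N f.
Proof.
move=> s; elim: n f => [|n IH] f /=; first by move=> cf x /s /cf.
by move=> [df Df]; split=> [x /s /df //|v]; exact: IH (Df v).
Qed.

Lemma CkS n V W (N : set V) (f : V -> W) : Ck_on n.+1 N f -> Ck_on n N f.
Proof.
elim: n f => [|n IH] f [df Df] /=.
  by move=> x Nx; apply: differentiable_continuous; exact: df.
by split=> // v; exact: IH (Df v).
Qed.

Lemma Ck_le m n V W (N : set V) (f : V -> W) : (m <= n)%N ->
  Ck_on n N f -> Ck_on m N f.
Proof.
move=> mn; rewrite -(subnK mn); elim: (n - m)%N => [//|k IH] /CkS; exact: IH.
Qed.

Lemma Ck_cont n V W (N : set V) (f : V -> W) : Ck_on n N f ->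
  forall x, N x -> {for x, continuous f}.
Proof. by move=> /(Ck_le (leq0n n)). Qed.

Lemma Ck_diff n V W (N : set V) (f : V -> W) : Ck_on n.+1 N f ->
  forall x, N x -> differentiable f x.
Proof. by case. Qed.

Lemma Ck_D n V W (N : set V) (f : V -> W) v : Ck_on n.+1 N f ->
  Ck_on n N (fun x => 'D_v f x).
Proof. by move=> /Ck_split [_ /(_ v)]. Qed.

Lemma Ck_cst n V W (N : set V) (c : W) : Ck_on n N (fun _ : V => c).
Proof.
elim: n c => [|n IH] c /=; first by move=> x _; exact: cst_continuous.
split=> [x _|v]; first exact: diffble_cst.
by under eq_fun do rewrite dcst; exact: IH.
Qed.

Lemma Ck_add n V (N : set V) (f h : V -> R) : open N ->
  Ck_on n N f -> Ck_on n N h -> Ck_on n N (fun x => f x + h x).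
Proof.
move=> oN; elim: n f h => [|n IH] f h /=.
  by move=> cf ch x Nx; apply: continuousD; [exact: cf|exact: ch].
move=> [df Df] [dh Dh]; split=> [x Nx|v].
  by apply: diffble_add; [exact: df|exact: dh].
apply: (Ck_extR oN) (IH _ _ (Df v) (Dh v)) => x Nx.
by rewrite dadd //; [exact: df|exact: dh].
Qed.

Lemma Ck_mul n V (N : set V) (f h : V -> R) : open N ->
  Ck_on n N f -> Ck_on n N h -> Ck_on n N (fun x => f x * h x).
Proof.
move=> oN; elim: n f h => [|n IH] f h /=.
  by move=> cf ch x Nx; apply: continuousM; [exact: cf|exact: ch].
move=> cf ch; have [df Df] := Ck_split cf; have [dh Dh] := Ck_split ch; split=> [x Nx|v].
  by apply: diffble_mul; [exact: df|exact: dh].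
apply: (Ck_extR oN) (Ck_add oN (IH _ _ (Df v) (CkS ch)) (IH _ _ (CkS cf) (Dh v))) => x Nx.
by rewrite dmul //; [exact: df|exact: dh].
Qed.

Lemma Ck_opp n V (N : set V) (f : V -> R) : open N ->
  Ck_on n N f -> Ck_on n N (fun x => - f x).
Proof.
move=> oN cf; apply: (Ck_extR oN (f := fun x => -1 * f x)).
  by move=> x _; rewrite mulN1r.
by apply: Ck_mul => //; exact: Ck_cst.
Qed.

Lemma Ck_subr n V (N : set V) (f h : V -> R) : open N ->
  Ck_on n N f -> Ck_on n N h -> Ck_on n N (fun x => f x - h x).
Proof. by move=> oN cf ch; apply: Ck_add => //; exact: Ck_opp. Qed.

Lemma Ck_sum n V (N : set V) (I : Type) (r : seq I) (F : I -> V -> R) : open N ->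
  (forall i, Ck_on n N (F i)) -> Ck_on n N (fun x => \sum_(i <- r) F i x).
Proof.
move=> oN cF; elim: r => [|i r IH].
  by under eq_fun do rewrite big_nil; exact: Ck_cst.
by under eq_fun do rewrite big_cons; exact: Ck_add.
Qed.

Lemma Ck_prod n V (N : set V) (I : Type) (r : seq I) (F : I -> V -> R) : open N ->
  (forall i, Ck_on n N (F i)) -> Ck_on n N (fun x => \prod_(i <- r) F i x).
Proof.
move=> oN cF; elim: r => [|i r IH].
  by under eq_fun do rewrite big_nil; exact: Ck_cst.
by under eq_fun do rewrite big_cons; exact: Ck_mul.
Qed.

(** Regularity is asked of the composite [f' (u x)] and not of [f'], so that functions whose
    derivative is expressed through themselves, such as the inverse and the square root, gain one
    order at a time by induction. *)
Lemma Ck_comp1 n V (N : set V) (f f' : R -> R) (u : V -> R) : open N ->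
  (forall x, N x -> is_derive (u x) 1 f (f' (u x))) ->
  Ck_on n N (fun x => f' (u x)) -> Ck_on n.+1 N u -> Ck_on n.+1 N (fun x => f (u x)).
Proof.
move=> oN ff' cf' cu; have [du Du] := Ck_split cu; split=> [x Nx|v].
  by apply: diffble_comp1; [exact: du|have [] := ff' x Nx].
apply: (Ck_extR oN) (Ck_mul oN cf' (Du v)) => x Nx.
by symmetry; apply: dcomp1; [exact: du|exact: ff'].
Qed.

Lemma Ck_inv n V (N : set V) (u : V -> R) : open N ->
  (forall x, N x -> u x != 0) -> Ck_on n N u -> Ck_on n N (fun x => (u x)^-1).
Proof.
move=> oN u0; elim: n => [|n IH] cu.
  by move=> x Nx; apply: continuousV; [exact: u0|exact: cu].
apply: (Ck_comp1 (f' := fun z => - (z^-1 * z^-1))) => //.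
  move=> x Nx; have dv := derivableV (u0 x Nx) (@derivable_id _ _ (u x) 1).
  apply: DeriveDef; first exact: dv.
  have did : differentiable (@id R) (u x) by [].
  have := @dinv _ _ _ _ (1 : R) did (u0 x Nx).
  by rewrite derive_id mul1r expr2.
by apply: Ck_opp => //; apply: Ck_mul => //; apply: IH; exact: CkS.
Qed.

Lemma Ck_sqrt n V (N : set V) (u : V -> R) : open N ->
  (forall x, N x -> 0 < u x) -> Ck_on n N u -> Ck_on n N (fun x => Num.sqrt (u x)).
Proof.
move=> oN u0; elim: n => [|n IH] cu.
  by move=> x Nx; apply: continuous_comp; [exact: cu|exact: sqrt_continuous].
apply: (Ck_comp1 (f' := fun z => (2 * Num.sqrt z)^-1)) => //.
  by move=> x Nx; apply: is_derive1_sqrt; exact: u0.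
apply: Ck_inv => //.
  by move=> x Nx; rewrite mulf_neq0 // gt_eqF // sqrtr_gt0 u0.
by apply: Ck_mul => //; [exact: Ck_cst|apply: IH; exact: CkS].
Qed.

Lemma Ck_coord n V (N : set V) p q (u : V -> 'M[R]_(p, q)) i j : open N ->
  Ck_on n N u -> Ck_on n N (fun x => u x i j).
Proof.
move=> oN; elim: n u => [|n IH] u /=.
  move=> cu x Nx; apply: (@continuous_comp _ _ _ u (fun M => M i j)); first exact: cu.
  exact: coord_continuous.
move=> [du Du]; split=> [x Nx|v]; first by apply: diffble_coord; exact: du.
by apply: (Ck_extR oN) (IH _ (Du v)) => x Nx; rewrite dcoord //; exact: du.
Qed.

Lemma Ck_comp n m V (N : set V) (N' : set 'rV[R]_m) (f : 'rV[R]_m -> R)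
    (u : V -> 'rV[R]_m) : open N ->
  (forall x, N x -> N' (u x)) -> Ck_on n N' f -> Ck_on n N u ->
  Ck_on n N (fun x => f (u x)).
Proof.
move=> oN NN'; elim: n f => [|n IH] f cf cu.
  by move=> x Nx; apply: continuous_comp; [exact: cu|apply: cf; exact: NN'].
have [df Df] := Ck_split cf; have [du Du] := Ck_split cu; split=> [x Nx|v].
  by apply: diffble_comp; [exact: du|apply: df; exact: NN'].
apply: (Ck_extR oN (f := fun x => \sum_i 'D_v u x ord0 i * 'D_(delta_mx ord0 i) f (u x))).
  move=> x Nx; rewrite (@dcomp _ _ _ _ f u); [|exact: du|by apply: df; exact: NN'].
  by rewrite [RHS]dlin_row //; apply: df; exact: NN'.
apply: Ck_sum => // i; apply: Ck_mul => //; first by apply: Ck_coord.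
by apply: (IH ('D_(delta_mx ord0 i) f)); [exact: Df|exact: CkS].
Qed.

Lemma Ck_complin n V V' W (N : set V) (l : {linear V -> V'}) (N' : set V')
    (f : V' -> W) : continuous l -> open N ->
  (forall x, N x -> N' (l x)) -> Ck_on n N' f -> Ck_on n N (fun x => f (l x)).
Proof.
move=> cl oN NN'; elim: n f => [|n IH] f cf.
  by move=> x Nx; apply: continuous_comp; [exact: cl|apply: cf; exact: NN'].
have dl x : differentiable l x by exact: linear_differentiable.
have [df Df] := Ck_split cf; split=> [x Nx|v].
  by apply: differentiable_comp; [exact: dl|apply: df; exact: NN'].
apply: (Ck_ext oN) (IH _ (Df (l v))) => x Nx.
rewrite (@dcomp _ _ _ _ f l); [|exact: dl|by apply: df; exact: NN'].
by rewrite [in RHS](deriveE v (dl x)) diff_lin.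
Qed.

Lemma Ck_young n V (N : set V) (f : V -> R) u v x : open N -> Ck_on n.+2 N f ->
  N x -> 'D_u ('D_v f) x = 'D_v ('D_u f) x.
Proof.
move=> oN cf Nx; have [df Df] := Ck_split cf; apply: young.
- by apply: filterS (open_nbhs_nbhs (conj oN Nx)) => z /df.
- exact: Ck_diff (Df u) _ Nx.
- exact: Ck_diff (Df v) _ Nx.
Qed.

Lemma open_preimage_on (V : topologicalType) (W : topologicalType) (N : set V) (f : V -> W) (B : set W) :
  open N -> (forall x, N x -> {for x, continuous f}) -> open B ->
  open (N `&` f @^-1` B).
Proof.
move=> oN cf oB; rewrite openE => x [Nx Bx]; rewrite /interior.
have H1 : nbhs x N by exact: open_nbhs_nbhs.
have H2 : nbhs x (f @^-1` B) by apply: (cf x Nx); exact: open_nbhs_nbhs.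
exact: filterI.
Qed.

Lemma closure_eq0 (V : normedModType R) (A : set V) (f : V -> R) x :
  closure A x -> {for x, continuous f} -> (forall z, A z -> f z = 0) -> f x = 0.
Proof.
move=> cA cf f0; apply/eqP; apply: contraT => fx.
have H : nbhs x [set z | f z != 0].
  exact: (cf _ (open_nbhs_nbhs (conj (@open_neq R 0) fx))).
by have [z [Az /=]] := cA _ H; rewrite (f0 z Az) eqxx.
Qed.

Lemma closure_ge (V : normedModType R) (A : set V) (f : V -> R) x a :
  closure A x -> {for x, continuous f} -> (forall z, A z -> a <= f z) -> a <= f x.
Proof.
move=> cA cf f0; rewrite leNgt; apply/negP => fx.
have H : nbhs x [set z | f z < a].
  exact: (cf _ (open_nbhs_nbhs (conj (@open_lt R a) fx))).
by have [z [Az /=]] := cA _ H; rewrite ltNge (f0 z Az).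
Qed.

Lemma diffble_prod V (I : finType) (r : seq I) (F : I -> V -> R) x :
  (forall i, differentiable (F i) x) ->
  differentiable (fun z => \prod_(i <- r) F i z) x.
Proof.
move=> dF; elim: r => [|i r IH].
  by under eq_fun do rewrite big_nil; exact: diffble_cst.
by under eq_fun do rewrite big_cons; exact: diffble_mul.
Qed.

Lemma dprod V (I : finType) (F : I -> V -> R) x v :
  (forall i, differentiable (F i) x) ->
  'D_v (fun z => \prod_i F i z) x = \sum_i 'D_v (F i) x * \prod_(j | j != i) F j x.
Proof.
move=> dF.
have H (r : seq I) : uniq r -> 'D_v (fun z => \prod_(i <- r) F i z) x =
    \sum_(i <- r) 'D_v (F i) x * \prod_(j <- r | j != i) F j x.
  elim: r => [|i r IH] /=.
    by move=> _; under eq_fun do rewrite big_nil; rewrite dcst big_nil.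
  move=> /andP[ir ur]; under eq_fun do rewrite big_cons.
  rewrite dmul //; last exact: diffble_prod.
  rewrite IH // [in RHS]big_cons [in RHS]big_cons eqxx /=; congr (_ * _ + _).
    rewrite big_seq [in RHS]big_seq_cond; apply: eq_bigl => j.
    by case: (boolP (j \in r)) => //= jr; symmetry; apply: contraNneq ir => <-.
  rewrite mulr_sumr big_seq [in RHS]big_seq; apply: eq_bigr => j jr.
  rewrite big_cons; have -> : i != j by apply: contraNneq ir => ->.
  by rewrite mulrCA.
by rewrite (H (index_enum I)) ?index_enum_uniq.
Qed.

(* Jacobi's formula: differentiating the Leibniz sum row by row gives
   determinants with one row differentiated. *)
Lemma det_derive V m (A : V -> 'M[R]_m) x v :
  (forall i j, differentiable (fun z => A z i j) x) ->
  'D_v (fun z => \det (A z)) x =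
  \sum_i \sum_j 'D_v (fun z => A z i j) x * cofactor (A x) i j.
Proof.
move=> dA; rewrite dsum; last first.
  by move=> s; apply: diffble_mul; [exact: diffble_cst|exact: diffble_prod].
transitivity (\sum_(s : {perm 'I_m}) \sum_i (-1) ^+ s *
    ('D_v (fun z => A z i (s i)) x * \prod_(j | j != i) A x j (s j))).
  apply: eq_bigr => s _; rewrite -mulr_sumr dmul; [|exact: diffble_cst|exact: diffble_prod].
  by rewrite dcst mul0r add0r dprod.
rewrite exchange_big; apply: eq_bigr => i _ /=.
pose B := \matrix_(k, j) (if k == i then 'D_v (fun z => A z i j) x else A x k j).
transitivity (\det B).
  apply: eq_bigr => s _; congr (_ * _); rewrite [in RHS](bigD1 i) //= mxE eqxx.
  by congr (_ * _); apply: eq_bigr => j ji; rewrite mxE (negbTE ji).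
rewrite (expand_det_row B i); apply: eq_bigr => j _; rewrite mxE eqxx; congr (_ * _).
rewrite /cofactor; congr (_ * \det _); apply/matrixP => a b; rewrite !mxE.
by rewrite eq_sym (negbTE (neq_lift _ _)).
Qed.

Lemma Ck_det n V (N : set V) m (A : V -> 'M[R]_m) : open N ->
  (forall i j, Ck_on n N (fun x => A x i j)) -> Ck_on n N (fun x => \det (A x)).
Proof.
move=> oN cA; apply: Ck_sum => // s; apply: Ck_mul => //; first exact: Ck_cst.
exact: Ck_prod.
Qed.

Lemma Ck_cofactor n V (N : set V) m (A : V -> 'M[R]_m) i j : open N ->
  (forall i j, Ck_on n N (fun x => A x i j)) -> Ck_on n N (fun x => cofactor (A x) i j).
Proof.
move=> oN cA; apply: Ck_mul => //; first exact: Ck_cst.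
apply: Ck_det => // k l; under eq_fun do rewrite !mxE; exact: cA.
Qed.

Lemma Ck_invmx n V (N : set V) m (A : V -> 'M[R]_m) i j : open N ->
  (forall x, N x -> A x \in unitmx) ->
  (forall i j, Ck_on n N (fun x => A x i j)) -> Ck_on n N (fun x => invmx (A x) i j).
Proof.
move=> oN uA cA.
apply: (Ck_extR oN (f := fun x => (\det (A x))^-1 * cofactor (A x) j i)).
  by move=> x Nx; rewrite /invmx uA // !mxE.
apply: Ck_mul => //; last exact: Ck_cofactor.
apply: Ck_inv => //; last exact: Ck_det.
by move=> x /uA; rewrite unitmxE unitfE.
Qed.

Lemma Ck_mulmx n V (N : set V) p q r (A : V -> 'M[R]_(p, q)) (B : V -> 'M[R]_(q, r)) i j :
  open N -> (forall i j, Ck_on n N (fun x => A x i j)) ->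
  (forall i j, Ck_on n N (fun x => B x i j)) -> Ck_on n N (fun x => (A x *m B x) i j).
Proof.
move=> oN cA cB; under eq_fun do rewrite mxE.
by apply: Ck_sum => // k; exact: Ck_mul.
Qed.

Definition dmx V p q v (A : V -> 'M[R]_(p, q)) x : 'M[R]_(p, q) :=
  \matrix_(i, j) 'D_v (fun z => A z i j) x.

Lemma dmx_mul V p q r (A : V -> 'M[R]_(p, q)) (B : V -> 'M[R]_(q, r)) v x :
  (forall i j, differentiable (fun z => A z i j) x) ->
  (forall i j, differentiable (fun z => B z i j) x) ->
  dmx v (fun z => A z *m B z) x = dmx v A x *m B x + A x *m dmx v B x.
Proof.
move=> dA dB; apply/matrixP => i j; rewrite !mxE.
under eq_fun do rewrite mxE.
rewrite dsum => [|k]; last exact: diffble_mul.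
rewrite -big_split /=; apply: eq_bigr => k _.
by rewrite dmul // !mxE.
Qed.

Lemma near_eq_dmx V p q (A B : V -> 'M[R]_(p, q)) v x :
  (\forall z \near x, A z = B z) -> dmx v A x = dmx v B x.
Proof.
move=> AB; apply/matrixP => i j; rewrite !mxE; apply: near_eq_derive.
by apply: filterS AB => z ->.
Qed.

(** Differentiate [A A^-1 = 1]. Differentiability of the inverse is a hypothesis here because it is
    obtained separately, from the cofactor formula in [Ck_invmx]. *)
Lemma dmx_inv V m (A : V -> 'M[R]_m) v x : (\forall z \near x, A z \in unitmx) ->
  (forall i j, differentiable (fun z => A z i j) x) ->
  (forall i j, differentiable (fun z => invmx (A z) i j) x) ->
  dmx v (fun z => invmx (A z)) x = - (invmx (A x) *m dmx v A x *m invmx (A x)).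
Proof.
move=> uA dA dB.
have ux : A x \in unitmx by exact: nbhs_singleton uA.
have : dmx v (fun z => A z *m invmx (A z)) x = 0.
  rewrite (@near_eq_dmx _ _ _ _ (fun _ => 1%:M)); last first.
    by apply: filterS uA => z uz; rewrite mulmxV.
  by apply/matrixP => i j; rewrite !mxE dcst.
rewrite dmx_mul // => H.
have := congr1 (mulmx (invmx (A x))) H.
rewrite mulmxDr mulmx0 !mulmxA mulVmx // mul1mx addrC => /eqP.
by rewrite addr_eq0 => /eqP.
Qed.
End CkCalculus.

(** * Functions of one real variable *)

Section OneVariable.
Set Implicit Arguments.
Unset Strict Implicit.
Variable R : realType.

Lemma Ck_compR n (V : normedModType R) (N : set V) (N' : set R) (f : R -> R)
    (u : V -> R) : open N -> (forall x, N x -> N' (u x)) -> Ck_on n N' f ->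
  Ck_on n N u -> Ck_on n N (fun x => f (u x)).
Proof.
move=> oN NN'; elim: n f => [|n IH] f cf cu.
  by move=> x Nx; apply: continuous_comp; [exact: cu|apply: cf; exact: NN'].
have [df Df] := Ck_split cf.
have H := @Ck_comp1 R n V N f ('D_(1:R) f) u oN; apply: H => //.
  move=> x Nx; apply/derivableP; apply: diff_derivable; apply: df; exact: NN'.
by apply: (IH ('D_(1:R) f)); [exact: Df|exact: CkS].
Qed.

Lemma Ck_id n (N : set R) : Ck_on n N (fun z : R => z).
Proof.
case: n => [|n]; first by move=> x _; exact: cvg_id.
split=> [x _|v]; first by [].
by under eq_fun do rewrite derive_id; exact: Ck_cst.
Qed.

(** The bootstrap for the differential equations of [p] and [F]: regularity of the right-hand side
    along the solution becomes one more derivative of the solution. *)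
Lemma CkS_derive n (N : set R) (f f' : R -> R) : open N ->
  (forall z, N z -> is_derive z 1 f (f' z)) -> Ck_on n N f' -> Ck_on n.+1 N f.
Proof. by move=> oN ff' cf'; apply: Ck_comp1 ff' cf' (Ck_id _ _). Qed.

Lemma derive_gt0_right (f : R -> R) (z f' : R) : is_derive z 1 f f' -> 0 < f' ->
  \forall h \near (0:R)^'+, f z < f (z + h).
Proof.
move=> [df <-] f0; have df' : differentiable f z by exact/derivable1_diffP.
have e0 : 0 < 'D_1 f z / 2 by rewrite divr_gt0.
have [d d0 Hd] := nbhs_norm (differentiable_eps df' e0).
near=> h; have h0 : 0 < h by near: h; exact: nbhs_right_gt.
have hd : `|h - 0| < d by rewrite subr0 gtr0_norm //; near: h; exact: nbhs_right_lt.
have := Hd h hd; have -> : 'D_h f z = h * 'D_1 f z by rewrite -dlinZ // /GRing.scale /= mulr1.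
rewrite (gtr0_norm h0) => /ler_normlP [H _].
have H2 : 0 < h * ('D_1 f z / 2) by rewrite mulr_gt0.
rewrite -subr_gt0; move: H H2.
set a := f (z + h); set b := f z; set c := 'D_1 f z; move=> H H2; lra.
Unshelve. all: by end_near. Qed.

Lemma is_derive0_const (f : R -> R) (a b : R) : a <= b ->
  (forall x, a <= x <= b -> is_derive x 1 f 0) -> f b = f a.
Proof.
move=> ab df.
have [|x|c _] := @MVT_segment _ f (fun=> 0) a b ab.
- by move=> x; rewrite in_itv /= => /andP[/ltW ax /ltW xb]; apply: df; rewrite ax.
- by apply: derivable_within_continuous => z; rewrite in_itv /= => /df [].
- by rewrite mul0r => /eqP; rewrite subr_eq0 => /eqP.
Qed.
End OneVariable.

(** * Equation of state: sign of p, smoothness of p and F, and F is nonzero *)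

Section EquationOfState.
Set Implicit Arguments.
Unset Strict Implicit.
Variables (R : realType) (X : body R).
Hypotheses (hEos : equation_of_state X) (hp : pressure_function X) (hF : F_function X).

Let itv1 (z : R) : 1 <= z -> (`[1, +oo[%classic : set R) z.
Proof. by rewrite /= in_itv /= andbT. Qed.
Let itv0 (z : R) : 0 <= z -> (`[0, +oo[%classic : set R) z.
Proof. by rewrite /= in_itv /= andbT. Qed.

Lemma p_derive (z : R) : 1 <= z -> is_derive z 1 (p X) ((rho X (p X z) + p X z) / z).
Proof. by case: hp => _ [N [_ sN dN]] /itv1 /sN /dN. Qed.

(** The bounds on [rho] are available only where the pressure is non-negative, so they cannot be
    used before its sign is known. A continuation argument resolves this: at the last point
    [t0 <= z] with [p >= 0] the derivative is positive, so p stays positive a little beyond, and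
    [t0 < z] is impossible. *)
Lemma p_ge0 (z : R) : 1 <= z -> 0 <= p X z.
Proof.
move=> z1; rewrite leNgt; apply/negP => pz.
have [r00 _ _ _ rge] := hEos.
pose A : set R := [set t | 1 <= t <= z /\ 0 <= p X t].
have A1 : A 1 by split; [rewrite lexx|case: hp => ->].
have hA : has_sup A.
  by split; [exists 1|exists z => t [/andP[]]].
set t0 := sup A.
have t01 : 1 <= t0 by apply: sup_upper_bound.
have t0z : t0 <= z by apply: ge_sup; [exists 1|move=> t [/andP[]]].
have pc t : 1 <= t -> {for t, continuous (p X)}.
  by move=> /p_derive [? _]; apply: differentiable_continuous; exact/derivable1_diffP.
have cA : closure A t0.
  move=> B /nbhs_norm [d d0 Bd].
  have [t At tt0] := sup_adherent d0 hA.
  exists t; split=> //; apply: Bd; have tle : t <= t0 by exact: sup_upper_bound.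
  by rewrite distrC ger0_norm ?subr_ge0 // ltrBlDr -ltrBlDl.
have pt0 : 0 <= p X t0 by apply: (closure_ge cA (pc _ t01)) => t [].
have d0 : 0 < (rho X (p X t0) + p X t0) / t0.
  have [/andP[rh _] _] := rge _ pt0.
  by rewrite divr_gt0 //; [exact: ltr_wpDr (lt_le_trans r00 rh)|exact: lt_le_trans t01].
have t0z' : t0 < z by rewrite lt_neqAle t0z andbT; apply: contraTneq pz => <-; rewrite -leNgt.
have zt : 0 < z - t0 by rewrite subr_gt0.
have [h h0 [Hh hz]] := right_ex (filterI (derive_gt0_right (p_derive t01) d0) (nbhs_right_lt zt)).
have : A (t0 + h).
  split; last by apply: le_trans (ltW Hh).
  apply/andP; split; first by rewrite (le_trans t01) // lerDl ltW.
  by rewrite addrC -lerBrDr ltW.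
move=> /(sup_upper_bound hA); rewrite -/t0 gerDl leNgt h0 //.
Qed.

(** [NZ] is cut out by the domains of the two differential equations, [0 < z], the values of p near
    which [rho] is smooth, and [F != 0]. The half-line from 1 survives the cuts by [p_ge0] and by a
    first integral for F. *)
Lemma eos_regular : exists NZ : set R, [/\ open NZ, (forall z, 1 <= z -> NZ z),
  (forall z, NZ z -> [/\ 0 < z, F X z != 0,
     is_derive z 1 (p X) ((rho X (p X z) + p X z) / z) &
     is_derive z 1 (F X) (- (F X z * derive1 (rho X) (p X z) / z))]) &
  forall n, [/\ Ck_on n NZ (p X), Ck_on n NZ (F X) &
    Ck_on n NZ (fun z => derive1 (rho X) (p X z))]].
Proof.
have [r00 _ [Nr [oNr sNr cr]] rX0 rge] := hEos.
have [p1 [Np [oNp sNp dp]]] := hp.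
have [F1 [NF [oNF sNF dF]]] := hF.
have dF' z : NF z -> is_derive z 1 (F X) (- (F X z * derive1 (rho X) (p X z) / z)).
  by move=> /dF; rewrite /s2 invfM invrK mulNr mulrA mulrAC.
pose N1 := Np `&` NF `&` [set z | 0 < z].
have oN1 : open N1 by apply: openI; [exact: openI|exact: open_gt].
have cp z : Np z -> {for z, continuous (p X)}.
  by move=> /dp [? _]; apply: differentiable_continuous; exact/derivable1_diffP.
have cF z : NF z -> {for z, continuous (F X)}.
  by move=> /dF [? _]; apply: differentiable_continuous; exact/derivable1_diffP.
pose N2 := N1 `&` p X @^-1` Nr.
have oN2 : open N2 by apply: open_preimage_on => // z [[/cp]].
pose NZ := N2 `&` F X @^-1` [set y | y != 0].
have oNZ : open NZ.
  apply: open_preimage_on => //.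
  by move=> z [[[_ /cF]]].
have Fne z : 1 <= z -> F X z != 0.
  (* [F (rho + p) / zeta] is a first integral: logarithmically, F contributes [- rho' / zeta],
     [rho + p] contributes [(rho' + 1) / zeta], and the last factor [- 1 / zeta]. Its value at 1 is
     [rho_0 > 0]. *)
  move=> z1; pose G t := F X t * (rho X (p X t) + p X t) * t^-1.
  have dr (q : R) : 0 <= q -> is_derive q 1 (rho X) (derive1 (rho X) q).
    move=> q0; rewrite derive1E; apply/derivableP/diff_derivable.
    exact: Ck_diff (cr 1%N) _ (sNr _ (itv0 q0)).
  have dG t : 1 <= t <= z -> is_derive t 1 G 0.
    move=> /andP[t1 _]; have pt := p_ge0 t1.
    have t0 : t != 0 by rewrite gt_eqF // (lt_le_trans ltr01).
    have H1 : differentiable (p X) t by apply/derivable1_diffP; have [] := p_derive t1.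
    have H2 : differentiable (F X) t by apply/derivable1_diffP; have [] := dF' t (sNF _ (itv1 t1)).
    have H3 : differentiable (fun t => rho X (p X t)) t.
      by apply: diffble_comp1 => //; have [] := dr _ pt.
    have H0 : differentiable (fun t : R => t) t by [].
    have H4 : differentiable (fun t => rho X (p X t) + p X t) t by exact: diffble_add.
    have H5 : differentiable (fun t => F X t * (rho X (p X t) + p X t)) t by exact: diffble_mul.
    have H6 : differentiable (fun t : R => t^-1) t by exact: diffble_inv.
    apply: DeriveDef; first by apply/derivable1_diffP; exact: diffble_mul.
    rewrite /G dmul // dmul // dadd // (dcomp1 _ H1 (dr _ pt)) dinv //.
    have := dF' t (sNF _ (itv1 t1)) => -[_ ->]; have := p_derive t1 => -[_ ->].
    by rewrite derive_id; field.
  have GE : G z = rho0 X.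
    by rewrite (is_derive0_const z1 dG) /G F1 p1 rX0 invr1 addr0 mulr1 mul1r.
  apply: contraTneq r00 => Fz; rewrite -GE /G Fz !mul0r ltxx //.
exists NZ; split=> //.
- move=> z z1; split=> /=; last exact: Fne.
  split=> /=; last by apply: sNr; apply: itv0; exact: p_ge0.
  by split; [split; [exact/sNp/itv1|exact/sNF/itv1]|exact: lt_le_trans z1].
- move=> z [[[[Npz NFz] z0] Nrz] Fz]; split=> //; [exact: dp|exact: dF'].
have ci n : Ck_on n NZ (fun z : R => z^-1).
  apply: Ck_inv => //; last exact: Ck_id.
  by move=> z [[[_ z0] _] _]; rewrite gt_eqF.
have cpn n : Ck_on n NZ (p X).
  elim: n => [|n IH]; first by move=> z [[[[/cp]]]].
  apply: (CkS_derive (f' := fun z => (rho X (p X z) + p X z) / z)) => //.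
    by move=> z [[[[/dp]]]].
  apply: Ck_mul => //; apply: Ck_add => //.
  by apply: (Ck_compR (N' := Nr)) => // z [[_]].
have crp n : Ck_on n NZ (fun z => derive1 (rho X) (p X z)).
  apply: (Ck_compR (N' := Nr)) => //; first by move=> z [[_]].
  have -> : derive1 (rho X) = 'D_1 (rho X) by apply/funext => q; rewrite derive1E.
  exact: Ck_D (cr n.+1).
move=> n; split=> //.
elim: n => [|n IH]; first by move=> z [[[[_ /cF]]]].
apply: (CkS_derive (f' := fun z => - (F X z * derive1 (rho X) (p X z) / z))) => //.
  by move=> z [[[[_ /dF']]]].
by apply: Ck_opp => //; apply: Ck_mul => //; apply: Ck_mul.
Qed.

End EquationOfState.

(** * The metric, its Christoffel symbols, and orthogonality to timelike vectors *)

Section Metric.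
Set Implicit Arguments.
Unset Strict Implicit.
Variables (R : realType) (X : body R).
Hypothesis hA1 : lorentzian X.
Notation pt4 := 'rV[R]_4.

Lemma minkowski_unit : minkowski R \in unitmx.
Proof.
have -> : minkowski R = diag_mx (\row_mu (if mu == ord0 then -1 else 1)).
  by apply/matrixP => i j; rewrite !mxE; case: eqP => [->|_]; rewrite ?mulr1n ?mulr0n.
rewrite unitmxE det_diag unitfE; apply/prodf_neq0 => i _; rewrite mxE.
by case: ifP => _; rewrite ?oppr_eq0 oner_eq0.
Qed.

Lemma g_symE y a b : g X y a b = g X y b a.
Proof. by case: hA1 => _ /(_ y) [gs _]; rewrite -[in LHS]gs mxE. Qed.

Lemma g_unit y : g X y \in unitmx.
Proof.
case: hA1 => _ /(_ y) [_ [P Pu PE]]; have := minkowski_unit; rewrite -PE.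
by rewrite !unitmx_mul => /andP[/andP[_ ->]].
Qed.

Lemma ginv_gE y a b : \sum_c ginv X y a c * g X y c b = (a == b)%:R.
Proof.
by have /matrixP/(_ a b) := mulVmx (g_unit y); rewrite !mxE => <-.
Qed.

Lemma g_ginvE y a b : \sum_c g X y a c * ginv X y c b = (a == b)%:R.
Proof.
by have /matrixP/(_ a b) := mulmxV (g_unit y); rewrite !mxE => <-.
Qed.

Lemma Ck_g n (N : set pt4) a b : Ck_on n N (fun y => g X y a b).
Proof.
case: hA1 => sg _; apply: (@Ck_sub _ _ _ _ _ setT) => //.
by apply: Ck_coord => //; exact: openT.
Qed.

Lemma Ck_ginv n (N : set pt4) a b : Ck_on n N (fun y => ginv X y a b).
Proof.
apply: (@Ck_sub _ _ _ _ _ setT) => //; apply: Ck_invmx; first exact: openT.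
  by move=> x _; exact: g_unit.
by move=> i j; exact: Ck_g.
Qed.

Lemma Ck_pdg n (N : set pt4) c a b : Ck_on n N (pd c (fun y => g X y a b)).
Proof. exact: Ck_D (Ck_g n.+1 N a b). Qed.

Lemma Ck_Gam n (N : set pt4) c a b : Ck_on n N (Gam X c a b).
Proof.
apply: (@Ck_sub _ _ _ _ _ setT) => //; apply: Ck_mul; [exact: openT|exact: Ck_cst|].
apply: Ck_sum; first exact: openT.
move=> d; apply: Ck_mul; [exact: openT|exact: Ck_ginv|].
apply: Ck_subr; [exact: openT| |exact: Ck_pdg].
by apply: Ck_add; [exact: openT|exact: Ck_pdg|exact: Ck_pdg].
Qed.

Lemma Gam_sym c a b y : Gam X c a b y = Gam X c b a y.
Proof.
rewrite /Gam; congr (_ * _); apply: eq_bigr => d _; congr (_ * (_ - _)).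
  by rewrite addrC.
by congr (pd _ _ _); apply/funext => z; exact: g_symE.
Qed.

Lemma pd_g_sym c a b y : pd c (fun z => g X z a b) y = pd c (fun z => g X z b a) y.
Proof. by congr (pd _ _ _); apply/funext => z; exact: g_symE. Qed.

Lemma Gam_lower a e b y : \sum_c g X y e c * Gam X c a b y =
  2^-1 * (pd a (fun z => g X z e b) y + pd b (fun z => g X z e a) y
     - pd e (fun z => g X z a b) y).
Proof.
under eq_bigr do rewrite mulrCA mulr_sumr.
rewrite -mulr_sumr; congr (_ * _); rewrite exchange_big /=.
under eq_bigr do (under eq_bigr do rewrite mulrA; rewrite -mulr_suml g_ginvE).
by rewrite (bigD1 e) //= eqxx mul1r big1 ?addr0 // => i ie; rewrite eq_sym (negbTE ie) mul0r.
Qed.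

(** The component form of [nabla g = 0], through which indices are lowered under a derivative. *)
Lemma metric_compat a e b y : pd a (fun z => g X z e b) y =
  \sum_c g X y e c * Gam X c a b y + \sum_c g X y b c * Gam X c a e y.
Proof.
rewrite !Gam_lower (pd_g_sym b e a) (pd_g_sym a b e) (pd_g_sym e b a); by field.
Qed.

(* In an orthonormal frame this is the Cauchy-Schwarz inequality in R^3. *)
Lemma timelike_orthogonal_spacelike y u v : gprod X y u u < 0 ->
  gprod X y u v = 0 -> v != 0 -> 0 < gprod X y v v.
Proof.
case: hA1 => _ /(_ y) [_ [P Pu PE]] uu uv v0.
have gE (a b : pt4) : gprod X y a b = (a *m g X y *m b^T) ord0 ord0.
  rewrite mxE /gprod exchange_big /=; apply: eq_bigr => nu _.
  rewrite mxE mulr_suml; apply: eq_bigr => mu _.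
  by rewrite mxE; congr (_ * _); rewrite mulrC.
have PE' (a b : pt4) : gprod X y a b = \sum_i minkowski R i i * (a *m invmx P) ord0 i * (b *m invmx P) ord0 i.
  rewrite gE; set a' := a *m invmx P; set b' := b *m invmx P.
  have -> : a = a' *m P by rewrite /a' mulmxKV.
  have -> : b = b' *m P by rewrite /b' mulmxKV.
  rewrite trmx_mul !mulmxA -[_ *m P *m _]mulmxA -[_ *m _ *m P^T]mulmxA PE mxE.
  apply: eq_bigr => j _; rewrite [X in X * _]mxE (bigD1 j) //= big1 ?addr0.
    by rewrite [b'^T _ _]mxE; congr (_ * _); rewrite mulrC.
  by move=> i ij; rewrite [minkowski _ _ _]mxE (negbTE ij) mulr0.
have v0' : v *m invmx P != 0.
  by apply: contraNneq v0 => H; rewrite -[v](mulmxKV Pu) H mul0mx.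
move: uu uv; rewrite !PE'; move: (u *m invmx P) (v *m invmx P) v0' => u' v' v0'.
rewrite !big_ord_recl !big_ord0 !mxE /= !addr0 !mul1r.
set a0 := u' _ _; set a1 := u' _ _; set a2 := u' _ _; set a3 := u' _ _.
set b0 := v' _ _; set b1 := v' _ _; set b2 := v' _ _; set b3 := v' _ _.
move=> uu uv.
have b_ne : ~ (b0 = 0 /\ b1 = 0 /\ b2 = 0 /\ b3 = 0).
  move=> [h0 [h1 [h2 h3]]]; move/eqP: v0'; apply; apply/rowP => i; rewrite mxE.
  case: (unliftP ord0 i) => [j ->|->]; last exact: h0.
  case: (unliftP ord0 j) => [k ->|->]; last exact: h1.
  case: (unliftP ord0 k) => [l ->|->]; last exact: h2.
  by rewrite [l]ord1; exact: h3.
move: a0 a1 a2 a3 b0 b1 b2 b3 uu uv b_ne {PE' gE v0 v0'} => a0 a1 a2 a3 b0 b1 b2 b3 uu uv bne.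
set A := a1 ^+ 2 + a2 ^+ 2 + a3 ^+ 2; set B := b1 ^+ 2 + b2 ^+ 2 + b3 ^+ 2.
have A0 : A < a0 ^+ 2 by rewrite /A; lra.
have B0 : 0 <= B by rewrite /B !addr_ge0 // sqr_ge0.
have CS : (a0 * b0) ^+ 2 <= A * B.
  have -> : a0 * b0 = a1 * b1 + a2 * b2 + a3 * b3 by lra.
  rewrite -subr_ge0.
  have -> : A * B - (a1 * b1 + a2 * b2 + a3 * b3) ^+ 2 =
    (a1 * b2 - a2 * b1) ^+ 2 + (a1 * b3 - a3 * b1) ^+ 2 + (a2 * b3 - a3 * b2) ^+ 2.
    by rewrite /A /B; ring.
  by rewrite !addr_ge0 // sqr_ge0.
have a00 : 0 < a0 ^+ 2 by apply: le_lt_trans A0; rewrite /A !addr_ge0 // sqr_ge0.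
suff : b0 ^+ 2 < B by rewrite /B; lra.
have [B_eq|B_gt] : B = 0 \/ 0 < B by move: B0; rewrite le_eqVlt => /orP[/eqP <-|]; [left|right].
  exfalso; apply: bne.
  have /eqP : b1 ^+ 2 + b2 ^+ 2 + b3 ^+ 2 = 0 by [].
  rewrite !paddr_eq0 ?addr_ge0 ?sqr_ge0 // !sqrf_eq0 => /andP[/andP[/eqP h1 /eqP h2] /eqP h3].
  do !split => //; apply/eqP; rewrite -sqrf_eq0 eq_le sqr_ge0 andbT.
  by move: CS; rewrite B_eq mulr0 exprMn pmulr_rle0.
rewrite -(ltr_pM2l a00) -exprMn; apply: (le_lt_trans CS).
by rewrite ltr_pM2r.
Qed.

End Metric.

(** * Regularity and first derivatives of w, its lowered form and [w^2] *)

Section Velocity.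
Set Implicit Arguments.
Unset Strict Implicit.
Variables (R : realType) (X : body R).
Hypothesis hA1 : lorentzian X.
Notation pt4 := 'rV[R]_4.

Lemma e0E : e X ord0 = w X.
Proof. by rewrite /e unlift_none. Qed.

Lemma eSE K : e X (sp K) = e_sp X K.
Proof. by rewrite /e /sp liftK. Qed.

Lemma gprodE y u v : gprod X y u v = \sum_mu u ord0 mu * \sum_nu g X y mu nu * v ord0 nu.
Proof.
apply: eq_bigr => mu _; rewrite mulr_sumr; apply: eq_bigr => nu _.
by rewrite mulrA; congr (_ * _); rewrite mulrC.
Qed.

Lemma gprodC y u v : gprod X y u v = gprod X y v u.
Proof.
rewrite /gprod exchange_big /=; apply: eq_bigr => i _; apply: eq_bigr => j _.
by rewrite (g_symE hA1 y i j) mulrAC.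
Qed.

Lemma gprod_wlow y u : gprod X y u (w X y) = \sum_mu w_low X y mu * u ord0 mu.
Proof. by rewrite gprodE; apply: eq_bigr => mu _; rewrite mulrC. Qed.

Lemma gamma00E y : gamma X y ord0 ord0 = - w2 X y.
Proof. by rewrite /gamma e0E /w2 opprK. Qed.

Lemma w2E y : w2 X y = - \sum_mu w_low X y mu * w X y ord0 mu.
Proof. by rewrite /w2 gprod_wlow. Qed.

Variable N : set pt4.
Hypotheses (oN : open N) (cw : Ck_on 3 N (w X)) (w2pos : forall y, N y -> 0 < w2 X y).

Lemma Ck_w nu : Ck_on 3 N (fun y => w X y ord0 nu).
Proof. exact: Ck_coord. Qed.

Lemma Ck_wlow nu : Ck_on 3 N (fun y => w_low X y nu).
Proof. by apply: Ck_sum => // mu; apply: Ck_mul => //; [exact: Ck_g|exact: Ck_w]. Qed.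

Lemma w2_funE : w2 X = fun y => - \sum_mu w_low X y mu * w X y ord0 mu.
Proof. by apply/funext => y; exact: w2E. Qed.

Lemma Ck_w2 : Ck_on 3 N (w2 X).
Proof.
rewrite w2_funE; apply: Ck_opp => //; apply: Ck_sum => // mu.
by apply: Ck_mul => //; [exact: Ck_wlow|exact: Ck_w].
Qed.

Lemma pd_w_low c b y : N y -> pd c (fun z => w_low X z b) y =
  \sum_nu g X y b nu * nabla_w X c nu y + \sum_d Gam X d c b y * w_low X y d.
Proof.
move=> Ny; rewrite /pd dsum => [|nu]; last first.
  by apply: diffble_mul; [exact: Ck_diff (Ck_g hA1 1 N _ _) _ Ny|exact: Ck_diff (Ck_w _) _ Ny].
under eq_bigr => nu _.
  rewrite dmul; [|exact: Ck_diff (Ck_g hA1 1 N _ _) _ Ny|exact: Ck_diff (Ck_w _) _ Ny].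
  rewrite -/(pd c (fun z => g X z b nu) y) (metric_compat hA1) mulrDl.
  over.
rewrite big_split /= big_split /= addrAC; congr (_ + _).
  under [in RHS]eq_bigr do rewrite /nabla_w mulrDr mulr_sumr.
  rewrite [in RHS]big_split /= addrC; congr (_ + _).
  under eq_bigr do rewrite mulr_suml.
  rewrite exchange_big /=; apply: eq_bigr => a _; apply: eq_bigr => d _; exact: esym (mulrA _ _ _).
under eq_bigr do rewrite mulr_suml.
rewrite exchange_big /=; apply: eq_bigr => d _; rewrite /w_low mulr_sumr.
by apply: eq_bigr => nu _; rewrite (g_symE hA1 y nu d) mulrA [Gam _ _ _ _ _ * _]mulrC.
Qed.

Lemma pd_w c nu y : pd c (fun z => w X z ord0 nu) y =
  nabla_w X c nu y - \sum_a Gam X nu c a y * w X y ord0 a.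
Proof. by rewrite /nabla_w addrK. Qed.

Lemma pd_w2 c y : N y -> pd c (w2 X) y =
  - (2 * \sum_nu w_low X y nu * nabla_w X c nu y).
Proof.
move=> Ny; have dl mu := Ck_diff (Ck_wlow mu) Ny; have dw mu := Ck_diff (Ck_w mu) Ny.
rewrite w2_funE /pd dopp; last by apply: diffble_sum => mu; exact: diffble_mul.
rewrite dsum => [|mu]; last exact: diffble_mul.
congr (- _); under eq_bigr => mu _.
  rewrite dmul // -/(pd c (fun z => w_low X z mu) y) -/(pd c (fun z => w X z ord0 mu) y).
  rewrite pd_w_low // pd_w mulrDl mulrBr addrACA [X in _ + X]addrC -addrA.
  over.
rewrite /= mulr2n mulrDl !mul1r.
rewrite !big_split /=.
have -> : \sum_i (\sum_nu g X y i nu * nabla_w X c nu y) * w X y ord0 i =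
    \sum_nu w_low X y nu * nabla_w X c nu y.
  under eq_bigr do rewrite mulr_suml.
  rewrite exchange_big /=; apply: eq_bigr => nu _; rewrite /w_low mulr_suml.
  by apply: eq_bigr => mu _; rewrite (g_symE hA1 y mu nu) mulrAC.
suff -> : \sum_i (\sum_d Gam X d c i y * w_low X y d) * w X y ord0 i =
    \sum_i w_low X y i * \sum_a Gam X i c a y * w X y ord0 a by rewrite sumrN; ring.
under eq_bigr do rewrite mulr_suml.
rewrite exchange_big /=; apply: eq_bigr => d _; rewrite mulr_sumr.
by apply: eq_bigr => a _; rewrite mulrA [Gam _ _ _ _ _ * _]mulrC.
Qed.
End Velocity.

(** * Consequences of the Euler equations: Lie transport and the conserved current *)

Section Euler.
Set Implicit Arguments.
Unset Strict Implicit.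
Variables (R : realType) (X : body R).
Hypothesis hA1 : lorentzian X.
Notation pt4 := 'rV[R]_4.

(** The contractions of [nabla w] in the Euler equations. [w_acc] is the lowered acceleration
    [w^c nabla_c w_mu]; [w_grad] is [w_nu nabla_mu w^nu], that is [- 1/2] times the differential of
    [w2]; [w_q] is the contraction of either of them with w. *)
Definition w_acc (mu : 'I_4) (y : pt4) : R :=
  \sum_c w X y ord0 c * \sum_nu g X y mu nu * nabla_w X c nu y.
Definition w_grad (mu : 'I_4) (y : pt4) : R :=
  \sum_nu w_low X y nu * nabla_w X mu nu y.
Definition w_div (y : pt4) : R := \sum_c nabla_w X c c y.
Definition w_q (y : pt4) : R := \sum_c w X y ord0 c * w_grad c y.
(** This is [1 / s^2]; written as [rho'] it is visibly smooth along [zeta]. *)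
Definition rs (y : pt4) : R := derive1 (rho X) (p X (zeta X y)).

Lemma s2V y : (s2 X (zeta X y))^-1 = rs y.
Proof. by rewrite /s2 invrK. Qed.

Lemma w_acc_w y : \sum_mu w X y ord0 mu * w_acc mu y = w_q y.
Proof.
rewrite /w_acc; under eq_bigr do rewrite mulr_sumr.
rewrite exchange_big /=; apply: eq_bigr => c _.
under eq_bigr do rewrite mulrCA.
rewrite -mulr_sumr; congr (_ * _); rewrite /w_grad.
under eq_bigr do rewrite mulr_sumr.
rewrite exchange_big /=; apply: eq_bigr => nu _; rewrite /w_low mulr_suml.
by apply: eq_bigr => mu _; rewrite (g_symE hA1 y mu nu) mulrA; congr (_ * _); rewrite mulrC.
Qed.

Lemma FWE_form y mu : \sum_c \sum_nu Acoef X mu nu c y * nabla_w X c nu y =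
  (3 + rs y) * (w_low X y mu / w2 X y) * w_q y + w_low X y mu * w_div y
  + w_grad mu y + w_acc mu y.
Proof.
rewrite /Acoef s2V; move: (3 + rs y) => K.
under eq_bigr => c _ do (under eq_bigr => nu _ do rewrite !mulrDl; rewrite !big_split /=).
rewrite !big_split /=; congr (_ + _ + _ + _).
- rewrite /w_q mulr_sumr; apply: eq_bigr => c _; rewrite /w_grad !mulr_sumr.
  by apply: eq_bigr => nu _; ring.
- rewrite /w_div mulr_sumr; apply: eq_bigr => c _.
  rewrite (bigD1 c) //= eqxx mul1r big1 ?addr0 // => i ic.
  by rewrite eq_sym (negbTE ic) !mul0r.
- rewrite (bigD1 mu) //= [X in _ + X]big1 ?addr0; last first.
    by move=> i imu; apply: big1 => nu _; rewrite (negbTE imu) !mul0r.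
  by apply: eq_bigr => nu _; rewrite eqxx mul1r.
- by apply: eq_bigr => c _; rewrite mulr_sumr; apply: eq_bigr => nu _; rewrite mulrA.
Qed.

Definition FWE_at (y : pt4) : Prop :=
  forall mu, \sum_c \sum_nu Acoef X mu nu c y * nabla_w X c nu y = 0.

(* Contraction of the equations with w. *)
Lemma FWE_div y : w2 X y != 0 -> FWE_at y -> (1 + rs y) * w_q y = - (w2 X y * w_div y).
Proof.
move=> w20 H.
have : \sum_mu w X y ord0 mu * (\sum_c \sum_nu Acoef X mu nu c y * nabla_w X c nu y) = 0.
  by apply: big1 => mu _; rewrite H mulr0.
under eq_bigr do rewrite FWE_form !mulrDr.
rewrite !big_split /= w_acc_w -/(w_q y).
have -> : \sum_i w X y ord0 i * ((3 + rs y) * (w_low X y i / w2 X y) * w_q y) =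
    - (3 + rs y) * w_q y.
  transitivity ((\sum_i w_low X y i * w X y ord0 i) * ((3 + rs y) / w2 X y * w_q y)).
    by rewrite mulr_suml; apply: eq_bigr => i _; ring.
  have -> : \sum_i w_low X y i * w X y ord0 i = - w2 X y by rewrite w2E opprK.
  by field.
have -> : \sum_i w X y ord0 i * (w_low X y i * w_div y) = - w2 X y * w_div y.
  by rewrite w2E opprK mulr_suml; apply: eq_bigr => i _; ring.
by move=> E; apply/eqP; rewrite -subr_eq0 -oppr_eq0 -[X in _ == X]E; apply/eqP; ring.
Qed.

(** Subtracting [w_mu / w^2] times the contracted equation [FWE_div] removes both the divergence and
    the sound speed, leaving only a multiple of [w_mu]. *)
Lemma FWE_acc y mu : w2 X y != 0 -> FWE_at y ->
  w_acc mu y + w_grad mu y = - (2 * w_q y * w_low X y mu / w2 X y).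
Proof.
move=> w20 H; have := H mu; rewrite FWE_form.
have := FWE_div w20 H.
move: (w_q y) (w_div y) (rs y) (w_low X y mu) (w_grad mu y) (w_acc mu y) (w2 X y) w20.
move=> q d r l gr a W W0 E1 E2.
have -> : a + gr = ((3 + r) * (l / W) * q + l * d + gr + a)
   - (l / W) * ((1 + r) * q - - (W * d)) - 2 * q * l / W by field.
by rewrite E1 E2 subrr mulr0 subr0 sub0r.
Qed.

Variable N : set pt4.
Hypotheses (oN : open N) (cw : Ck_on 3 N (w X)) (w2pos : forall y, N y -> 0 < w2 X y).

Let w2n0 y : N y -> w2 X y != 0.
Proof. by move=> /w2pos/lt0r_neq0. Qed.
Let dw nu y : N y -> differentiable (fun y => w X y ord0 nu) y.
Proof. exact: Ck_diff (Ck_w oN cw nu) y. Qed.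
Let dwl nu y : N y -> differentiable (fun y => w_low X y nu) y.
Proof. exact: Ck_diff (Ck_wlow hA1 oN cw nu) y. Qed.
Let dw2 y : N y -> differentiable (w2 X) y.
Proof. exact: Ck_diff (Ck_w2 hA1 oN cw) y. Qed.

(* The covector w_mu / gamma_00, which is theta^0 wherever gamma_0J = 0. *)
Definition vt (b : 'I_4) (y : pt4) : R := - (w_low X y b * (w2 X y)^-1).

Lemma Ck_vt b : Ck_on 3 N (vt b).
Proof.
apply: Ck_opp => //; apply: Ck_mul => //; first exact: Ck_wlow.
by apply: Ck_inv => //; exact: Ck_w2.
Qed.

Lemma nabla_vt c b y : N y -> pd c (vt b) y - \sum_d Gam X d c b y * vt d y =
  - ((\sum_nu g X y b nu * nabla_w X c nu y) / w2 X y)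
  - 2 * w_low X y b * w_grad c y / w2 X y ^+ 2.
Proof.
move=> Ny; have w20 := w2n0 Ny.
have dv : differentiable (fun z => (w2 X z)^-1) y by apply: diffble_inv => //; exact: dw2.
rewrite /vt /pd dopp; last by apply: diffble_mul => //; exact: dwl.
rewrite dmul //; last exact: dwl.
rewrite dinv //; last exact: dw2.
rewrite -/(pd c (fun z => w_low X z b) y) -/(pd c (w2 X) y) (pd_w_low hA1 oN cw) // (pd_w2 hA1 oN cw) //.
have -> : \sum_d Gam X d c b y * - (w_low X y d / w2 X y) =
    - ((\sum_d Gam X d c b y * w_low X y d) / w2 X y).
  by rewrite mulr_suml -sumrN; apply: eq_bigr => d _; rewrite mulrN mulrA.
rewrite -/(w_grad c y); field; exact: w20.
Qed.

Lemma lie_vtE b y : N y ->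
  \sum_c w X y ord0 c * pd c (vt b) y + \sum_c vt c y * pd b (fun z => w X z ord0 c) y =
  - ((w_acc b y + w_grad b y) / w2 X y) - 2 * w_low X y b * w_q y / w2 X y ^+ 2.
Proof.
move=> Ny.
have -> : \sum_c w X y ord0 c * pd c (vt b) y =
   \sum_c w X y ord0 c * (pd c (vt b) y - \sum_d Gam X d c b y * vt d y)
   + \sum_c w X y ord0 c * \sum_d Gam X d c b y * vt d y.
  by rewrite -[RHS]big_split; apply: eq_bigr => c _ /=; rewrite -mulrDr subrK.
under eq_bigr do rewrite nabla_vt // mulrBr.
under [X in _ + X = _]eq_bigr do rewrite pd_w mulrBr.
rewrite !big_split /= !sumrN -!addrA.
have -> : \sum_c w X y ord0 c * - ((\sum_nu g X y b nu * nabla_w X c nu y) / w2 X y) =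
    - (w_acc b y / w2 X y).
  by rewrite /w_acc mulr_suml -sumrN; apply: eq_bigr => c _; rewrite mulrN mulrA.
have -> : \sum_c w X y ord0 c * (2 * w_low X y b * w_grad c y / w2 X y ^+ 2) =
    2 * w_low X y b * w_q y / w2 X y ^+ 2.
  by rewrite /w_q mulr_sumr mulr_suml; apply: eq_bigr => c _; ring.
have -> : \sum_c vt c y * nabla_w X b c y = - (w_grad b y / w2 X y).
  by rewrite /w_grad mulr_suml -sumrN; apply: eq_bigr => c _; rewrite /vt; ring.
have -> : \sum_c w X y ord0 c * (\sum_d Gam X d c b y * vt d y) =
    \sum_d vt d y * (\sum_a Gam X d b a y * w X y ord0 a).
  under eq_bigr do rewrite mulr_sumr.
  rewrite exchange_big /=; apply: eq_bigr => d _; rewrite mulr_sumr.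
  by apply: eq_bigr => a _; rewrite (Gam_sym hA1 d a b); ring.
by rewrite mulrDl; ring.
Qed.

(** The left-hand side is the Lie derivative of [vt] along w. Its Christoffel terms cancel by
    symmetry, and the derivative of the factor [1 / w^2] produces exactly the multiple of [w_b] that
    [FWE_acc] leaves over. *)
Lemma lie_vt b y : N y -> FWE_at y ->
  \sum_c w X y ord0 c * pd c (vt b) y + \sum_c vt c y * pd b (fun z => w X z ord0 c) y = 0.
Proof.
move=> Ny H; rewrite lie_vtE // FWE_acc //; last exact: w2n0.
by field; exact: w2n0.
Qed.

Variable NZ : set R.
Hypotheses (NzN : forall y, N y -> NZ (zeta X y))
  (Hz : forall z, NZ z -> [/\ 0 < z, F X z != 0,
     is_derive z 1 (p X) ((rho X (p X z) + p X z) / z) &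
     is_derive z 1 (F X) (- (F X z * derive1 (rho X) (p X z) / z))])
  (Cz : forall n, [/\ Ck_on n NZ (p X), Ck_on n NZ (F X) &
    Ck_on n NZ (fun z => derive1 (rho X) (p X z))]).

Definition fz (y : pt4) : R := f X (zeta X y).

Lemma Ck_zeta : Ck_on 3 N (zeta X).
Proof.
apply: Ck_inv => //; last by apply: Ck_sqrt => //; exact: Ck_w2.
by move=> y Ny; rewrite gt_eqF // sqrtr_gt0 w2pos.
Qed.

Lemma Ck_Fz : Ck_on 3 N (fun y => F X (zeta X y)).
Proof. by have [_ H _] := Cz 3; apply: Ck_compR NzN H Ck_zeta. Qed.

Lemma Ck_pz : Ck_on 3 N (fun y => p X (zeta X y)).
Proof. by have [H _ _] := Cz 3; apply: Ck_compR NzN H Ck_zeta. Qed.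

Lemma Ck_rs : Ck_on 3 N rs.
Proof. by have [_ _ H] := Cz 3; apply: Ck_compR NzN H Ck_zeta. Qed.

Lemma Ck_fz : Ck_on 3 N fz.
Proof. by apply: Ck_opp => //; apply: Ck_mul => //; [exact: Ck_zeta|exact: Ck_Fz]. Qed.

Lemma fz_neq0 y : N y -> fz y != 0.
Proof.
by move=> /NzN/Hz [z0 F0 _ _]; rewrite /fz /f oppr_eq0 mulf_neq0 // gt_eqF.
Qed.

Lemma pd_zeta c y : N y -> pd c (zeta X) y = zeta X y * w_grad c y / w2 X y.
Proof.
move=> Ny; have W := w2pos Ny; have S0 : Num.sqrt (w2 X y) != 0 by rewrite gt_eqF // sqrtr_gt0.
have dS : differentiable (fun z => Num.sqrt (w2 X z)) y.
  by apply: diffble_comp1; [exact: dw2|have [] := is_derive1_sqrt W].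
rewrite /pd /zeta dinv // (dcomp1 _ (dw2 Ny) (is_derive1_sqrt W)).
rewrite -/(pd c (w2 X) y) (pd_w2 hA1 oN cw) // -/(w_grad c y).
have -> : (w2 X y)^-1 = (Num.sqrt (w2 X y) ^+ 2)^-1 by rewrite sqr_sqrtr // ltW.
by field.
Qed.

Lemma pd_pz c y : N y -> pd c (fun y => p X (zeta X y)) y =
  (rho X (p X (zeta X y)) + p X (zeta X y)) * w_grad c y / w2 X y.
Proof.
move=> Ny; have [z0 _ dp _] := Hz (NzN Ny).
rewrite /pd (dcomp1 _ (Ck_diff Ck_zeta Ny) dp) -/(pd c (zeta X) y) pd_zeta //.
by field; rewrite w2n0 // gt_eqF.
Qed.

Lemma pd_fz c y : N y -> pd c fz y = fz y * (1 - rs y) * w_grad c y / w2 X y.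
Proof.
move=> Ny; have [z0 _ _ dF] := Hz (NzN Ny).
have d1 := Ck_diff Ck_zeta Ny; have d2 := Ck_diff Ck_Fz Ny.
rewrite /pd /fz /f dopp; last exact: diffble_mul.
rewrite dmul // (dcomp1 _ d1 dF) -/(pd c (zeta X) y) pd_zeta // -/(rs y).
by field; rewrite w2n0 // gt_eqF.
Qed.

(* The conserved current theta^{0 alpha} / f. *)
Definition lam (al : 'I_4) (y : pt4) : R := - (w X y ord0 al * (w2 X y * fz y)^-1).

Lemma Ck_lam al : Ck_on 3 N (lam al).
Proof.
apply: Ck_opp => //; apply: Ck_mul => //; first exact: Ck_w.
apply: Ck_inv => //; first by move=> y Ny; rewrite mulf_neq0 ?w2n0 ?fz_neq0.
by apply: Ck_mul => //; [exact: Ck_w2|exact: Ck_fz].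
Qed.

Definition nabla_up (l : 'I_4 -> pt4 -> R) (c al : 'I_4) (y : pt4) : R :=
  pd c (l al) y + \sum_s Gam X al c s y * l s y.

Lemma nabla_lamE c al y : N y -> nabla_up lam c al y =
  - (nabla_w X c al y / (w2 X y * fz y))
  - (1 + rs y) * w X y ord0 al * w_grad c y / (w2 X y ^+ 2 * fz y).
Proof.
move=> Ny; have w20 := w2n0 Ny; have f0 := fz_neq0 Ny.
have df := Ck_diff Ck_fz Ny; have d2 := dw2 Ny.
have dm : differentiable (fun z => w2 X z * fz z) y by exact: diffble_mul.
have m0 : w2 X y * fz y != 0 by rewrite mulf_neq0.
have di : differentiable (fun z => (w2 X z * fz z)^-1) y by exact: diffble_inv.
rewrite /nabla_up /lam /pd dopp; last by apply: diffble_mul => //; exact: dw.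
rewrite dmul //; last exact: dw.
rewrite dinv // dmul // -/(pd c (fun z => w X z ord0 al) y) -/(pd c (w2 X) y) -/(pd c fz y).
rewrite pd_fz // (pd_w2 hA1 oN cw) // pd_w -/(w_grad c y).
have -> : \sum_s Gam X al c s y * - (w X y ord0 s / (w2 X y * fz y)) =
    - ((\sum_s Gam X al c s y * w X y ord0 s) / (w2 X y * fz y)).
  by rewrite mulr_suml -sumrN; apply: eq_bigr => d _; rewrite mulrN mulrA.
by field; rewrite w20 f0.
Qed.

(** Here the choice of f pays off. The factor [1 / w^2] contributes the coefficient 2 and the factor
    [1 / f] contributes [- (1 - rs)]; together they give the [1 + rs] of the contracted Euler
    equation [FWE_div]. *)
Lemma div_lam y : N y -> FWE_at y -> \sum_al nabla_up lam al al y = 0.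
Proof.
move=> Ny H; have w20 := w2n0 Ny; have f0 := fz_neq0 Ny.
under eq_bigr do rewrite nabla_lamE //.
rewrite big_split /= !sumrN -mulr_suml -/(w_div y).
have -> : \sum_i (1 + rs y) * w X y ord0 i * w_grad i y / (w2 X y ^+ 2 * fz y) =
    (1 + rs y) * w_q y / (w2 X y ^+ 2 * fz y).
  by rewrite /w_q mulr_sumr mulr_suml; apply: eq_bigr => i _; ring.
rewrite FWE_div //; field; by rewrite w20 f0.
Qed.

(* The acoustic metric of the tilde quantities, as a field on spacetime. *)
Definition ac (al be : 'I_4) (y : pt4) : R := ginv X y al be
  + (w2 X y)^-1 * (1 - rs y) * w X y ord0 al * w X y ord0 be.

(** Raising the index with g alone differentiates [theta^0] but not the factor [1 / f]. The missing
    term is a multiple of [(1 - rs) w_grad], and since contracting the covariant derivative of [vt]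
    with w gives [w_grad / w^2], the rank-one part of [ac] supplies it. *)
Lemma ac_nabla_vt nu al y : N y ->
  (fz y)^-1 * \sum_be ac al be y * (pd nu (vt be) y - \sum_d Gam X d nu be y * vt d y) =
  nabla_up lam nu al y.
Proof.
move=> Ny; have w20 := w2n0 Ny; have f0 := fz_neq0 Ny.
rewrite nabla_lamE //.
under eq_bigr do rewrite nabla_vt // /ac mulrDl mulrBr [X in _ + X]mulrBr.
rewrite !big_split /= !sumrN.
have -> : \sum_be ginv X y al be * - ((\sum_nu0 g X y be nu0 * nabla_w X nu nu0 y) / w2 X y)
    = - (nabla_w X nu al y / w2 X y).
  rewrite -[in RHS](_ : \sum_nu0 (al == nu0)%:R * nabla_w X nu nu0 y = nabla_w X nu al y); last first.
    by rewrite (bigD1 al) //= eqxx mul1r big1 ?addr0 // => i ia; rewrite eq_sym (negbTE ia) mul0r.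
  under [in RHS]eq_bigr do rewrite -(ginv_gE hA1 y) mulr_suml.
  rewrite exchange_big /= mulr_suml -sumrN; apply: eq_bigr => be _.
  by rewrite mulrN mulrA mulr_sumr; congr (- (_ * _)); apply: eq_bigr => i _; rewrite mulrA.
have -> : \sum_be ginv X y al be * (2 * w_low X y be * w_grad nu y / w2 X y ^+ 2)
    = 2 * w X y ord0 al * w_grad nu y / w2 X y ^+ 2.
  transitivity ((\sum_be ginv X y al be * w_low X y be) * (2 * w_grad nu y / w2 X y ^+ 2)).
    by rewrite mulr_suml; apply: eq_bigr => be _; ring.
  suff -> : \sum_be ginv X y al be * w_low X y be = w X y ord0 al by ring.
  rewrite /w_low; under eq_bigr do rewrite mulr_sumr.
  rewrite exchange_big /=; under eq_bigr do (under eq_bigr do rewrite mulrA; rewrite -mulr_suml (ginv_gE hA1)).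
  by rewrite (bigD1 al) //= eqxx mul1r big1 ?addr0 // => i ia; rewrite eq_sym (negbTE ia) mul0r.
have -> : \sum_be (w2 X y)^-1 * (1 - rs y) * w X y ord0 al * w X y ord0 be *
     - ((\sum_nu0 g X y be nu0 * nabla_w X nu nu0 y) / w2 X y)
   = - ((w2 X y)^-1 ^+ 2 * (1 - rs y) * w X y ord0 al * w_grad nu y).
  have -> : w_grad nu y = \sum_be w X y ord0 be * \sum_nu0 g X y be nu0 * nabla_w X nu nu0 y.
    rewrite /w_grad; under [RHS]eq_bigr do rewrite mulr_sumr.
    rewrite [RHS]exchange_big /=; apply: eq_bigr => s _; rewrite /w_low mulr_suml.
    by apply: eq_bigr => be _; rewrite (g_symE hA1 y s be); ring.
  by rewrite mulr_sumr -sumrN; apply: eq_bigr => be _; ring.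
have -> : \sum_be (w2 X y)^-1 * (1 - rs y) * w X y ord0 al * w X y ord0 be *
     (2 * w_low X y be * w_grad nu y / w2 X y ^+ 2)
   = - (2 * (w2 X y)^-1 ^+ 2 * (1 - rs y) * w X y ord0 al * w_grad nu y).
  transitivity ((\sum_be w_low X y be * w X y ord0 be) * (2 * (w2 X y)^-1 * (1 - rs y) * w X y ord0 al * w_grad nu y / w2 X y ^+ 2)).
    by rewrite mulr_suml; apply: eq_bigr => be _; ring.
  have -> : \sum_i w_low X y i * w X y ord0 i = - w2 X y by rewrite w2E opprK.
  by field.
by field; rewrite w20 f0.
Qed.
End Euler.

(** * The Ricci identity for vector fields *)

Section Curvature.
Set Implicit Arguments.
Unset Strict Implicit.
Variables (R : realType) (X : body R).
Hypothesis hA1 : lorentzian X.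
Notation pt4 := 'rV[R]_4.

Let sum_delta (h : 'I_4 -> R) s : \sum_c h c * (c == s)%:R = h s.
Proof.
by rewrite (bigD1 s) //= eqxx mulr1 big1 ?addr0 // => i /negbTE ->; rewrite mulr0.
Qed.

Let dG c a b y : differentiable (Gam X c a b) y.
Proof. exact: (Ck_diff (Ck_Gam hA1 1 setT c a b)). Qed.

(** The first covariant derivative of [dx^s] is minus a Christoffel symbol, and the contribution of
    [Gamma^t_{mu nu}] drops out on antisymmetrizing. *)
Lemma RiemE mu nu c s y : Riem X mu nu c s y =
  pd nu (Gam X s mu c) y - pd mu (Gam X s nu c) y
  + \sum_t Gam X t mu c y * Gam X s nu t y - \sum_t Gam X t nu c y * Gam X s mu t y.
Proof.
set dx := fun (c' : 'I_4) (_ : pt4) => (c' == s)%:R : R.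
have n1 a b : nabla1 X dx a b = fun z => - Gam X s a b z.
  by apply/funext => z; rewrite /nabla1 /pd dcst sub0r sum_delta.
have n2 a b : nabla2 X dx a b c y = - pd a (Gam X s b c) y
    + \sum_t Gam X t a b y * Gam X s t c y + \sum_t Gam X t a c y * Gam X s b t y.
  rewrite /nabla2 !n1 /pd dopp //; congr (_ + _ + _).
    by rewrite -sumrN; apply: eq_bigr => t _; rewrite n1 mulrN opprK.
  by rewrite -sumrN; apply: eq_bigr => t _; rewrite n1 mulrN opprK.
rewrite /Riem -/dx !n2.
have -> : \sum_t Gam X t nu mu y * Gam X s t c y = \sum_t Gam X t mu nu y * Gam X s t c y.
  by apply: eq_bigr => t _; rewrite (Gam_sym hA1 t nu mu).
move: (pd mu _ y) (pd nu _ y) (\sum_t _) (\sum_t _) (\sum_t _) => a b c' d' e'; ring.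
Qed.

Variable N : set pt4.
Hypothesis oN : open N.

Let sumD4 (F1 F2 : 'I_4 -> R) : \sum_i (F1 i + F2 i) = \sum_i F1 i + \sum_i F2 i.
Proof. exact: big_split. Qed.

(* The left-hand side is nabla_a nabla_nu l^a - nabla_nu nabla_a l^a. *)
Lemma ricci_identity (l : 'I_4 -> pt4 -> R) nu y : (forall a, Ck_on 2 N (l a)) -> N y ->
  \sum_a pd a (nabla_up X l nu a) y
  + \sum_a \sum_c Gam X a a c y * nabla_up X l nu c y
  - \sum_a \sum_c Gam X c a nu y * nabla_up X l c a y
  - pd nu (fun z => \sum_a nabla_up X l a a z) y = \sum_c Ric X nu c y * l c y.
Proof.
move=> cl Ny.
have dl a : differentiable (l a) y by exact: Ck_diff (cl a) _ Ny.
have dpl a b : differentiable (pd b (l a)) y by exact: Ck_diff (Ck_D _ (cl a)) _ Ny.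
have dGl a b s : differentiable (fun z => Gam X a b s z * l s z) y by exact: diffble_mul.
have pn a b c : pd a (nabla_up X l b c) y = pd a (pd b (l c)) y
    + \sum_s (pd a (Gam X c b s) y * l s y + Gam X c b s y * pd a (l s) y).
  rewrite /nabla_up [LHS]/pd dadd //; last exact: diffble_sum.
  congr (_ + _); rewrite dsum //; apply: eq_bigr => s _; exact: dmul.
have -> : pd nu (fun z => \sum_a nabla_up X l a a z) y = \sum_a pd nu (nabla_up X l a a) y.
  by rewrite {1}/pd dsum // => a; apply: diffble_add => //; exact: diffble_sum.
have yg a : pd nu (pd a (l a)) y = pd a (pd nu (l a)) y by exact: Ck_young oN (cl a) Ny.
rewrite addrAC [X in X - _]addrAC.
(* With the second derivatives of l gone by symmetry, [A1] collects the derivatives of Christoffel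
   symbols, [B1] and [B2] the products of a Christoffel symbol with a derivative of l, [Q1] and [Q2]
   the quadratic terms. The B terms cancel, and [A1 + Q1 - Q2] is the Ricci term. *)
pose A1 := \sum_c \sum_a (pd a (Gam X a nu c) y - pd nu (Gam X a a c) y) * l c y.
pose B1 := \sum_a \sum_c Gam X a nu c y * pd a (l c) y.
pose B2 := \sum_a \sum_c Gam X a a c y * pd nu (l c) y.
pose Q1 := \sum_c \sum_a \sum_t Gam X t nu c y * Gam X a a t y * l c y.
pose Q2 := \sum_c \sum_a \sum_t Gam X t a c y * Gam X a nu t y * l c y.
have -> : \sum_a pd a (nabla_up X l nu a) y - \sum_a pd nu (nabla_up X l a a) y = A1 + B1 - B2.
  rewrite /A1 exchange_big /= -sumD4 -!sumrB; apply: eq_bigr => a _; rewrite !pn yg.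
  rewrite opprD addrACA subrr add0r -sumrB -sumD4 -sumrB; apply: eq_bigr => s _.
  move: (pd a (Gam X a nu s) y) (pd nu (Gam X a a s) y) (pd a (l s) y) (pd nu (l s) y) => h1 h2 h3 h4; ring.
have -> : \sum_a \sum_c Gam X a a c y * nabla_up X l nu c y = B2 + Q1.
  rewrite /Q1 [X in _ = _ + X]exchange_big /= -sumD4; apply: eq_bigr => a _.
  rewrite [X in _ = _ + X]exchange_big /= -sumD4; apply: eq_bigr => c _.
  rewrite /nabla_up mulrDr mulr_sumr; congr (_ + _); apply: eq_bigr => s _; ring.
have -> : \sum_a \sum_c Gam X c a nu y * nabla_up X l c a y = B1 + Q2.
  rewrite [LHS]exchange_big /= /Q2 [X in _ = _ + X]exchange_big /= -sumD4; apply: eq_bigr => a _.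
  rewrite [X in _ = _ + X]exchange_big /= -sumD4; apply: eq_bigr => c _.
  rewrite (Gam_sym hA1 a c nu) /nabla_up mulrDr mulr_sumr; congr (_ + _); apply: eq_bigr => s _; ring.
have -> : \sum_c Ric X nu c y * l c y = A1 + Q1 - Q2.
  rewrite -sumD4 -sumrB; apply: eq_bigr => c _; rewrite /Ric mulr_suml -sumD4 -sumrB.
  apply: eq_bigr => a _; rewrite RiemE mulrBl mulrDl !mulr_suml; congr (_ + _ - _).
move: A1 B1 B2 Q1 Q2 => a1 b1 b2 q1 q2; ring.
Qed.
End Curvature.

(** * Dual frame, structure equation and Lie transport of the coframe *)

Section Frame.
Set Implicit Arguments.
Unset Strict Implicit.
Variables (R : realType) (X : body R).
Notation pt4 := 'rV[R]_4.
Variable N : set pt4.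
Hypotheses (oN : open N) (ce : forall i, Ck_on 2 N (e X i))
  (uE : forall y, N y -> E X y \in unitmx).

Lemma EE y mu i : E X y mu i = e X i y ord0 mu.
Proof. by rewrite mxE. Qed.

Lemma Ck_E mu i : Ck_on 2 N (fun y => E X y mu i).
Proof. by apply: (Ck_extR oN (f := fun y => e X i y ord0 mu)) => [y _|]; [rewrite mxE|exact: Ck_coord]. Qed.

Lemma Ck_theta i mu : Ck_on 2 N (fun y => theta X y i mu).
Proof. by apply: Ck_invmx => // a b; exact: Ck_E. Qed.

Lemma theta_e y i j : N y -> \sum_mu theta X y i mu * e X j y ord0 mu = (i == j)%:R.
Proof.
move=> Ny; have /matrixP/(_ i j) := mulVmx (uE Ny); rewrite !mxE => <-.
by apply: eq_bigr => mu _; rewrite EE.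
Qed.

Lemma e_theta y mu nu : N y -> \sum_i e X i y ord0 mu * theta X y i nu = (mu == nu)%:R.
Proof.
move=> Ny; have /matrixP/(_ mu nu) := mulmxV (uE Ny); rewrite !mxE => <-.
by apply: eq_bigr => i _; rewrite EE.
Qed.

Lemma pd_theta b l n y : N y -> pd b (fun z => theta X z l n) y =
  - \sum_j \sum_mu theta X y l mu * pd b (fun z => e X j z ord0 mu) y * theta X y j n.
Proof.
move=> Ny.
have nu : \forall z \near y, E X z \in unitmx by exact: filterS uE (open_nbhs_nbhs (conj oN Ny)).
have /matrixP/(_ l n) := @dmx_inv _ _ _ (E X) (delta_mx ord0 b) y nu
  (fun i j => Ck_diff (Ck_E i j) Ny) (fun i j => Ck_diff (Ck_theta i j) Ny).
rewrite !mxE => H; rewrite {1}/pd {1}/theta H; congr (- _); apply: eq_bigr => j _.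
rewrite mxE mulr_suml; apply: eq_bigr => mu _; rewrite mxE; congr (_ * _ * _).
suff -> : (fun z => E X z mu j) = (fun z => e X j z ord0 mu) by [].
by apply/funext => z; rewrite EE.
Qed.

Lemma bracketE i j mu y : N y -> lie_bracket (e X i) (e X j) y ord0 mu =
  \sum_c e X i y ord0 c * pd c (fun z => e X j z ord0 mu) y
  - \sum_c e X j y ord0 c * pd c (fun z => e X i z ord0 mu) y.
Proof.
move=> Ny; rewrite /lie_bracket mxE [X in _ + X]mxE.
have H a b : ('D_(e X a y) (e X b) y) ord0 mu =
    \sum_c e X a y ord0 c * pd c (fun z => e X b z ord0 mu) y.
  have de : differentiable (e X b) y by exact: Ck_diff (ce b) _ Ny.
  rewrite dlin_row // summxE; apply: eq_bigr => c _; rewrite mxE /pd dcoord //.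
by rewrite !H.
Qed.

(** Cartan's structure equation. Differentiating the inverse matrix expresses [d theta] through
    derivatives of the frame, and the antisymmetrized result is the bracket of frame fields
    evaluated by [theta^l]. *)
Lemma dtheta l b n y : N y ->
  pd b (fun z => theta X z l n) y - pd n (fun z => theta X z l b) y =
  - \sum_i \sum_j sigma X i l j y * theta X y i b * theta X y j n.
Proof.
move=> Ny; rewrite !pd_theta // -opprD; congr (- _).
(* Completeness of the frame: a covector is recovered from its values on the [e_i]. *)
have H (F : 'I_4 -> R) c : \sum_i (\sum_d e X i y ord0 d * F d) * theta X y i c = F c.
  under eq_bigr do rewrite mulr_suml.
  rewrite exchange_big /=.
  transitivity (\sum_d F d * (d == c)%:R).
    apply: eq_bigr => d _; rewrite -(e_theta _ _ Ny) mulr_sumr.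
    by apply: eq_bigr => i _; ring.
  by rewrite (bigD1 c) //= eqxx mulr1 big1 ?addr0 // => i /negbTE ->; rewrite mulr0.
rewrite /sigma; under [RHS]eq_bigr do under eq_bigr do under eq_bigr do rewrite bracketE // mulrBr.
under [RHS]eq_bigr do under eq_bigr do rewrite sumrB !mulrBl.
under [RHS]eq_bigr do rewrite sumrB.
rewrite sumrB; congr (_ - _).
  rewrite [RHS]exchange_big /=; apply: eq_bigr => j _; rewrite -mulr_suml -[RHS]mulr_suml; congr (_ * _).
  rewrite -[LHS](H (fun c => \sum_mu theta X y l mu * pd c (fun z => e X j z ord0 mu) y)).
  apply: eq_bigr => i _; congr (_ * _); under eq_bigr do rewrite mulr_sumr.
  rewrite exchange_big /=; apply: eq_bigr => mu _; rewrite mulr_sumr; apply: eq_bigr => d _; ring.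
apply: eq_bigr => i _; rewrite -mulr_suml.
have -> : \sum_j (\sum_mu theta X y l mu * \sum_c e X j y ord0 c * pd c (fun z => e X i z ord0 mu) y)
     * theta X y i b * theta X y j n =
   (\sum_j (\sum_d e X j y ord0 d * (\sum_mu theta X y l mu * pd d (fun z => e X i z ord0 mu) y)) * theta X y j n) * theta X y i b.
  rewrite mulr_suml; apply: eq_bigr => j _; rewrite mulrAC; congr (_ * _ * _).
  under [RHS]eq_bigr do rewrite mulr_sumr.
  rewrite [RHS]exchange_big /=; apply: eq_bigr => mu _; rewrite mulr_sumr; apply: eq_bigr => d _; ring.
by rewrite H.
Qed.

Definition frame_commutes (y : pt4) : Prop :=
  forall K, lie_bracket (e X ord0) (e X (sp K)) y = 0.

Lemma sigma0 l j y : frame_commutes y -> sigma X ord0 l j y = 0.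
Proof.
move=> H; rewrite /sigma big1 // => mu _.
case: (unliftP ord0 j) => [K ->|->]; first by rewrite H mxE mulr0.
by rewrite /lie_bracket subrr mxE mulr0.
Qed.

Lemma sigma0r l i y : frame_commutes y -> sigma X i l ord0 y = 0.
Proof.
move=> H; rewrite /sigma big1 // => mu _.
case: (unliftP ord0 i) => [K ->|->]; last by rewrite /lie_bracket subrr mxE mulr0.
by rewrite /lie_bracket -opprB -/(lie_bracket _ _ _) H oppr0 mxE mulr0.
Qed.

Lemma dtheta_sp l b n y : N y -> frame_commutes y ->
  pd b (fun z => theta X z l n) y - pd n (fun z => theta X z l b) y =
  - \sum_(M < 3) \sum_(L < 3) sigma X (sp M) l (sp L) y * theta X y (sp M) b * theta X y (sp L) n.
Proof.
move=> Ny H; rewrite dtheta //; congr (- _).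
rewrite big_ord_recl big1 ?add0r; last by move=> j _; rewrite sigma0 // !mul0r.
apply: eq_bigr => M _; rewrite big_ord_recl sigma0r // !mul0r add0r.
by apply: eq_bigr.
Qed.

(** Cartan's formula: [theta^l(w)] is constant, and contracting [d theta^l] with [w = e_0] leaves
    only structure coefficients carrying an index 0, which vanish because the frame commutes with
    w. *)
Lemma lie_theta l n y : N y -> frame_commutes y ->
  \sum_c w X y ord0 c * pd c (fun z => theta X z l n) y
  + \sum_c theta X y l c * pd n (fun z => w X z ord0 c) y = 0.
Proof.
move=> Ny H.
have dw c : differentiable (fun z => w X z ord0 c) y.
  by have := Ck_diff (Ck_coord ord0 c oN (ce ord0)) Ny; rewrite e0E.
have dt i c : differentiable (fun z => theta X z i c) y by exact: (Ck_diff (Ck_theta i c) Ny).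
have H1 : \sum_c (pd n (fun z => theta X z l c) y * w X y ord0 c + theta X y l c * pd n (fun z => w X z ord0 c) y) = 0.
  transitivity (pd n (fun z => \sum_c theta X z l c * w X z ord0 c) y).
    rewrite /pd dsum => [|c]; last exact: diffble_mul.
    by apply: eq_bigr => c _; rewrite dmul.
  rewrite /pd (@near_eq_derive _ _ _ _ (fun _ : pt4 => (l == ord0)%:R : R)) ?dcst //.
  by apply: filterS (open_nbhs_nbhs (conj oN Ny)) => z Nz; rewrite -(theta_e l ord0 Nz) e0E.
rewrite -[RHS]H1 !big_split /=; congr (_ + _).
apply/eqP; rewrite -subr_eq0 -sumrB; apply/eqP.
transitivity (\sum_c w X y ord0 c * - \sum_i \sum_j sigma X i l j y * theta X y i c * theta X y j n).
  by apply: eq_bigr => c _; rewrite -dtheta // mulrBr; congr (_ - _); rewrite mulrC.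
transitivity (- \sum_i (\sum_c theta X y i c * w X y ord0 c) * \sum_j sigma X i l j y * theta X y j n).
  rewrite -sumrN; under [RHS]eq_bigr do rewrite -mulNr -sumrN mulr_suml.
  rewrite [RHS]exchange_big /=; apply: eq_bigr => c _; rewrite mulrN -mulNr mulr_sumr; apply: eq_bigr => i _.
  by rewrite !mulr_sumr; apply: eq_bigr => j _; ring.
rewrite big1 ?oppr0 // => i _; case: (unliftP ord0 i) => [K ->|->].
  by rewrite -e0E theta_e // eq_sym (negbTE (neq_lift _ _)) mul0r.
by rewrite [X in _ * X]big1 ?mulr0 // => j _; rewrite sigma0 // mul0r.
Qed.
End Frame.

(** * Jacobian of phi and the Piola identity *)

Section Piola.
Set Implicit Arguments.
Unset Strict Implicit.
Variables (R : realType) (X : body R).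
Notation pt4 := 'rV[R]_4.
Variable N : set pt4.
Hypotheses (oN : open N) (cphi : Ck_on 3 N (phi X)) (uJ : forall x, N x -> J X x \in unitmx).

Lemma Ck_phi mu : Ck_on 3 N (fun x => phi X x ord0 mu).
Proof. exact: Ck_coord. Qed.

Lemma JE x mu nu : J X x mu nu = pd nu (fun z => phi X z ord0 mu) x.
Proof. by rewrite mxE. Qed.

Lemma Ck_J mu nu : Ck_on 2 N (fun x => J X x mu nu).
Proof. by apply: (Ck_extR oN) (Ck_D (delta_mx ord0 nu) (Ck_phi mu)) => x _; rewrite mxE. Qed.

Lemma Ck_Jinv mu nu : Ck_on 2 N (fun x => Jinv X x mu nu).
Proof. by apply: Ck_invmx => // i j; exact: Ck_J. Qed.

Lemma Ck_detJ : Ck_on 2 N (fun x => \det (J X x)).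
Proof. by apply: Ck_det => // i j; exact: Ck_J. Qed.

Lemma J_Jinv x a b : N x -> \sum_c J X x a c * Jinv X x c b = (a == b)%:R.
Proof. by move=> Nx; have /matrixP/(_ a b) := mulmxV (uJ Nx); rewrite !mxE => <-. Qed.

Lemma Jinv_J x a b : N x -> \sum_c Jinv X x a c * J X x c b = (a == b)%:R.
Proof. by move=> Nx; have /matrixP/(_ a b) := mulVmx (uJ Nx); rewrite !mxE => <-. Qed.

Lemma pd_J_sym a mu nu x : N x -> pd a (fun z => J X z mu nu) x = pd nu (fun z => J X z mu a) x.
Proof.
move=> Nx; have H b : (fun z => J X z mu b) = pd b (fun z => phi X z ord0 mu).
  by apply/funext => z; rewrite JE.
by rewrite !H; exact: Ck_young oN (Ck_phi mu) Nx.
Qed.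

Lemma chain_phi (h : pt4 -> R) x b : N x -> differentiable h (phi X x) ->
  pd b (fun z => h (phi X z)) x = \sum_om J X x om b * pd om h (phi X x).
Proof.
move=> Nx dh; have dp : differentiable (phi X) x by exact: Ck_diff cphi _ Nx.
rewrite /pd (@dcomp _ _ _ _ h (phi X)) // dlin_row //; apply: eq_bigr => om _.
by rewrite JE /pd dcoord.
Qed.

(** Jacobi's formula for the determinant and the derivative of the inverse produce two sums that
    differ only by exchanging the two derivatives falling on phi. *)
Lemma piola mu x : N x -> \sum_a pd a (fun z => \det (J X z) * Jinv X z a mu) x = 0.
Proof.
move=> Nx; have dJ i j : differentiable (fun z => J X z i j) x by exact: (Ck_diff (Ck_J i j) Nx).
have dJi i j : differentiable (fun z => Jinv X z i j) x by exact: (Ck_diff (Ck_Jinv i j) Nx).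
have d1 a : pd a (fun z => \det (J X z)) x =
    \det (J X x) * \sum_i \sum_j pd a (fun z => J X z i j) x * Jinv X x j i.
  rewrite /pd det_derive // mulr_sumr; apply: eq_bigr => i _; rewrite mulr_sumr.
  apply: eq_bigr => j _; rewrite [RHS]mulrCA; congr (_ * _).
  rewrite /Jinv /invmx uJ // !mxE mulrA mulfV ?mul1r //.
  by have := uJ Nx; rewrite unitmxE unitfE.
have d2 a : pd a (fun z => Jinv X z a mu) x =
    - \sum_j \sum_i Jinv X x a i * pd a (fun z => J X z i j) x * Jinv X x j mu.
  have nu : \forall z \near x, J X z \in unitmx by exact: filterS uJ (open_nbhs_nbhs (conj oN Nx)).
  have /matrixP/(_ a mu) := @dmx_inv _ _ _ (J X) (delta_mx ord0 a) x nu dJ dJi.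
  rewrite !mxE => H; rewrite {1}/pd {1}/Jinv H; congr (- _); apply: eq_bigr => j _.
  by rewrite mxE mulr_suml; apply: eq_bigr => i _; rewrite mxE.
under eq_bigr => a _.
  rewrite /pd dmul //; last exact: (Ck_diff Ck_detJ Nx).
  rewrite -/(pd a (fun z => \det (J X z)) x) -/(pd a (fun z => Jinv X z a mu) x) d1 d2 mulrN -mulrA -mulrBr.
  over.
rewrite -mulr_sumr sumrB; apply/eqP; rewrite mulf_eq0; apply/orP; right.
rewrite subr_eq0; apply/eqP.
under eq_bigr do rewrite mulr_suml.
transitivity (\sum_a \sum_i \sum_j pd j (fun z => J X z i a) x * Jinv X x j i * Jinv X x a mu).
  apply: eq_bigr => a _; apply: eq_bigr => i _; rewrite mulr_suml; apply: eq_bigr => j _.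
  by rewrite pd_J_sym.
rewrite exchange_big /= [RHS]exchange_big /=.
under [RHS]eq_bigr do rewrite exchange_big /=.
rewrite [RHS]exchange_big /=; apply: eq_bigr => i _; apply: eq_bigr => a _; apply: eq_bigr => j _.
by congr (_ * _); rewrite mulrC.
Qed.

Lemma piola_div (V : 'I_4 -> pt4 -> R) x : N x -> (forall mu, differentiable (V mu) (phi X x)) ->
  \sum_a pd a (fun z => \det (J X z) * \sum_mu Jinv X z a mu * V mu (phi X z)) x =
  \det (J X x) * \sum_mu pd mu (V mu) (phi X x).
Proof.
move=> Nx dV; have dp : differentiable (phi X) x by exact: Ck_diff cphi _ Nx.
have dVp mu : differentiable (fun z => V mu (phi X z)) x by exact: diffble_comp.
have dJi i j : differentiable (fun z => Jinv X z i j) x by exact: (Ck_diff (Ck_Jinv i j) Nx).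
have dD : differentiable (fun z => \det (J X z)) x by exact: (Ck_diff Ck_detJ Nx).
have H a : pd a (fun z => \det (J X z) * \sum_mu Jinv X z a mu * V mu (phi X z)) x =
   \sum_mu pd a (fun z => \det (J X z) * Jinv X z a mu) x * V mu (phi X x)
   + \det (J X x) * \sum_mu \sum_om (Jinv X x a mu * J X x om a) * pd om (V mu) (phi X x).
  have -> : (fun z => \det (J X z) * \sum_mu Jinv X z a mu * V mu (phi X z)) =
     (fun z => \sum_mu (\det (J X z) * Jinv X z a mu) * V mu (phi X z)).
    by apply/funext => z; rewrite mulr_sumr; apply: eq_bigr => mu _; rewrite mulrA.
  rewrite {1}/pd dsum => [|mu]; last by do 2!apply: diffble_mul => //.
  rewrite mulr_sumr -big_split; apply: eq_bigr => mu _ /=.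
  rewrite dmul //; last exact: diffble_mul.
  congr (_ + _); rewrite -/(pd a (fun z => V mu (phi X z)) x) chain_phi // -mulrA; congr (_ * _).
  by rewrite mulr_sumr; apply: eq_bigr => om _; rewrite mulrA.
under eq_bigr do rewrite H.
rewrite big_split /= exchange_big /= big1 ?add0r; last first.
  by move=> mu _; rewrite -mulr_suml piola // mul0r.
rewrite -mulr_sumr; congr (_ * _); rewrite exchange_big /=; apply: eq_bigr => mu _.
rewrite exchange_big /=.
under eq_bigr => om _.
  rewrite -mulr_suml; under eq_bigr do rewrite mulrC.
  rewrite J_Jinv //; over.
by rewrite (bigD1 mu) //= eqxx mul1r big1 ?addr0 // => i /negbTE ->; rewrite mul0r.
Qed.
End Piola.

(** * The frame pulled back to Lagrangian coordinates *)

Section Lagrange.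
Set Implicit Arguments.
Unset Strict Implicit.
Variables (R : realType) (X : body R).
Notation pt4 := 'rV[R]_4.
Variables (N M : set pt4).
Hypotheses (oN : open N) (ce : forall i, Ck_on 2 N (e X i)).
Hypotheses (oM : open M) (cphi : Ck_on 3 M (phi X)) (uJ : forall x, M x -> J X x \in unitmx)
  (MN : forall x, M x -> N (phi X x))
  (dphi0 : forall x, M x -> 'D_(delta_mx ord0 ord0) (phi X) x = w X (phi X x)).

Lemma Ck_phi2 : Ck_on 2 M (phi X).
Proof. exact: CkS. Qed.

Lemma Ck_Ephi mu i : Ck_on 2 M (fun x => E X (phi X x) mu i).
Proof. exact: (Ck_comp oM MN (Ck_E oN ce mu i) Ck_phi2). Qed.

Lemma Ck_Ebar i j : Ck_on 2 M (fun x => Ebar X x i j).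
Proof.
apply: Ck_mulmx => // a b; last exact: Ck_Ephi.
exact: Ck_Jinv.
Qed.

Lemma e_push x mu i : M x -> e X i (phi X x) ord0 mu = \sum_nu J X x mu nu * Ebar X x nu i.
Proof.
move=> Mx; have : J X x *m Ebar X x = E X (phi X x) by rewrite mulmxA mulmxV ?mul1mx ?uJ.
by move=> /matrixP/(_ mu i); rewrite !mxE => <-.
Qed.

Lemma pd0_phi x mu : M x -> pd ord0 (fun z => phi X z ord0 mu) x = w X (phi X x) ord0 mu.
Proof. by move=> Mx; rewrite /pd dcoord ?dphi0 //; exact: (Ck_diff cphi Mx). Qed.

Lemma Ebar0 x b : M x -> Ebar X x b ord0 = (b == ord0)%:R.
Proof.
move=> Mx; rewrite mxE -(Jinv_J uJ b ord0 Mx); apply: eq_bigr => mu _.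
by rewrite JE pd0_phi // mxE e0E.
Qed.

(** Components of the Lie bracket of the pulled-back fields [ebar_i] and [ebar_j]. *)
Definition bar_bracket i j nu x : R :=
  \sum_b Ebar X x b i * pd b (fun z => Ebar X z nu j) x
  - \sum_b Ebar X x b j * pd b (fun z => Ebar X z nu i) x.

(* The first derivatives of J cancel in the bracket because second derivatives
   of phi are symmetric. *)
Lemma bracket_push i j mu x : M x -> lie_bracket (e X i) (e X j) (phi X x) ord0 mu =
  \sum_nu J X x mu nu * bar_bracket i j nu x.
Proof.
move=> Mx; rewrite (bracketE ce) ?MN //.
have dE a b : differentiable (fun z => Ebar X z a b) x by exact: (Ck_diff (Ck_Ebar a b) Mx).
have dJ a b : differentiable (fun z => J X z a b) x by exact: (Ck_diff (Ck_J oM cphi a b) Mx).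
have H a c : \sum_d e X a (phi X x) ord0 d * pd d (fun z => e X c z ord0 mu) (phi X x) =
    \sum_b \sum_nu (Ebar X x b a * Ebar X x nu c * pd b (fun z => J X z mu nu) x)
    + \sum_b \sum_nu (J X x mu nu * (Ebar X x b a * pd b (fun z => Ebar X z nu c) x)).
  transitivity (\sum_b Ebar X x b a * pd b (fun z => e X c (phi X z) ord0 mu) x).
    under eq_bigr do rewrite e_push // mulr_suml.
    rewrite exchange_big /=; apply: eq_bigr => b _.
    have de : differentiable (fun z => e X c z ord0 mu) (phi X x).
      exact: (Ck_diff (Ck_coord ord0 mu oN (ce c)) (MN Mx)).
    rewrite (chain_phi cphi b Mx de) mulr_sumr; apply: eq_bigr => d _.
    by rewrite mulrAC mulrC.
  rewrite -big_split; apply: eq_bigr => b _ /=.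
  have -> : pd b (fun z => e X c (phi X z) ord0 mu) x =
      pd b (fun z => \sum_nu J X z mu nu * Ebar X z nu c) x.
    apply: near_eq_derive; apply: filterS (open_nbhs_nbhs (conj oM Mx)) => z Mz.
    exact: e_push.
  rewrite [in LHS]/pd dsum => [|nu]; last exact: diffble_mul.
  rewrite mulr_sumr -big_split; apply: eq_bigr => nu _ /=.
  rewrite dmul //; rewrite /pd.
  move: ('D__ _ x) ('D__ _ x) => d1 d2; ring.
rewrite !H opprD addrACA.
have -> : \sum_b \sum_nu (Ebar X x b i * Ebar X x nu j * pd b (fun z => J X z mu nu) x)
   - \sum_b \sum_nu (Ebar X x b j * Ebar X x nu i * pd b (fun z => J X z mu nu) x) = 0.
  apply/eqP; rewrite subr_eq0; apply/eqP; rewrite exchange_big /=.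
  apply: eq_bigr => b _; apply: eq_bigr => nu _.
  by rewrite (pd_J_sym oM cphi nu mu b Mx) [Ebar _ _ _ _ * _]mulrC.
rewrite add0r exchange_big /= [X in _ - X]exchange_big /= -sumrB.
by apply: eq_bigr => nu _; rewrite -!mulr_sumr -mulrBr.
exact: MN.
Qed.

Lemma J_inj x (v : 'I_4 -> R) : M x -> (forall mu, \sum_nu J X x mu nu * v nu = 0) ->
  forall nu, v nu = 0.
Proof.
move=> Mx H nu; transitivity (\sum_b (\sum_mu Jinv X x nu mu * J X x mu b) * v b).
  under eq_bigr do rewrite (Jinv_J uJ) //.
  by rewrite (bigD1 nu) //= eqxx mul1r big1 ?addr0 // => i ib; rewrite eq_sym (negbTE ib) mul0r.
under eq_bigr do rewrite mulr_suml.
rewrite exchange_big /= big1 // => mu _.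
by under eq_bigr do rewrite -mulrA; rewrite -mulr_sumr H mulr0.
Qed.

Lemma JT_inj x (v : 'I_4 -> R) : M x -> (forall b, \sum_om J X x om b * v om = 0) ->
  forall om, v om = 0.
Proof.
move=> Mx H om; transitivity (\sum_a (\sum_b J X x a b * Jinv X x b om) * v a).
  under eq_bigr do rewrite (J_Jinv uJ) //.
  by rewrite (bigD1 om) //= eqxx mul1r big1 ?addr0 // => i /negbTE ->; rewrite mul0r.
under eq_bigr do rewrite mulr_suml.
rewrite exchange_big /= big1 // => b _.
transitivity (Jinv X x b om * \sum_a J X x a b * v a); last by rewrite H mulr0.
by rewrite mulr_sumr; apply: eq_bigr => a _; rewrite mulrAC mulrC.
Qed.

(** Near x the field [ebar_0] is the constant coordinate field, so its bracket with [ebar_j] is just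
    the time derivative of [ebar_j]; the bracket vanishes because its push-forward does and J is
    injective. *)
Lemma pd0_Ebar x nu j : M x -> frame_commutes X (phi X x) ->
  pd ord0 (fun z => Ebar X z nu j) x = 0.
Proof.
move=> Mx H; have B0 : forall nu, bar_bracket ord0 j nu x = 0.
  apply: (J_inj Mx) => mu; rewrite -bracket_push //.
  case: (unliftP ord0 j) => [K ->|->]; first by rewrite H mxE.
  by rewrite /lie_bracket subrr mxE.
have := B0 nu; rewrite /bar_bracket.
have -> : \sum_b Ebar X x b j * pd b (fun z => Ebar X z nu ord0) x = 0.
  apply: big1 => b _; rewrite /pd (@near_eq_derive _ _ _ _ (fun _ : pt4 => (nu == ord0)%:R : R)) ?dcst ?mulr0 //.
  by apply: filterS (open_nbhs_nbhs (conj oM Mx)) => z Mz; exact: Ebar0.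
under eq_bigr do rewrite Ebar0 //.
rewrite subr0 => <-; symmetry; rewrite (bigD1 ord0) // eqxx mul1r big1; first exact: addr0.
by move=> i /andP[_ /negbTE ->]; rewrite mul0r.
Qed.

Lemma theta_barE x l nu : M x -> E X (phi X x) \in unitmx ->
  theta_bar X x l nu = \sum_mu theta X (phi X x) l mu * J X x mu nu.
Proof.
move=> Mx uE; suff -> : theta_bar X x = theta X (phi X x) *m J X x by rewrite mxE.
have uEb : Ebar X x \in unitmx by rewrite unitmx_mul unitmx_inv uJ // uE.
have H : (theta X (phi X x) *m J X x) *m Ebar X x = 1%:M.
  by rewrite -mulmxA mulKVmx ?uJ // mulVmx.
by rewrite /theta_bar -[RHS](mulmxK uEb) H mul1mx.
Qed.
End Lagrange.

(** * Splitting points into time and space *)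

Section Coordinates.
Set Implicit Arguments.
Unset Strict Implicit.
Variable R : realType.
Notation pt4 := 'rV[R]_4.

Lemma lift0_eqF n (K : 'I_n) : (lift ord0 K == ord0) = false.
Proof. by rewrite eq_sym (negbTE (neq_lift _ _)). Qed.

Lemma linear_row_continuous n (W : normedModType R) (l : 'rV[R]_n -> W) :
  linear l -> continuous l.
Proof.
move=> ll; pose L : {linear 'rV[R]_n -> W} := HB.pack l (GRing.isLinear.Build _ _ _ _ _ ll).
have -> : l = fun x => \sum_i x ord0 i *: l (delta_mx ord0 i).
  apply/funext => x; rewrite -[l]/(L : _ -> _) {1}[x]row_sum_delta linear_sum.
  by apply: eq_bigr => i _; rewrite linearZ.
move=> x; apply: differentiable_continuous; elim: (index_enum _) => [|i r IH].
  by under eq_fun do rewrite big_nil; exact: diffble_cst.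
under eq_fun do rewrite big_cons.
apply: differentiableD => //; apply: differentiableZl; exact: differentiable_coord.
Qed.

Lemma space_linear : linear (@space R).
Proof. by move=> a x y; apply/rowP => K; rewrite !mxE. Qed.

Lemma spaceD (x y : pt4) : space (x + y) = space x + space y.
Proof. by apply/rowP => K; rewrite !mxE. Qed.

Lemma spaceZ a (x : pt4) : space (a *: x) = a *: space x.
Proof. by apply/rowP => K; rewrite !mxE. Qed.

Lemma pt0_linear : linear (@pt R 0).
Proof.
move=> a x y; apply/rowP => i; rewrite !mxE; case: (unlift _ _) => [K|].
  by rewrite !mxE.
by rewrite mulr0 addr0.
Qed.

Lemma pt_time t (y : 'rV[R]_3) : pt t y ord0 ord0 = t.
Proof. by rewrite mxE unlift_none. Qed.

Lemma space_pt t (y : 'rV[R]_3) : space (pt t y) = y.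
Proof. by apply/rowP => K; rewrite !mxE /sp liftK. Qed.

Lemma pt_space (x : pt4) : pt (x ord0 ord0) (space x) = x.
Proof.
apply/rowP => i; rewrite mxE; case: (unliftP ord0 i) => [K ->|->].
  by rewrite ?liftK mxE.
by rewrite ?unlift_none.
Qed.

Lemma pt_shift t (y : 'rV[R]_3) : pt t y = pt 0 y + t *: delta_mx ord0 ord0.
Proof.
apply/rowP => i; rewrite !mxE; case: (unliftP ord0 i) => [K ->|->].
  by rewrite lift0_eqF andbF mulr0 addr0.
by rewrite !eqxx mulr1 add0r.
Qed.

Lemma pt_continuous t : continuous (@pt R t).
Proof.
have -> : @pt R t = fun y => pt 0 y + t *: delta_mx ord0 ord0.
  by apply/funext => y; exact: pt_shift.
move=> y; apply: continuousD; last exact: cst_continuous.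
exact: (linear_row_continuous pt0_linear).
Qed.

Definition proj (x : pt4) : pt4 := pt 0 (space x).

Lemma proj_linear : linear proj.
Proof. by move=> a x y; rewrite /proj space_linear pt0_linear. Qed.

Lemma proj_continuous : continuous proj.
Proof. exact: linear_row_continuous proj_linear. Qed.

Lemma proj_e0 : proj (delta_mx ord0 ord0) = 0.
Proof.
apply/rowP => i; rewrite !mxE; case: (unlift _ _) => [K|//].
by rewrite !mxE /sp lift0_eqF andbF.
Qed.

Lemma proj_eS K : proj (delta_mx ord0 (sp K)) = delta_mx ord0 (sp K).
Proof.
apply/rowP => i; rewrite !mxE; case: (unliftP ord0 i) => [L ->|->].
  by rewrite ?liftK !mxE.
by rewrite /sp [_ == lift _ _]eq_sym lift0_eqF andbF.
Qed.

Lemma closure_map (V W : topologicalType) (A : set V) (B : set W) (h : V -> W) x :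
  closure A x -> {for x, continuous h} -> (forall z, A z -> B (h z)) -> closure B (h x).
Proof. by move=> cA ch AB S /ch nS; have [z [/AB Bz Sz]] := cA _ nS; exists (h z). Qed.

Lemma Ck_comp_linear n (V V' W : normedModType R) (N : set V) (l : V -> V') (N' : set V')
    (f : V' -> W) : linear l -> continuous l -> open N ->
  (forall x, N x -> N' (l x)) -> @Ck_on R n V' W N' f -> @Ck_on R n V W N (fun x => f (l x)).
Proof.
move=> ll; pose L : {linear V -> V'} := HB.pack l (GRing.isLinear.Build _ _ _ _ _ ll).
exact: (@Ck_complin R n V V' W N L N' f).
Qed.

Lemma derive_linear (V W : normedModType R) (l : V -> W) x v : linear l -> continuous l ->
  differentiable l x /\ 'D_v l x = l v.
Proof.
move=> ll cl; pose L : {linear V -> W} := HB.pack l (GRing.isLinear.Build _ _ _ _ _ ll).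
have dL : differentiable L x by exact: linear_differentiable.
by split=> //; rewrite -[l]/(L : _ -> _) deriveE // diff_lin.
Qed.

End Coordinates.

(** * Functions vanishing on the Lagrangian cylinder *)

Section Cylinder.
Set Implicit Arguments.
Unset Strict Implicit.
Variables (R : realType) (X : body R).
Notation pt4 := 'rV[R]_4.
Hypothesis T0 : 0 < T X.
Hypothesis oOm : open (Omega X).

(* The Lagrangian domain together with its lateral boundary, [0, T] x closure Omega. *)
Definition Omega_Gamma_T (x : pt4) : Prop := Omega_T X x \/ Gamma_T X x.

Lemma OG_time x : Omega_Gamma_T x -> 0 <= x ord0 ord0 <= T X.
Proof. by case=> -[]. Qed.

Lemma OG_closure x : Omega_Gamma_T x -> closure (Omega X) (space x).
Proof. by case=> -[_ H]; [exact: subset_closure|case: H]. Qed.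

Lemma OG_proj x : Omega_Gamma_T x -> Omega_Gamma_T (proj x).
Proof.
have H : 0 <= proj x ord0 ord0 <= T X by rewrite pt_time lexx ltW.
by case=> -[_ Hx]; [left|right]; (split; [exact: H|rewrite /proj space_pt; exact: Hx]).
Qed.

Lemma OG_closure_T x : Omega_Gamma_T x -> closure (Omega_T X) x.
Proof.
move=> Hx; have ht := OG_time Hx; rewrite -(pt_space x).
apply: (closure_map (OG_closure Hx) (@pt_continuous R _ _)) => y Oy.
by split; rewrite ?pt_time // space_pt.
Qed.

(** Every lateral boundary point is a limit of points of [Omega_T] at the same time, so identities
    proved inside pass to [Gamma_T] by continuity. *)
Lemma OG_ext (h : pt4 -> R) x : Omega_Gamma_T x -> {for x, continuous h} ->
  (forall z, Omega_T X z -> h z = 0) -> h x = 0.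
Proof. by move=> /OG_closure_T cx ch; exact: closure_eq0 cx ch. Qed.

(** Moving in time does not change the spatial point, so the argument works for any set S of spatial
    points; it is applied with the base [Omega] and with its boundary. *)
Lemma vanish_pd0 (S : 'rV[R]_3 -> Prop) (h : pt4 -> R) (x : pt4) :
  (forall z : pt4, 0 <= z ord0 ord0 <= T X -> S (space z) -> h z = 0) ->
  0 <= x ord0 ord0 <= T X -> S (space x) -> differentiable h x -> pd ord0 h x = 0.
Proof.
move=> h0 /andP[x0 xT] Sx dh.
have hx : h x = 0 by apply: h0 => //; rewrite x0.
have sE a : space (x + a *: delta_mx ord0 ord0) = space x.
  by apply/rowP => K; rewrite !mxE /sp lift0_eqF andbF mulr0 addr0.
have tE a : (x + a *: delta_mx ord0 ord0) ord0 ord0 = x ord0 ord0 + a.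
  by rewrite !mxE !eqxx mulr1.
have [xlt|xge] := ltP (x ord0 ord0) (T X).
  apply: onesided_eq0 => //; near=> a.
  have a0 : 0 < a by near: a; exact: nbhs_right_gt.
  have aT : a < T X - x ord0 ord0 by near: a; apply: nbhs_right_lt; rewrite subr_gt0.
  apply: h0; rewrite ?sE // tE addr_ge0 ?(ltW a0) //=.
  by rewrite addrC -lerBrDr ltW.
(* At the final time only backward increments remain in the cylinder; [0 < T] leaves room for
   them. *)
apply/eqP; rewrite -oppr_eq0 /pd -dlinN //; apply/eqP.
apply: onesided_eq0 => //; near=> a.
have a0 : 0 < a by near: a; exact: nbhs_right_gt.
have aT : a < x ord0 ord0 by near: a; apply: nbhs_right_lt; apply: lt_le_trans xge.
rewrite scalerN -scaleNr; apply: h0; rewrite ?sE // tE subr_ge0 (ltW aT) /=.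
by rewrite lerBlDr (le_trans xT) // lerDl ltW.
Unshelve. all: by end_near. Qed.

Lemma vanish_pd (h : pt4 -> R) x b : (forall z, Omega_T X z -> h z = 0) ->
  Omega_T X x -> differentiable h x -> pd b h x = 0.
Proof.
move=> h0 Ox dh; case: (unliftP ord0 b) => [K ->|->]; last first.
  case: (Ox) => ht hs; apply: (vanish_pd0 (S := Omega X)) => // z z1 z2; exact: h0.
apply: onesided_eq0 => //; first exact: h0.
have [ht hs] := Ox.
have [d d0 Hd] := nbhs_norm (open_nbhs_nbhs (conj oOm hs)).
pose v : pt4 := delta_mx ord0 (lift ord0 K).
have n0 : 0 < `|space v| + 1 by rewrite ltr_wpDl.
near=> a.
have a0 : 0 < a by near: a; exact: nbhs_right_gt.
have ad : a < d / (`|space v| + 1) by near: a; apply: nbhs_right_lt; rewrite divr_gt0.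
apply: h0; split.
  by rewrite !mxE eqxx (negbTE (neq_lift _ _)) mulr0 addr0.
apply: Hd; rewrite spaceD spaceZ addrC addKr normrZ gtr0_norm //.
rewrite ltr_pdivlMr // in ad; apply: le_lt_trans ad.
by rewrite ler_pM2l // lerDl.
Unshelve. all: by end_near. Qed.

Lemma const_in_time (h : pt4 -> R) x : (forall z, Omega_T X z -> differentiable h z) ->
  (forall z, Omega_T X z -> pd ord0 h z = 0) -> Omega_T X x -> h x = h (proj x).
Proof.
move=> dh h0 [/andP[t0 tT] hs].
have E s : pt s (space x) = proj x + s *: delta_mx ord0 ord0 by rewrite pt_shift.
have O s : 0 <= s <= x ord0 ord0 -> Omega_T X (pt s (space x)).
  move=> /andP[s0 st]; split; rewrite ?space_pt // pt_time s0 /=; exact: le_trans tT.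
have := @is_derive0_const R (fun s => h (proj x + s *: delta_mx ord0 ord0)) 0 (x ord0 ord0) t0.
rewrite scale0r addr0 -E pt_space; apply=> s hs'.
have D : differentiable h (proj x + s *: delta_mx ord0 ord0) by rewrite -E; apply: dh; exact: O.
have := is_derive_line D; have -> // : 'D_(delta_mx ord0 ord0) h (proj x + s *: delta_mx ord0 ord0) = 0.
by rewrite -E; apply: h0; exact: O.
Qed.
End Cylinder.

(** * Open neighbourhoods on which all data are regular; invertibility of the frame *)

Section Domains.
Set Implicit Arguments.
Unset Strict Implicit.
Variables (R : realType) (X : body R).
Notation pt4 := 'rV[R]_4.
Hypotheses (hEos : equation_of_state X) (hp : pressure_function X) (hF : F_function X)
  (hA1 : lorentzian X) (hA2 : cylinder_domain X) (hA3 : fluid_solution X)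
  (hA4 : flow_invariant X) (hLag : lagrangian_coordinates X) (hFrame : adapted_frame X).

Lemma T_gt0 : 0 < T X.
Proof. by case: hA4. Qed.

Lemma open_Omega : open (Omega X).
Proof. by case: hA2 => -[]. Qed.

(** The map phi is the flow composed with this linear map, and so inherits the regularity of the
    flow on the open set [M0]. *)
Definition lag (x : pt4) : R * pt4 := (x ord0 ord0, proj x).

Lemma lag_linear : linear lag.
Proof.
move=> a x y; congr pair; first by rewrite !mxE.
exact: proj_linear.
Qed.

Lemma lag_continuous : continuous lag.
Proof. exact: linear_row_continuous lag_linear. Qed.

Definition M0 : set pt4 := lag @^-1` flow_dom X.

Lemma open_M0 : open M0.
Proof.
have [[oF _ _ _ _] _ _ _ _] := hA4.
have -> : M0 = setT `&` lag @^-1` flow_dom X by rewrite setTI.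
by apply: open_preimage_on => //; [exact: openT|move=> x _; exact: lag_continuous].
Qed.

Lemma Ck_phi0 n : (n <= k X)%N -> Ck_on n M0 (phi X).
Proof.
move=> nk; have [[_ cF _ _ _] _ _ _ _] := hA4.
exact: (Ck_comp_linear lag_linear lag_continuous open_M0 (fun x H => H) (Ck_le nk cF)).
Qed.

Lemma phi0E x : M0 x -> 'D_(delta_mx ord0 ord0) (phi X) x = w X (phi X x).
Proof.
move=> Mx; have [[_ _ _ _ dF] _ _ _ _] := hA4.
have [_ [_ <-]] := dF _ _ Mx; rewrite /derive; congr (lim _).
have -> // : (fun h : R => h^-1 *: ((phi X \o shift x) (h *: delta_mx ord0 ord0) - phi X x)) =
  (fun h : R => h^-1 *: (((fun s : R => flow X (s, proj x)) \o shift (x ord0 ord0)) (h *: 1) - flow X (x ord0 ord0, proj x))).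
apply/funext => h /=; congr (_ *: (_ - _)); rewrite /phi -/(proj _); congr (flow X (_, _)).
  by rewrite !mxE !eqxx.
by rewrite proj_linear proj_e0 scaler0 add0r.
Qed.

Lemma proj_proj x : proj (proj x) = proj x :> pt4.
Proof. by rewrite /proj space_pt. Qed.

Lemma phi_proj x : M0 x -> phi X (proj x) = proj x.
Proof.
move=> Mx; have [[_ _ _ _ dF] _ _ _ _] := hA4.
have [H _] := dF _ _ Mx.
by rewrite /phi -/(proj _) proj_proj pt_time.
Qed.

Lemma OG_M0 x : Omega_Gamma_T X x -> M0 x.
Proof.
move=> Hx; have [_ _ _ H _] := hA4.
exact: H (OG_time Hx) (OG_closure Hx).
Qed.

Lemma phi_UT x : Omega_T X x -> U_T X (phi X x).
Proof.
move=> [ht hs]; exists (x ord0 ord0); first by rewrite /= in_itv.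
by exists (proj x) => //; exists (space x).
Qed.

Lemma UT_U y : U_T X y -> U X y.
Proof. by case: hA4 => _ _ _ _; apply. Qed.

Lemma phi_closure_UT x : Omega_Gamma_T X x -> closure (U_T X) (phi X x).
Proof.
move=> Hx; apply: (closure_map (OG_closure_T Hx)); last exact: phi_UT.
exact: Ck_cont (Ck_phi0 (leq0n _)) _ (OG_M0 Hx).
Qed.

Lemma closure_UT_U y : closure (U_T X) y -> closure (U X) y.
Proof. by move=> H B /H [z [/UT_U Uz Bz]]; exists z. Qed.

(* The derivatives in the theorem are taken up to the boundary, so everything is
   extended to neighbourhoods: N of the closed fluid region, M of its Lagrangian
   counterpart, NZ of the values of zeta. *)
Record regular_data (NZ : set R) (N M : set pt4) : Prop := Regular_data {
  g_oN : open N;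
  g_oM : open M;
  g_cw : Ck_on 3 N (w X);
  g_w2 : forall y, N y -> 0 < w2 X y;
  g_NZ : forall y, N y -> NZ (zeta X y);
  g_Hz : forall z, NZ z -> [/\ 0 < z, F X z != 0,
     is_derive z 1 (p X) ((rho X (p X z) + p X z) / z) &
     is_derive z 1 (F X) (- (F X z * derive1 (rho X) (p X z) / z))];
  g_Cz : forall n, [/\ Ck_on n NZ (p X), Ck_on n NZ (F X) &
    Ck_on n NZ (fun z => derive1 (rho X) (p X z))];
  g_ce : forall i, Ck_on 2 N (e X i);
  g_cphi : Ck_on 3 M (phi X);
  g_uJ : forall x, M x -> J X x \in unitmx;
  g_MN : forall x, M x -> N (phi X x);
  g_dphi0 : forall x, M x -> 'D_(delta_mx ord0 ord0) (phi X) x = w X (phi X x);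
  g_M0 : forall x, M x -> M0 x;
  g_OG : forall x, Omega_Gamma_T X x -> M x
}.

(** The neighbourhoods are shrunk successively by open conditions: [w^2 > 0], [zeta] in [NZ], [phi]
    with values in the shrunken set, [det J != 0]. Each holds on the closed fluid region or its
    Lagrangian counterpart, so these sets are never lost. *)
Lemma regular_data_exists : exists NZ N M, regular_data NZ N M.
Proof.
have [k8 [Nw [oNw sNw cw]] w2c z1 FW] := hA3.
have [ce _ _ _] := hFrame.
have /choice [NK HNK] : forall K, exists N : set pt4,
    [/\ open N, closure (U_T X) `<=` N & Ck_on (k X).-1 N (e_sp X K)].
  by move=> K; have [[N H] _] := ce K; exists N.
have [NZ [oNZ sNZ Hz Cz]] := eos_regular hEos hp hF.
pose i0 : 'I_3 := ord0; pose i1 : 'I_3 := lift ord0 ord0; pose i2 : 'I_3 := ord_max.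
pose N1 := Nw `&` (NK i0 `&` (NK i1 `&` NK i2)).
have oK K : open (NK K) by have [] := HNK K.
have sK K : closure (U_T X) `<=` NK K by have [] := HNK K.
have oN1 : open N1 by exact: openI oNw (openI (oK _) (openI (oK _) (oK _))).
have N1K K : N1 `<=` NK K.
  move=> y [_ [H0 [H1 H2]]]; case: K => -[|[|[|//]]] i.
  - by rewrite (_ : Ordinal i = i0) //; apply: val_inj.
  - by rewrite (_ : Ordinal i = i1) //; apply: val_inj.
  - by rewrite (_ : Ordinal i = i2) //; apply: val_inj.
have cw1 : Ck_on 3 N1 (w X).
  apply: (Ck_le (n := k X)); first exact: leq_trans k8.
  by apply: Ck_sub cw => y [].
pose N2 := N1 `&` w2 X @^-1` [set z | 0 < z].
have oN2 : open N2.
  exact: (open_preimage_on oN1 (Ck_cont (Ck_w2 hA1 oN1 cw1)) (@open_gt R 0)).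
have N21 : N2 `<=` N1 by move=> y [].
have cw2 := Ck_sub N21 cw1.
have w2p2 y : N2 y -> 0 < w2 X y by case.
have cz2 := Ck_zeta hA1 oN2 cw2 w2p2.
pose N3 := N2 `&` zeta X @^-1` NZ.
have oN3 : open N3.
  by apply: open_preimage_on => //; exact: Ck_cont cz2.
have N32 : N3 `<=` N2 by move=> y [].
have cz3 := Ck_sub N32 cz2.
have ce3 i : Ck_on 2 N3 (e X i).
  case: (unliftP ord0 i) => [K ->|->].
    rewrite -/(sp K) eSE; have [_ _ cK] := HNK K.
    apply: (Ck_le (n := (k X).-1)).
      by rewrite -ltnS; apply: leq_trans (leqSpred _); apply: leq_trans k8.
    by apply: Ck_sub cK => y /N32/N21/N1K.
  by rewrite e0E; apply: CkS; exact: Ck_sub N32 cw2.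
have sN3 : closure (U_T X) `<=` N3.
  move=> y cy; have cUy := closure_UT_U cy.
  have N1y : N1 y.
    by split; [exact: sNw|split; [exact: sK|split; exact: sK]].
  have N2y : N2 y by split=> //; exact: w2c.
  (* The bound [1 <= zeta] is given on U and reaches its closure by continuity. *)
  split=> //; apply: sNZ; apply: (closure_ge cUy) => //.
  exact: Ck_cont cz2 _ N2y.
pose M1 := M0 `&` phi X @^-1` N3.
have oM1 : open M1.
  by apply: open_preimage_on => //; [exact: open_M0|exact: Ck_cont (Ck_phi0 (leq0n _))].
have k3 : (3 <= k X)%N by exact: leq_trans k8.
have cphi1 : Ck_on 3 M1 (phi X) by apply: Ck_sub (Ck_phi0 k3) => x [].
pose M2 := M1 `&` (fun x => \det (J X x)) @^-1` [set z | z != 0].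
have cJ i j : Ck_on 2 M1 (fun x => J X x i j).
  by apply: (Ck_extR oM1) (Ck_D (delta_mx ord0 j) (Ck_phi oM1 cphi1 i)) => x _; rewrite JE.
have oM2 : open M2.
  apply: (open_preimage_on _ _ (@open_neq R 0)) => //.
  by apply: Ck_cont; apply: Ck_det => //; exact: cJ.
exists NZ, N3, M2; split=> //.
- exact: Ck_sub N32 cw2.
- by move=> y /N32 /w2p2.
- by move=> y [].
- by apply: Ck_sub cphi1 => x [].
- by move=> x [_ H]; rewrite unitmxE unitfE.
- by move=> x [[_ H] _].
- by move=> x [[H _] _]; exact: phi0E.
- by move=> x [[H _] _].
move=> x Hx; split; last by have := hLag Hx; rewrite unitmxE unitfE.
by split; [exact: OG_M0|exact/sN3/phi_closure_UT].
Qed.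

Section Regular_data.
Variables (NZ : set R) (N M : set pt4).
Hypothesis G : regular_data NZ N M.

Lemma OG_Mproj x : Omega_Gamma_T X x -> M (proj x).
Proof. by move=> Hx; apply: (g_OG G); apply: OG_proj => //; exact: T_gt0. Qed.

Lemma frame_commutes_UT y : U_T X y -> frame_commutes X y.
Proof. by case: hFrame => _ H _ _ Uy K; exact: H. Qed.

Lemma Ck_Ebar0 i j : Ck_on 2 M (fun x => Ebar X x i j).
Proof. exact: (Ck_Ebar (g_oN G) (g_ce G) (g_oM G) (g_cphi G) (g_uJ G) (g_MN G)). Qed.

Lemma Ebar_proj_T x i j : Omega_T X x -> Ebar X x i j = Ebar X (proj x) i j.
Proof.
move=> Ox; apply: (const_in_time (X := X) (h := fun x => Ebar X x i j)) => // z Oz.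
  by apply: (Ck_diff (Ck_Ebar0 i j)); apply: (g_OG G); left.
apply: (pd0_Ebar (g_oN G) (g_ce G) (g_oM G) (g_cphi G) (g_uJ G) (g_MN G) (g_dphi0 G)).
  by apply: (g_OG G); left.
by apply: frame_commutes_UT; exact: phi_UT.
Qed.

Lemma Ebar_proj x : Omega_Gamma_T X x -> Ebar X x = Ebar X (proj x).
Proof.
move=> Hx; apply/matrixP => i j; apply/eqP; rewrite -subr_eq0; apply/eqP.
have := @OG_ext _ X (fun x => Ebar X x i j - Ebar X (proj x) i j) x Hx; apply.
  apply: continuousB; first exact: Ck_cont (Ck_Ebar0 i j) _ (g_OG G Hx).
  apply: (@continuous_comp _ _ _ (@proj R) (fun x => Ebar X x i j)).
    exact: proj_continuous.
  exact: Ck_cont (Ck_Ebar0 i j) _ (OG_Mproj Hx).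
by move=> z Oz; rewrite -Ebar_proj_T // subrr.
Qed.

Lemma Ck_gamma i j : Ck_on 2 N (fun y => gamma X y i j).
Proof.
have oN := g_oN G; apply: Ck_sum => // mu; apply: Ck_sum => // nu.
apply: Ck_mul => //; last by apply: Ck_coord => //; exact: (g_ce G).
apply: Ck_mul => //; first exact: Ck_g.
by apply: Ck_coord => //; exact: (g_ce G).
Qed.

Lemma slice_gamma0 y K : closure (slice (Omega X)) y -> N y -> gamma X y ord0 (sp K) = 0.
Proof.
move=> cy Ny; apply: (closure_eq0 cy (Ck_cont (Ck_gamma ord0 (sp K)) Ny)) => z sz.
by case: hFrame => _ _ /(_ z sz) [H _] _.
Qed.

(** The Gram matrix of the frame is block diagonal on the initial slice, with determinant
    [gamma_00 F^2]. This is nonzero, and it equals [det(E)^2 det(g)]. The closure of the slice is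
    covered by continuity of both normalization conditions. *)
Lemma slice_E_unit y : closure (slice (Omega X)) y -> N y -> E X y \in unitmx.
Proof.
move=> cy Ny; have oN := g_oN G.
pose B z := \matrix_(K < 3, L < 3) gamma X z (sp K) (sp L).
have cB : Ck_on 2 N (fun z => \det (B z)).
  apply: Ck_det => // K L; apply: (Ck_extR oN) (Ck_gamma (sp K) (sp L)) => z _.
  by rewrite mxE.
have cF : Ck_on 2 N (fun z => F X (zeta X z) * F X (zeta X z)).
  have cFz := CkS (Ck_Fz hA1 oN (g_cw G) (g_w2 G) (g_NZ G) (g_Cz G)).
  exact: (Ck_mul oN cFz cFz).
have dB : \det (B y) - F X (zeta X y) * F X (zeta X y) = 0.
  apply: (closure_eq0 cy (Ck_cont (Ck_subr oN cB cF) Ny)) => z sz.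
  case: hFrame => _ _ /(_ z sz) [_ ->] _.
  by rewrite gamma00E opprK expr2 subrr.
have F0 : F X (zeta X y) != 0 by have [] := g_Hz G (g_NZ G Ny).
pose Gm := \matrix_(i, j) gamma X y i j.
have GmE : Gm = (E X y)^T *m g X y *m E X y.
  apply/matrixP => i j; rewrite mxE [RHS]mxE /gamma /gprod exchange_big /=.
  apply: eq_bigr => nu _; rewrite [in RHS]mxE mulr_suml; apply: eq_bigr => mu _.
  by rewrite !mxE; congr (_ * _); rewrite mulrC.
have dG : \det Gm = gamma X y ord0 ord0 * \det (B y).
  (* Since [gamma_0K = 0], the expansion along row 0 has a single term, whose minor is the spatial
     block. *)
  rewrite (expand_det_row Gm ord0) big_ord_recl [X in _ + X]big1 ?addr0.
    rewrite mxE /cofactor /= expr0 mul1r; congr (_ * \det _).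
    by apply/matrixP => a b; rewrite !mxE.
  by move=> K _; rewrite mxE slice_gamma0 // mul0r.
have : \det Gm != 0.
  rewrite dG mulf_neq0 //; first by rewrite gamma00E oppr_eq0 gt_eqF // (g_w2 G).
  by move/eqP: dB; rewrite subr_eq0 => /eqP ->; rewrite mulf_neq0.
by rewrite GmE det_mulmx mulf_eq0 negb_or => /andP[_]; rewrite unitmxE unitfE.
Qed.

Lemma OG_slice x : Omega_Gamma_T X x -> closure (slice (Omega X)) (proj x).
Proof.
move=> Hx; apply: (closure_map (OG_closure Hx) (@pt_continuous R 0 _)) => y Oy.
by exists y.
Qed.

(** Invertibility travels from the slice: [E(phi x) = J Ebar], and [Ebar] has at x the value it has
    at the initial point [proj x]. *)
Lemma OG_E_unit x : Omega_Gamma_T X x -> E X (phi X x) \in unitmx.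
Proof.
move=> Hx; have Mx := g_OG G Hx.
have -> : E X (phi X x) = J X x *m Ebar X x by rewrite mulmxA mulmxV ?mul1mx ?(g_uJ G).
rewrite unitmx_mul (g_uJ G) //= Ebar_proj // /Ebar unitmx_mul unitmx_inv.
have Mp := OG_Mproj Hx; rewrite (g_uJ G) //= phi_proj; last exact: OG_M0.
apply: slice_E_unit; first exact: OG_slice.
by rewrite -[proj x]phi_proj; [exact: (g_MN G)|exact: OG_M0].
Qed.
End Regular_data.

(** A second shrinking, since invertibility on the closed region was itself proved with regular
    data; only then can [det E != 0] be imposed on an open neighbourhood. *)
Lemma regular_frame_data_exists : exists NZ N M, regular_data NZ N M /\ forall y, N y -> E X y \in unitmx.
Proof.
have [NZ [N [M G]]] := regular_data_exists; have oN := g_oN G.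
pose N' := N `&` (fun y => \det (E X y)) @^-1` [set z | z != 0].
have oN' : open N'.
  apply: (open_preimage_on _ _ (@open_neq R 0)) => //.
  by apply: Ck_cont; apply: Ck_det => // i j; exact: (Ck_E oN (g_ce G)).
have N'N : N' `<=` N by move=> y [].
pose M' := M `&` phi X @^-1` N'.
have oM' : open M'.
  by apply: open_preimage_on => //; [exact: (g_oM G)|exact: Ck_cont (g_cphi G)].
have M'M : M' `<=` M by move=> y [].
exists NZ, N', M'; split; last by move=> y [_ H]; rewrite unitmxE unitfE.
split=> //.
- exact: Ck_sub N'N (g_cw G).
- by move=> y /N'N; exact: (g_w2 G).
- by move=> y /N'N; exact: (g_NZ G).
- exact: (g_Hz G).
- exact: (g_Cz G).
- by move=> i; exact: Ck_sub N'N (g_ce G i).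
- exact: Ck_sub M'M (g_cphi G).
- by move=> x /M'M; exact: (g_uJ G).
- by move=> x [].
- by move=> x /M'M; exact: (g_dphi0 G).
- by move=> x /M'M; exact: (g_M0 G).
move=> x Hx; have Mx := g_OG G Hx; split=> //; split; first exact: (g_MN G).
by have := OG_E_unit G Hx; rewrite unitmxE unitfE.
Qed.
End Domains.

(** * Identification of theta^0, the wave equation, time-independence of sigma *)

Section LiquidBody.
Set Implicit Arguments.
Unset Strict Implicit.
Variables (R : realType) (X : body R).
Notation pt4 := 'rV[R]_4.
Hypotheses (hA1 : lorentzian X) (hA2 : cylinder_domain X) (hA3 : fluid_solution X)
  (hA4 : flow_invariant X) (hFrame : adapted_frame X).
Variables (NZ : set R) (N M : set pt4).
Hypotheses (G : regular_data X NZ N M) (uE : forall y, N y -> E X y \in unitmx).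

Let oN : open N := g_oN G.
Let oM : open M := g_oM G.
Let ce := g_ce G.
Let cphi := g_cphi G.
Let uJ := g_uJ G.
Let MN := g_MN G.
Let OGM := g_OG G.
Let T0 := T_gt0 hA4.
Let oOm := open_Omega hA2.

Lemma OG_N x : Omega_Gamma_T X x -> N (phi X x).
Proof. by move=> /OGM /MN. Qed.

Lemma OG_ext_phi n (h : pt4 -> R) x : Omega_Gamma_T X x -> Ck_on n N h ->
  (forall z, Omega_T X z -> h (phi X z) = 0) -> h (phi X x) = 0.
Proof.
move=> Hx ch; apply: (OG_ext (h := fun z => h (phi X z)) Hx).
apply: (@continuous_comp _ _ _ (phi X) h).
  exact: (Ck_cont cphi (OGM Hx)).
exact: (Ck_cont ch (OG_N Hx)).
Qed.

Lemma frame_commutes_OG x : Omega_Gamma_T X x -> frame_commutes X (phi X x).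
Proof.
move=> Hx K; apply/rowP => mu; rewrite [RHS]mxE.
pose h y := \sum_c e X ord0 y ord0 c * pd c (fun z => e X (sp K) z ord0 mu) y
  - \sum_c e X (sp K) y ord0 c * pd c (fun z => e X ord0 z ord0 mu) y.
have cc i nu : Ck_on 2 N (fun z => e X i z ord0 nu) by exact: (Ck_coord ord0 nu oN (ce i)).
have cp i nu c : Ck_on 1 N (pd c (fun z => e X i z ord0 nu)) by exact: (Ck_D _ (cc i nu)).
have ch : Ck_on 1 N h.
  by apply: Ck_subr => //; apply: Ck_sum => // c; (apply: Ck_mul => //; exact: CkS (cc _ _)).
rewrite (bracketE ce); last exact: OG_N.
apply: (OG_ext_phi Hx ch) => z Oz.
rewrite /h -(bracketE ce); last by apply: OG_N; left.
by rewrite (frame_commutes_UT hFrame (phi_UT Oz)) mxE.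
Qed.

Lemma FWE_T x : Omega_T X x -> FWE_at X (phi X x).
Proof. by move=> Ox; case: hA3 => _ _ _ _ H; apply: H; exact: (UT_U hA4 (phi_UT Ox)). Qed.

Let cvt := Ck_vt hA1 oN (g_cw G) (g_w2 G).
Let dvt nu y : N y -> differentiable (vt X nu) y := Ck_diff (cvt nu) (x := y).
Let de i mu y : N y -> differentiable (fun z => e X i z ord0 mu) y :=
  Ck_diff (Ck_coord ord0 mu oN (ce i)) (x := y).
Let w2n0 y : N y -> w2 X y != 0.
Proof. by move=> Ny; rewrite gt_eqF // (g_w2 G). Qed.

Lemma vt_w y : N y -> \sum_mu vt X mu y * e X ord0 y ord0 mu = 1.
Proof.
move=> Ny; rewrite e0E /vt.
transitivity (- (\sum_mu w_low X y mu * w X y ord0 mu) / w2 X y).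
  by rewrite -sumrN mulr_suml; apply: eq_bigr => mu _; rewrite !mulNr mulrAC.
by rewrite -w2E mulfV // w2n0.
Qed.

Lemma pd0_comp (h : pt4 -> R) x : M x -> differentiable h (phi X x) ->
  pd ord0 (fun z => h (phi X z)) x = \sum_c w X (phi X x) ord0 c * pd c h (phi X x).
Proof.
move=> Mx dh; rewrite (chain_phi cphi ord0 Mx dh); apply: eq_bigr => c _.
by rewrite JE (pd0_phi cphi (g_dphi0 G)).
Qed.

(** Both the covector [vt] and the field [e_K] are Lie-transported by w, so their pairing is
    constant along the flow; on the initial slice it is a multiple of [gamma_0K = 0]. *)
Lemma vt_eK x K : Omega_T X x ->
  \sum_mu vt X mu (phi X x) * e X (sp K) (phi X x) ord0 mu = 0.
Proof.
move=> Ox; pose hE y := \sum_mu vt X mu y * e X (sp K) y ord0 mu.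
have dh y : N y -> differentiable hE y.
  by move=> Ny; apply: diffble_sum => mu; apply: diffble_mul; [exact: dvt|exact: de].
have OGT z : Omega_T X z -> Omega_Gamma_T X z by left.
have -> : \sum_mu vt X mu (phi X x) * e X (sp K) (phi X x) ord0 mu = hE (phi X (proj x)).
  apply: (const_in_time (X := X) (h := fun z => hE (phi X z))) => // z Oz.
    apply: diffble_comp; first exact: (Ck_diff cphi (OGM (OGT z Oz))).
    by apply: dh; apply: OG_N; exact: OGT.
  have Nz := OG_N (OGT z Oz).
  rewrite pd0_comp; [|exact: (OGM (OGT z Oz))|exact: dh].
  have := frame_commutes_OG (OGT z Oz); move: (phi X z) Nz (FWE_T Oz) => y Ny FW fc.
  have pE c : pd c hE y = \sum_mu (pd c (vt X mu) y * e X (sp K) y ord0 mu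
      + vt X mu y * pd c (fun z => e X (sp K) z ord0 mu) y).
    rewrite /pd dsum => [|mu]; last by apply: diffble_mul; [exact: dvt|exact: de].
    by apply: eq_bigr => mu _; rewrite dmul //; [exact: dvt|exact: de].
  under eq_bigr do rewrite pE mulr_sumr.
  rewrite exchange_big /=.
  under eq_bigr do under eq_bigr do rewrite mulrDr.
  under eq_bigr do rewrite big_split /=.
  rewrite big_split /=.
  have -> : \sum_mu \sum_c w X y ord0 c * (pd c (vt X mu) y * e X (sp K) y ord0 mu) =
     - \sum_mu \sum_c vt X c y * pd mu (fun z => w X z ord0 c) y * e X (sp K) y ord0 mu.
    rewrite -sumrN; apply: eq_bigr => mu _; rewrite -mulr_suml -mulNr.
    have := lie_vt hA1 oN (g_cw G) (g_w2 G) mu Ny FW => /eqP; rewrite addr_eq0 => /eqP <-.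
    by rewrite mulr_suml; apply: eq_bigr => c _; rewrite mulrA.
  have br mu : \sum_c w X y ord0 c * pd c (fun z => e X (sp K) z ord0 mu) y =
     \sum_c e X (sp K) y ord0 c * pd c (fun z => w X z ord0 mu) y.
    have := bracketE ce ord0 (sp K) mu Ny; rewrite fc mxE !e0E => /esym/eqP.
    by rewrite subr_eq0 => /eqP.
  have -> : \sum_mu \sum_c w X y ord0 c * (vt X mu y * pd c (fun z => e X (sp K) z ord0 mu) y) =
    \sum_mu vt X mu y * \sum_c e X (sp K) y ord0 c * pd c (fun z => w X z ord0 mu) y.
    by apply: eq_bigr => mu _; rewrite -br mulr_sumr; apply: eq_bigr => c _; rewrite mulrCA.
  rewrite exchange_big /= addrC; apply/eqP; rewrite subr_eq0; apply/eqP.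
  apply: eq_bigr => mu _; rewrite mulr_sumr; apply: eq_bigr => c _.
  by rewrite -[RHS]mulrA; congr (_ * _); exact: mulrC.
have Hx := OGT x Ox; have Mp := OG_Mproj hA4 G Hx.
rewrite (phi_proj hA4); last exact: (g_M0 G (OGM Hx)).
have Np : N (proj x) by rewrite -(phi_proj hA4 (g_M0 G (OGM Hx))); exact: MN.
have := slice_gamma0 hA1 hFrame G K (OG_slice Hx) Np.
rewrite /gamma e0E (gprodC hA1) gprod_wlow => H.
transitivity (- (\sum_mu w_low X (proj x) mu * e X (sp K) (proj x) ord0 mu) / w2 X (proj x)).
  by rewrite /hE /vt -sumrN mulr_suml; apply: eq_bigr => mu _; rewrite !mulNr mulrAC.
by rewrite H oppr0 mul0r.
Qed.

Let cth l nu : Ck_on 2 N (fun y => theta X y l nu) := Ck_theta oN ce uE l nu.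

(** The two covectors take the same values on the frame, inside by [vt_w] and [vt_eK] and then on
    the lateral boundary by continuity. *)
Lemma theta0_vt x nu : Omega_Gamma_T X x -> theta X (phi X x) ord0 nu = vt X nu (phi X x).
Proof.
move=> Hx; apply/eqP; rewrite -subr_eq0; apply/eqP.
have ch : Ck_on 2 N (fun y => theta X y ord0 nu - vt X nu y).
  by apply: Ck_subr; [exact: oN|exact: cth|apply: CkS; exact: cvt].
apply: (OG_ext_phi Hx ch) => z Oz; have Hz : Omega_Gamma_T X z by left.
have Nz := OG_N Hz.
suff -> : vt X nu (phi X z) = theta X (phi X z) ord0 nu by rewrite subrr.
have H j : \sum_mu vt X mu (phi X z) * e X j (phi X z) ord0 mu = (j == ord0)%:R.
  case: (unliftP ord0 j) => [K ->|->]; last by rewrite vt_w // eqxx.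
  by rewrite lift0_eqF; exact: vt_eK.
transitivity (\sum_j (\sum_mu vt X mu (phi X z) * e X j (phi X z) ord0 mu) * theta X (phi X z) j nu).
  under eq_bigr do rewrite mulr_suml.
  rewrite exchange_big /=.
  transitivity (\sum_mu vt X mu (phi X z) * (mu == nu)%:R).
    rewrite (bigD1 nu) // eqxx mulr1 big1; first exact: (esym (addr0 _)).
    by move=> i /andP[_ /negbTE ->]; rewrite mulr0.
  apply: eq_bigr => mu _; rewrite -(e_theta uE mu nu Nz) mulr_sumr.
  by apply: eq_bigr => j _; rewrite mulrA.
under eq_bigr do rewrite H.
rewrite (bigD1 ord0) // eqxx mul1r big1; first exact: addr0.
by move=> i /andP[_ /negbTE ->]; rewrite mul0r.
Qed.

(** Only the values of h along phi on the cylinder are known. They annihilate all Lagrangian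
    derivatives of the composite, and inverting the transposed Jacobian gives the spacetime
    derivatives. *)
Lemma euler_vanish_pd (h : pt4 -> R) x om : Omega_T X x -> differentiable h (phi X x) ->
  (forall z, Omega_T X z -> h (phi X z) = 0) -> pd om h (phi X x) = 0.
Proof.
move=> Ox dh h0; have Mx : M x by apply: OGM; left.
apply: (JT_inj uJ (v := fun om => pd om h (phi X x)) Mx) => b.
rewrite -(chain_phi cphi b Mx dh); apply: (vanish_pd T0 oOm (h := fun z => h (phi X z))) => //.
by apply: diffble_comp => //; exact: (Ck_diff cphi Mx).
Qed.

(** The two covectors are only known to agree on the closed fluid region, which is not a
    neighbourhood of its boundary points. Inside, [euler_vanish_pd] compares their derivatives; at
    the lateral boundary continuity of the derivatives does. *)
Lemma pd_theta0_vt x om nu : Omega_Gamma_T X x ->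
  pd om (fun y => theta X y ord0 nu) (phi X x) = pd om (vt X nu) (phi X x).
Proof.
move=> Hx; pose d y := theta X y ord0 nu - vt X nu y.
have cd : Ck_on 2 N d by apply: Ck_subr; [exact: oN|exact: cth|apply: CkS; exact: cvt].
have dE y : N y -> pd om d y = pd om (fun y => theta X y ord0 nu) y - pd om (vt X nu) y.
  by move=> Ny; rewrite /pd dsub //; [exact: (Ck_diff (cth _ _) Ny)|exact: dvt].
apply/eqP; rewrite -subr_eq0 -dE; last exact: OG_N.
apply/eqP; apply: (OG_ext_phi Hx (Ck_D (delta_mx ord0 om) cd)) => z Oz.
have Hz : Omega_Gamma_T X z by left.
apply: euler_vanish_pd => //; first exact: (Ck_diff cd (OG_N Hz)).
by move=> z' Oz'; rewrite /d theta0_vt; [exact: subrr|left].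
Qed.

(* Bc and Yc are the bracket in, and the whole of, Y_t as fields on spacetime. *)
Definition Bc (be nu : 'I_4) (y : pt4) : R :=
  pd be (fun z => theta X z ord0 nu) y - \sum_c Gam X c be nu y * theta X y ord0 c
  + \sum_(M < 3) \sum_(L < 3) sigma X (sp M) ord0 (sp L) y
      * theta X y (sp M) be * theta X y (sp L) nu.

Definition Yc (al nu : 'I_4) (y : pt4) : R :=
  (fz X y)^-1 * \sum_be ac X al be y * Bc be nu y.

Lemma Bc_nabla x be nu : Omega_Gamma_T X x -> Bc be nu (phi X x) =
  pd nu (vt X be) (phi X x) - \sum_c Gam X c nu be (phi X x) * vt X c (phi X x).
Proof.
move=> Hx; have Ny := OG_N Hx.
have := dtheta_sp oN ce uE ord0 be nu Ny (frame_commutes_OG Hx) => /eqP.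
rewrite subr_eq addrC => /eqP H; rewrite /Bc H -pd_theta0_vt // addrAC; congr (_ - _).
  by rewrite subrK.
by apply: eq_bigr => c _; rewrite (Gam_sym hA1) theta0_vt.
Qed.

Let clam := Ck_lam hA1 oN (g_cw G) (g_w2 G) (g_NZ G) (g_Hz G) (g_Cz G).

Lemma Yc_nabla x al nu : Omega_Gamma_T X x -> Yc al nu (phi X x) = nabla_up X (lam X) nu al (phi X x).
Proof.
move=> Hx; rewrite -(ac_nabla_vt hA1 oN (g_cw G) (g_w2 G) (g_NZ G) (g_Hz G) (g_Cz G)); last exact: OG_N.
by congr (_ * _); apply: eq_bigr => be _; rewrite Bc_nabla.
Qed.

Lemma Ck_sigma i l j : Ck_on 1 N (sigma X i l j).
Proof.
apply: Ck_sum => // mu; apply: Ck_mul => //; first exact: CkS (cth _ _).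
have cc a nu : Ck_on 2 N (fun z => e X a z ord0 nu) by exact: (Ck_coord ord0 nu oN (ce a)).
have cp a nu c : Ck_on 1 N (pd c (fun z => e X a z ord0 nu)) by exact: (Ck_D _ (cc a nu)).
apply: (Ck_extR oN) => [y Ny|]; first by symmetry; exact: (bracketE ce i j mu Ny).
by apply: Ck_subr => //; apply: Ck_sum => // c; (apply: Ck_mul => //; exact: CkS (cc _ _)).
Qed.

Lemma Ck_Yc al nu : Ck_on 1 N (Yc al nu).
Proof.
have c1 := Ck_le (isT : (1 <= 3)%N) (Ck_rs hA1 oN (g_cw G) (g_w2 G) (g_NZ G) (g_Cz G)).
have c2 := Ck_le (isT : (1 <= 3)%N) (Ck_fz hA1 oN (g_cw G) (g_w2 G) (g_NZ G) (g_Cz G)).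
have c3 := Ck_le (isT : (1 <= 3)%N) (Ck_w2 hA1 oN (g_cw G)).
have c4 mu := Ck_le (isT : (1 <= 3)%N) (Ck_w oN (g_cw G) mu).
have c5 l mu := CkS (cth l mu).
have c6 be : Ck_on 1 N (fun y => ac X al be y).
  apply: (Ck_add oN); first exact: Ck_ginv.
  apply: (Ck_mul oN); last exact: c4.
  apply: (Ck_mul oN); last exact: c4.
  apply: (Ck_mul oN); first exact: (Ck_inv oN w2n0 c3).
  by apply: (Ck_subr oN) c1; exact: Ck_cst.
have c7 be : Ck_on 1 N (Bc be nu).
  apply: (Ck_add oN).
    apply: (Ck_subr oN); first exact: (Ck_D _ (cth ord0 nu)).
    apply: (Ck_sum _ oN) => c; apply: (Ck_mul oN); [exact: Ck_Gam|exact: c5].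
  apply: (Ck_sum _ oN) => K; apply: (Ck_sum _ oN) => L.
  apply: (Ck_mul oN); last exact: c5.
  by apply: (Ck_mul oN); [exact: Ck_sigma|exact: c5].
apply: (Ck_mul oN).
  by apply: (Ck_inv oN) c2 => y Ny; exact: (fz_neq0 (g_NZ G) (g_Hz G) Ny).
by apply: (Ck_sum _ oN) => be; exact: (Ck_mul oN (c6 be) (c7 be)).
Qed.

(** The Ricci identity wants a field defined on an open set, so [Yc] is first replaced, together
    with its derivatives, by the covariant derivative of [lam], which is regular on all of N. *)
Lemma Yc_div x nu : Omega_T X x ->
  \sum_a pd a (Yc a nu) (phi X x) =
  - \sum_a \sum_c Gam X a a c (phi X x) * Yc c nu (phi X x)
  + \sum_a \sum_c Gam X c a nu (phi X x) * Yc a c (phi X x)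
  + \sum_c Ric X nu c (phi X x) * lam X c (phi X x).
Proof.
move=> Ox; have Hx : Omega_Gamma_T X x by left. have Ny := OG_N Hx.
have cn a : Ck_on 2 N (nabla_up X (lam X) nu a).
  apply: Ck_add => //; first exact: (Ck_D _ (clam a)).
  by apply: Ck_sum => // s; apply: Ck_mul => //; [exact: Ck_Gam|exact: CkS (clam s)].
have pE a : pd a (Yc a nu) (phi X x) = pd a (nabla_up X (lam X) nu a) (phi X x).
  have d1 := Ck_diff (Ck_Yc a nu) Ny; have d2 := Ck_diff (cn a) Ny.
  apply/eqP; rewrite -subr_eq0 /pd -dsub //; apply/eqP.
  apply: (euler_vanish_pd a Ox (h := fun y => Yc a nu y - nabla_up X (lam X) nu a y)).
    by apply: diffble_add => //; exact: diffble_opp.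
  by move=> z Oz; rewrite Yc_nabla; [exact: subrr|left].
under eq_bigr do rewrite pE.
have -> : \sum_a \sum_c Gam X a a c (phi X x) * Yc c nu (phi X x) =
    \sum_a \sum_c Gam X a a c (phi X x) * nabla_up X (lam X) nu c (phi X x).
  by apply: eq_bigr => a _; apply: eq_bigr => c _; rewrite Yc_nabla.
have -> : \sum_a \sum_c Gam X c a nu (phi X x) * Yc a c (phi X x) =
    \sum_a \sum_c Gam X c a nu (phi X x) * nabla_up X (lam X) c a (phi X x).
  by apply: eq_bigr => a _; apply: eq_bigr => c _; rewrite Yc_nabla.
rewrite -(ricci_identity hA1 oN nu (fun a => CkS (clam a)) Ny).
(* The Euler equations hold on the open set U around [phi x], so div [lam] vanishes in a full
   neighbourhood and may be differentiated. *)
have -> : pd nu (fun z => \sum_a nabla_up X (lam X) a a z) (phi X x) = 0.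
  have oU : open (U X) by case: hA2 => _ [].
  rewrite /pd (@near_eq_derive _ _ _ _ (fun _ : pt4 => 0 : R)) ?dcst //.
  have Uy := UT_U hA4 (phi_UT Ox).
  apply: filterS (open_nbhs_nbhs (conj (openI oN oU) (conj Ny Uy))) => z [Nz Uz].
  apply: (div_lam hA1 oN (g_cw G) (g_w2 G) (g_NZ G) (g_Hz G) (g_Cz G) Nz).
  by case: hA3 => _ _ _ _; apply.
set a := \sum_a _; set b := \sum_a _; set c := \sum_a _.
by rewrite subr0 addrC; ring.
Qed.

Lemma a_tE al be x : a_t X al be x = ac X al be (phi X x).
Proof.
rewrite /a_t /ac /s2_t /gamma_t /ginv_t /e0_t gamma00E (opprK (w2 X _)) -/(zeta X _) s2V e0E invrN.
by rewrite !mulNr; congr (_ + _); exact: opprK.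
Qed.

Lemma f_tE x : f_t X x = fz X (phi X x).
Proof. by rewrite /f_t /gamma_t gamma00E (opprK (w2 X _)). Qed.

Lemma dtheta_t l nu x : M x -> differentiable (theta_t X l nu) x.
Proof.
move=> Mx; apply: (diffble_comp (u := phi X) (f := fun y => theta X y l nu)).
  exact: (Ck_diff cphi Mx).
exact: (Ck_diff (cth l nu) (MN Mx)).
Qed.

Lemma pd_theta_t l nu b x : M x -> pd b (theta_t X l nu) x =
  \sum_om J X x om b * pd om (fun y => theta X y l nu) (phi X x).
Proof.
move=> Mx; apply: (chain_phi cphi b Mx (h := fun y => theta X y l nu)).
exact: (Ck_diff (cth l nu) (MN Mx)).
Qed.

Let delta_sum (a : 'I_4) (h : 'I_4 -> R) : \sum_b (a == b)%:R * h b = h a.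
Proof.
rewrite (bigD1 a) // eqxx mul1r big1; first exact: addr0.
by move=> i /andP[_]; rewrite eq_sym => /negbTE ->; rewrite mul0r.
Qed.

Let delta_sumr (a : 'I_4) (h : 'I_4 -> R) : \sum_b (b == a)%:R * h b = h a.
Proof. by under eq_bigr do rewrite eq_sym; exact: delta_sum. Qed.

Lemma Y_tE al nu x : M x -> Y_t X al nu x = Yc al nu (phi X x).
Proof.
move=> Mx; rewrite /Y_t /Yc f_tE; congr (_ * _); apply: eq_bigr => be _.
rewrite a_tE; congr (_ * (_ - _ + _)).
rewrite -[RHS](delta_sum be (fun b => pd b (fun z => theta X z ord0 nu) (phi X x))).
under [RHS]eq_bigr do rewrite eq_sym -(J_Jinv uJ _ _ Mx) mulr_suml.
rewrite [RHS]exchange_big /=; apply: eq_bigr => c _; rewrite pd_theta_t // mulr_sumr.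
by apply: eq_bigr => om _; rewrite mulrCA mulrA.
Qed.

Definition flux al nu x : R := \sum_be A_t X al be x * pd be (theta_t X ord0 nu) x + L_t X al nu x.

(** The bracket contracted with [a_bar] is the pull-back of the covector [Bc] by J. Its J cancels
    one inverse Jacobian of [a_bar]; the other stays, and the flux is minus the Piola transform of
    [Yc]. *)
Lemma fluxE al nu x : M x -> flux al nu x =
  - (\det (J X x) * \sum_mu Jinv X x al mu * Yc mu nu (phi X x)).
Proof.
move=> Mx; have uEx := uE (MN Mx).
have H be : pd be (theta_t X ord0 nu) x
   + (- (\sum_om \sum_c J X x om be * Gam_t X c om nu x * theta_t X ord0 c x)
     + \sum_(M < 3) \sum_(L < 3)
         sigma_t X (sp M) ord0 (sp L) x * theta_bar X x (sp M) be
           * theta_t X (sp L) nu x) = \sum_om J X x om be * Bc om nu (phi X x).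
  rewrite pd_theta_t // /Bc; under [RHS]eq_bigr do rewrite mulrDr mulrBr.
  rewrite big_split sumrB /= -addrA; congr (_ + (- _ + _)).
    by apply: eq_bigr => om _; rewrite [RHS]mulr_sumr; apply: eq_bigr => c _; exact: (esym (mulrA _ _ _)).
  under [RHS]eq_bigr do rewrite mulr_sumr; rewrite [RHS]exchange_big /=; apply: eq_bigr => K _.
  under [RHS]eq_bigr do rewrite mulr_sumr; rewrite [RHS]exchange_big /=; apply: eq_bigr => L _.
  rewrite (theta_barE uJ _ _ Mx uEx) mulr_sumr mulr_suml; apply: eq_bigr => om _.
  rewrite /sigma_t /theta_t; ring.
rewrite /flux /L_t mulr_sumr -big_split /=.
transitivity (\sum_be (- (\det (J X x) / f_t X x)) * (a_bar X al be x * \sum_om J X x om be * Bc om nu (phi X x))).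
  by apply: eq_bigr => be _; rewrite -H [in RHS]mulrDr [in RHS]mulrDr; congr (_ + _); exact: (esym (mulrA _ _ _)).
rewrite -mulr_sumr mulNr -mulrA f_tE; congr (- (_ * _)).
transitivity ((fz X (phi X x))^-1 * \sum_mu \sum_nu0 Jinv X x al mu * ac X mu nu0 (phi X x) * Bc nu0 nu (phi X x)).
  congr (_ * _).
  transitivity (\sum_mu \sum_nu0 \sum_om (Jinv X x al mu * ac X mu nu0 (phi X x) * Bc om nu (phi X x)) * \sum_be J X x om be * Jinv X x be nu0).
    under eq_bigr do rewrite /a_bar mulr_suml.
    rewrite exchange_big /=; apply: eq_bigr => mu _.
    under eq_bigr do rewrite mulr_suml.
    rewrite exchange_big /=; apply: eq_bigr => nu0 _.
    under eq_bigr do rewrite mulr_sumr.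
    rewrite exchange_big /=; apply: eq_bigr => om _; rewrite mulr_sumr; apply: eq_bigr => be _.
    rewrite a_tE; ring.
  apply: eq_bigr => mu _; apply: eq_bigr => nu0 _.
  under eq_bigr do rewrite (J_Jinv uJ _ _ Mx) mulrC.
  by rewrite (delta_sumr nu0 (fun om => Jinv X x al mu * ac X mu nu0 (phi X x) * Bc om nu (phi X x))).
rewrite mulr_sumr; apply: eq_bigr => mu _; rewrite /Yc [RHS]mulrCA; congr (_ * _).
by rewrite [RHS]mulr_sumr; apply: eq_bigr => nu0 _; exact: (esym (mulrA _ _ _)).
Qed.

Lemma diffble_flux al nu x : M x -> differentiable (flux al nu) x.
Proof.
move=> Mx; have dp : differentiable (phi X) x by exact: (Ck_diff cphi Mx).
apply: (near_eq_differentiable (f := fun x => - (\det (J X x) * \sum_mu Jinv X x al mu * Yc mu nu (phi X x)))).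
  by apply: filterS (open_nbhs_nbhs (conj oM Mx)) => z Mz; rewrite fluxE.
apply: diffble_opp; apply: diffble_mul; first exact: (Ck_diff (Ck_detJ oM cphi) Mx).
apply: diffble_sum => mu; apply: diffble_mul; first exact: (Ck_diff (Ck_Jinv oM cphi uJ al mu) Mx).
by apply: diffble_comp => //; exact: (Ck_diff (Ck_Yc mu nu) (MN Mx)).
Qed.

Lemma ginv_vt y mu : \sum_nu ginv X y mu nu * vt X nu y = - (w X y ord0 mu / w2 X y).
Proof.
transitivity (- ((\sum_nu ginv X y mu nu * w_low X y nu) / w2 X y)).
  by rewrite mulr_suml -sumrN; apply: eq_bigr => nu _; rewrite /vt mulrN mulrA.
congr (- (_ / _)); rewrite /w_low; under eq_bigr do rewrite mulr_sumr.
rewrite exchange_big /=.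
under eq_bigr do (under eq_bigr do rewrite mulrA; rewrite -mulr_suml (ginv_gE hA1)).
exact: delta_sum.
Qed.

Lemma wave_equation x nu : Omega_T X x -> \sum_al pd al (flux al nu) x = F_t X nu x.
Proof.
move=> Ox; have Hx : Omega_Gamma_T X x by left. have Mx := OGM Hx.
have Ny := MN Mx.
have -> : \sum_al pd al (flux al nu) x =
  - \sum_al pd al (fun z => \det (J X z) * \sum_mu Jinv X z al mu * Yc mu nu (phi X z)) x.
  rewrite -sumrN; apply: eq_bigr => al _; rewrite /pd -dopp.
    apply: near_eq_derive; apply: filterS (open_nbhs_nbhs (conj oM Mx)) => z Mz.
    exact: fluxE.
  apply: (near_eq_differentiable (f := fun x => - flux al nu x)).
    by apply: filterS (open_nbhs_nbhs (conj oM Mx)) => z Mz; rewrite fluxE // opprK.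
  by apply: diffble_opp; exact: diffble_flux.
rewrite (piola_div oM cphi uJ Mx (V := fun mu => Yc mu nu)); last first.
  by move=> mu; exact: (Ck_diff (Ck_Yc mu nu) Ny).
rewrite Yc_div // /F_t mulNr; congr (- (_ * (_ + _ + _))).
- by congr (- _); apply: eq_bigr => a _; apply: eq_bigr => c _; rewrite Y_tE.
- by apply: eq_bigr => a _; apply: eq_bigr => c _; rewrite Y_tE.
rewrite f_tE /Ric_t /Ric_mixed.
have f0 := fz_neq0 (g_NZ G) (g_Hz G) Ny; have w0 := w2n0 Ny.
transitivity ((fz X (phi X x))^-1 * \sum_c Ric X nu c (phi X x) * \sum_la ginv X (phi X x) c la * vt X la (phi X x)).
  rewrite mulr_sumr; apply: eq_bigr => c _; rewrite ginv_vt /lam invfM.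
  move: (Ric _ _ _ _) (w _ _ _ _) (_^-1) (_^-1) => a1 a2 a3 a4; ring.
congr (_ * _); under eq_bigr do rewrite mulr_sumr.
rewrite exchange_big /=; apply: eq_bigr => la _; rewrite mulr_suml; apply: eq_bigr => c _.
by rewrite /theta_t theta0_vt // mulrA.
Qed.

Lemma flow_equation x mu : Omega_T X x -> pd ord0 (fun z => phi X z ord0 mu) x
  = gamma_t X ord0 ord0 x * \sum_nu ginv_t X mu nu x * theta_t X ord0 nu x.
Proof.
move=> Ox; have Hx : Omega_Gamma_T X x by left. have Mx := OGM Hx.
rewrite (pd0_phi cphi (g_dphi0 G)) // /gamma_t gamma00E /theta_t.
under eq_bigr do rewrite theta0_vt //.
by rewrite ginv_vt mulrNN mulrC divfK //; apply: w2n0; exact: MN.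
Qed.

(** Naturality of the bracket: the structure coefficients can be computed from the pulled-back
    frame, where their dependence on time is visible. *)
Lemma sigma_tE i l j x : M x -> sigma X i l j (phi X x) =
  \sum_nu theta_bar X x l nu * bar_bracket X i j nu x.
Proof.
move=> Mx; rewrite /sigma.
under eq_bigr do rewrite (bracket_push oN ce oM cphi uJ MN i j _ Mx) mulr_sumr.
rewrite exchange_big /=; apply: eq_bigr => nu _.
rewrite (theta_barE uJ _ _ Mx (uE (MN Mx))) mulr_suml; apply: eq_bigr => mu _.
by rewrite mulrA.
Qed.

Lemma pd_Ebar_proj b nu j x : Omega_T X x ->
  pd b (fun z => Ebar X z nu j) x = pd b (fun z => Ebar X z nu j) (proj x).
Proof.
move=> Ox; have Hx : Omega_Gamma_T X x by left. have Mx := OGM Hx; have Mp := OG_Mproj hA4 G Hx.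
have Hp : Omega_Gamma_T X (proj x) by exact: OG_proj.
have dE z : M z -> differentiable (fun z => Ebar X z nu j) z.
  by move=> Mz; exact: (Ck_diff (Ck_Ebar0 G nu j) Mz).
case: (unliftP ord0 b) => [K ->|->]; last first.
  by rewrite !(pd0_Ebar oN ce oM cphi uJ MN (g_dphi0 G)) //; exact: frame_commutes_OG.
have [dP PE] := derive_linear x (delta_mx ord0 (sp K)) (@proj_linear R) (@proj_continuous R).
have dEp : differentiable (fun z => Ebar X (proj z) nu j) x.
  by apply: (diffble_comp (u := @proj R) (f := fun z => Ebar X z nu j)) => //; exact: dE.
have := vanish_pd T0 oOm (h := fun z => Ebar X z nu j - Ebar X (proj z) nu j) (lift ord0 K) _ Ox.
rewrite /pd dsub //; last exact: dE.
rewrite (dcomp (u := @proj R) (f := fun z => Ebar X z nu j)) //; last exact: dE.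
rewrite -/(sp K) PE proj_eS => H; apply/eqP; rewrite -subr_eq0; apply/eqP; apply: H.
  by move=> z Oz; rewrite -(Ebar_proj_T hFrame G) // subrr.
by apply: diffble_add => //; [exact: dE|exact: diffble_opp].
Qed.

(** The coefficients involve only [Ebar] and its first derivatives, none of which depends on time
    over [Omega_T]; the lateral boundary follows by continuity. *)
Lemma sigma_const x i l j : Omega_Gamma_T X x -> sigma_t X i l j x = sigma X i l j (proj x).
Proof.
move=> Hx; apply/eqP; rewrite -subr_eq0; apply/eqP.
have Mp := OG_Mproj hA4 G Hx.
have pp z : Omega_Gamma_T X z -> phi X (proj z) = proj z by move=> Hz; exact: (phi_proj hA4 (g_M0 G (OGM Hz))).
apply: (OG_ext (h := fun x => sigma X i l j (phi X x) - sigma X i l j (proj x)) Hx).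
  apply: continuousB.
    apply: (@continuous_comp _ _ _ (phi X) (sigma X i l j)); first exact: (Ck_cont cphi (OGM Hx)).
    exact: (Ck_cont (Ck_sigma i l j) (OG_N Hx)).
  apply: (@continuous_comp _ _ _ (@proj R) (sigma X i l j)); first exact: proj_continuous.
  by apply: (Ck_cont (Ck_sigma i l j)); rewrite -pp //; exact: MN.
move=> z Oz; have Hz : Omega_Gamma_T X z by left.
have Mz := OGM Hz; have Mpz := OG_Mproj hA4 G Hz.
rewrite -(pp z Hz) !sigma_tE //; apply/eqP; rewrite subr_eq0; apply/eqP.
have EE : Ebar X z = Ebar X (proj z) by exact: (Ebar_proj hA4 hFrame G).
apply: eq_bigr => nu _; rewrite /theta_bar EE; congr (_ * _); rewrite /bar_bracket EE.
by congr (_ - _); apply: eq_bigr => b _; rewrite pd_Ebar_proj.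
Qed.
End LiquidBody.

(** * Tangential derivatives at a smooth boundary *)

Section Tangency.
Set Implicit Arguments.
Unset Strict Implicit.
Variable R : realType.

Lemma ge0_add_eps (a b : R) : (forall e, 0 < e -> 0 <= a + e * b) -> 0 <= a.
Proof.
move=> H; apply/ler_addgt0Pl => e e0.
have b0 : 0 < `|b| + 1 by rewrite ltr_wpDl.
have := H (e / (`|b| + 1)) (divr_gt0 e0 b0) => H1.
apply: (le_trans H1); rewrite addrC lerD2r.
rewrite mulrAC ler_pdivrMr // ler_pM2l //.
by apply: (le_trans (ler_norm b)); rewrite lerDl.
Qed.

(* A non-negative function on Om vanishing at a boundary point has vanishing
   tangential derivatives there: tilting a tangent vector slightly inwards keeps
   it inside Om, so no parametrization of the boundary is needed. *)
Lemma tangent_derive_eq0 (Om : set 'rV[R]_3) (f : 'rV[R]_3 -> R) y u :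
  open Om -> smooth_boundary Om -> bd Om y -> differentiable f y -> f y = 0 ->
  (forall z, Om z -> 0 <= f z) -> tangent_bd Om y u -> 'D_u f y = 0.
Proof.
move=> oOm sOm by_ df fy f0 tu.
have [h bh] := sOm y by_; have [[n0 hn0] [N [oN Ny sh hN]]] := bh.
have dh : differentiable h y by exact: (Ck_diff (sh 1%N) Ny).
have [n hn] : exists n, 'D_n h y < 0.
  move: hn0; rewrite neq_lt => /orP[hn|hn]; first by exists n0.
  by exists (- n0); rewrite dlinN // oppr_lt0.
(* A boundary point is a limit of points of the domain, where [h < 0]. Hence a direction that
   strictly decreases h leads immediately into the domain. *)
have hy : h y <= 0.
  rewrite leNgt; apply/negP => hy.
  have ch : {for y, continuous h} by exact: differentiable_continuous.
  have nb : nbhs y (N `&` [set z | 0 < h z]).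
    apply: filterI; first exact: open_nbhs_nbhs.
    exact: (ch _ (open_nbhs_nbhs (conj (@open_gt R 0) hy))).
  have [cy _] := by_; have [z [Oz [Nz /= hz]]] := cy _ nb.
  by have := (hN z Nz).1 Oz; rewrite ltNge (ltW hz).
have inw v : 'D_v h y < 0 -> 0 <= 'D_v f y.
  move=> hv; apply: onesided_ge0 => //.
  have dl : is_derive (0 : R) 1 (fun s => - h (y + s *: v)) (- 'D_v h y).
    have y0 : y + 0 *: v = y by rewrite scale0r addr0.
    have dl : is_derive (0 : R) 1 (fun s : R => h (y + s *: v)) ('D_v h (y + 0 *: v)).
      by apply: is_derive_line; rewrite y0.
    by rewrite y0 in dl; exact: is_deriveN.
  have hv' : 0 < - 'D_v h y by rewrite oppr_gt0.
  have H1 := derive_gt0_right dl hv'.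
  have [d d0 Hd] := nbhs_norm (open_nbhs_nbhs (conj oN Ny)).
  have v0 : 0 < `|v| + 1 by rewrite ltr_wpDl.
  near=> s.
  have s0 : 0 < s by near: s; exact: nbhs_right_gt.
  have sd : s < d / (`|v| + 1) by near: s; apply: nbhs_right_lt; rewrite divr_gt0.
  have Hs : - h (y + 0 *: v) < - h (y + (0 + s) *: v) by near: s.
  rewrite add0r scale0r addr0 ltrN2 in Hs.
  apply/f0/hN; last exact: lt_le_trans Hs hy.
  apply: Hd; rewrite addrC addKr normrZ gtr0_norm //.
  rewrite ltr_pdivlMr // in sd; apply: le_lt_trans sd.
  by rewrite ler_pM2l // lerDl.
have half v : 'D_v h y = 0 -> 0 <= 'D_v f y.
  move=> hv; apply: (@ge0_add_eps _ ('D_n f y)) => e e0.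
  rewrite addrC -[e * _]/(e *: 'D_n f y) -dlin //; apply: inw.
  by rewrite dlin // hv addr0 pmulr_rlt0.
have t0 := tu h bh.
apply/eqP; rewrite eq_le half // andbT -oppr_ge0 -dlinN //; apply: half.
by rewrite dlinN // t0 oppr0.
Unshelve. all: by end_near. Qed.
End Tangency.

(** * The pressure gradient on the free boundary and its relation to psi *)

Section FreeBoundary.
Set Implicit Arguments.
Unset Strict Implicit.
Variables (R : realType) (X : body R) (c_p : R).
Notation pt4 := 'rV[R]_4.
Hypotheses (hEos : equation_of_state X) (hp : pressure_function X)
  (hA1 : lorentzian X) (hA2 : cylinder_domain X) (hA3 : fluid_solution X)
  (hA4 : flow_invariant X) (hA7 : taylor_sign X c_p) (hFrame : adapted_frame X).
Variables (NZ : set R) (N M : set pt4).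
Hypotheses (G : regular_data X NZ N M) (uE : forall y, N y -> E X y \in unitmx).

Let oN : open N := g_oN G.
Let ce := g_ce G.
Let cphi := g_cphi G.
Let uJ := g_uJ G.
Let MN := g_MN G.
Let OGM := g_OG G.
Let T0 := T_gt0 hA4.
Let oOm := open_Omega hA2.
Let cq := Ck_pz hA1 oN (g_cw G) (g_w2 G) (g_NZ G) (g_Cz G).
Let cth l nu : Ck_on 2 N (fun y => theta X y l nu) := Ck_theta oN ce uE l nu.

Let sum_only (a : 'I_4) (h : 'I_4 -> R) : (forall i, i != a -> h i = 0) -> \sum_b h b = h a.
Proof.
by move=> H; rewrite (bigD1 a) // big1; [exact: addr0|move=> i /andP[_]; exact: H].
Qed.

Let sum_deltar (a : 'I_4) (h : 'I_4 -> R) : \sum_b h b * (b == a)%:R = h a.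
Proof.
by rewrite (sum_only (a := a)) => [|i /negbTE ->]; rewrite ?eqxx ?mulr1 ?mulr0.
Qed.

Notation q := (fun y => p X (zeta X y)).

(** Lie transport trades the w-derivative of [theta^l] for derivatives of w, and the [beta] term
    completes them to covariant derivatives. *)
Lemma D0_theta x l nu : Omega_Gamma_T X x -> D0 X (theta_t X l) nu x =
  - \sum_c theta X (phi X x) l c * nabla_w X nu c (phi X x).
Proof.
move=> Hx; have Mx := OGM Hx; have Ny := MN Mx.
rewrite /D0 (pd0_comp G Mx (h := fun y => theta X y l nu)); last exact: (Ck_diff (cth l nu) Ny).
have H := lie_theta oN ce uE l nu Ny (frame_commutes_OG hFrame G Hx).
move/eqP: H; rewrite addr_eq0 => /eqP ->.
transitivity (- (\sum_c theta X (phi X x) l c * pd nu (fun z => w X z ord0 c) (phi X x)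
   + \sum_c theta X (phi X x) l c * \sum_a Gam X c nu a (phi X x) * w X (phi X x) ord0 a)).
  rewrite opprD; congr (_ + _); rewrite -sumrN; apply: eq_bigr => c _.
  rewrite /beta mulNr mulrC; congr (- (_ * _)); apply: eq_bigr => a _.
  by rewrite /e0_t e0E /Gam_t (Gam_sym hA1) mulrC.
congr (- _); rewrite -big_split; apply: eq_bigr => c _ /=.
by rewrite -mulrDr.
Qed.

(** The right-hand side is [dzeta / zeta], which is how the pressure gradient enters. *)
Lemma psiE x nu : Omega_Gamma_T X x -> psi X nu x = w_grad X nu (phi X x) / w2 X (phi X x).
Proof.
move=> Hx; rewrite /psi D0_theta // /w_grad mulr_suml -sumrN; apply: eq_bigr => c _.
by rewrite (theta0_vt hA1 hA3 hA4 hFrame G uE) // /vt mulNr opprK mulrAC.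
Qed.

Lemma q_ge0 x : Omega_T X x -> 0 <= q (phi X x).
Proof.
move=> Ox; case: hA3 => _ _ _ H _.
exact: (p_ge0 hEos hp (H _ (UT_U hA4 (phi_UT Ox)))).
Qed.

Lemma q_Gamma x : Gamma_T X x -> q (phi X x) = 0.
Proof. by case: hA7 => _ H _; exact: H. Qed.

Let dq y : N y -> differentiable q y.
Proof. by move=> Ny; exact: (Ck_diff cq Ny). Qed.

Let dphi x : M x -> differentiable (phi X) x.
Proof. by move=> Mx; exact: (Ck_diff cphi Mx). Qed.

(** Split v into time and space. In time, the pressure vanishes along the whole boundary line
    through x; in space, at fixed time, it is non-negative on the domain and zero at the point, so
    [tangent_derive_eq0] applies. *)
Lemma D_q_tangent x v : Gamma_T X x -> TGamma X x v -> 'D_v (fun z => q (phi X z)) x = 0.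
Proof.
move=> Gx tv; have Hx : Omega_Gamma_T X x by right. have Mx := OGM Hx.
have dqp z : M z -> differentiable (fun z => q (phi X z)) z.
  by move=> Mz; apply: (diffble_comp (u := phi X) (f := q)); [exact: dphi|apply: dq; exact: MN].
have [ht hb] := Gx.
have sOm : smooth_boundary (Omega X) by case: hA2 => -[].
have -> : v = v ord0 ord0 *: delta_mx ord0 ord0 + pt 0 (space v).
  by rewrite addrC -pt_shift pt_space.
rewrite dlin; last exact: dqp.
have -> : 'D_(delta_mx ord0 ord0) (fun z => q (phi X z)) x = 0.
  apply: (vanish_pd0 T0 (S := bd (Omega X)) (h := fun z => q (phi X z)) _ ht hb (dqp _ Mx)).
  by move=> z h1 h2; exact: (q_Gamma (conj h1 h2)).
rewrite scaler0 add0r.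
pose t := x ord0 ord0.
have dpt : differentiable (@pt R t) (space x) /\ 'D_(space v) (@pt R t) (space x) = pt 0 (space v).
  have cp0 := linear_row_continuous (@pt0_linear R).
  have [d0 D0'] := derive_linear (space x) (space v) (@pt0_linear R) cp0.
  have -> : @pt R t = fun y => pt 0 y + t *: delta_mx ord0 ord0.
    by apply/funext => y; exact: pt_shift.
  split; first by apply: differentiableD => //; exact: diffble_cst.
  have dc : derivable (fun _ : 'rV[R]_3 => t *: delta_mx ord0 ord0 : pt4) (space x) (space v).
    by apply: diff_derivable; exact: diffble_cst.
  have dp : derivable (@pt R 0) (space x) (space v) by exact: diff_derivable.
  by rewrite (deriveD dp dc) dcst addr0.
have [dpt1 dpt2] := dpt.
have ptx : pt t (space x) = x by exact: pt_space.
have dqx : differentiable (fun z => q (phi X z)) (pt t (space x)) by rewrite ptx; exact: dqp.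
have := dcomp (space v) dpt1 dqx; rewrite dpt2 ptx => <-.
apply: (tangent_derive_eq0 (Om := Omega X)) => //.
- by apply: (diffble_comp (u := @pt R t) (f := fun z => q (phi X z))).
- by rewrite ptx; exact: q_Gamma.
move=> z Oz; apply: q_ge0; split; first by rewrite pt_time.
by rewrite space_pt.
Qed.

Lemma TGamma_ebar x i : Gamma_T X x -> i != ord_max -> TGamma X x (ebar X i x).
Proof.
move=> Gx im; case: hFrame => _ _ _ /(_ x Gx) [H _]; apply/H.
exists (fun j => (j == i)%:R); split; first by rewrite eq_sym (negbTE im).
rewrite (bigD1 i) // eqxx scale1r big1; first exact: (esym (addr0 _)).
by move=> j /andP[_ /negbTE ->]; rewrite scale0r.
Qed.

Lemma push_ebar x i mu : M x -> \sum_b J X x mu b * ebar X i x ord0 b = e X i (phi X x) ord0 mu.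
Proof. by move=> Mx; rewrite (e_push uJ) //; apply: eq_bigr => b _; rewrite !mxE. Qed.

Lemma D_q_ebar x i : M x -> 'D_(ebar X i x) (fun z => q (phi X z)) x =
  \sum_om e X i (phi X x) ord0 om * pd om q (phi X x).
Proof.
move=> Mx; have dqx : differentiable q (phi X x) by apply: dq; exact: MN.
rewrite dlin_row; last by apply: (diffble_comp (u := phi X) (f := q)) => //; exact: dphi.
transitivity (\sum_b ebar X i x ord0 b * \sum_om J X x om b * pd om q (phi X x)).
  by apply: eq_bigr => b _; rewrite -(chain_phi cphi b Mx dqx).
under eq_bigr do rewrite mulr_sumr.
rewrite exchange_big /=; apply: eq_bigr => om _; rewrite -push_ebar // mulr_suml.
by apply: eq_bigr => b _; rewrite mulrA; congr (_ * _); exact: mulrC.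
Qed.

(** The derivative [e_3(p)], the one frame derivative of the pressure that survives on the free
    boundary. *)
Definition dp_e3 x : R := \sum_om e X ord_max (phi X x) ord0 om * pd om q (phi X x).

Lemma pd_q_theta3 x om : Gamma_T X x ->
  pd om q (phi X x) = dp_e3 x * theta X (phi X x) ord_max om.
Proof.
move=> Gx; have Hx : Omega_Gamma_T X x by right. have Mx := OGM Hx; have Ny := MN Mx.
transitivity (\sum_i (\sum_d e X i (phi X x) ord0 d * pd d q (phi X x)) * theta X (phi X x) i om).
  under eq_bigr do rewrite mulr_suml.
  rewrite exchange_big /=.
  transitivity (\sum_d pd d q (phi X x) * (d == om)%:R).
    exact: (esym (sum_deltar om (fun d => pd d q (phi X x)))).
  apply: eq_bigr => d _; rewrite -(e_theta uE _ _ Ny) mulr_sumr.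
  by apply: eq_bigr => i _; rewrite mulrAC mulrC.
apply: (sum_only (a := ord_max)) => i im; rewrite -(D_q_ebar i Mx) (D_q_tangent Gx (TGamma_ebar Gx im)); exact: mul0r.
Qed.

Definition theta3_sq (y : pt4) : R :=
  \sum_a \sum_b ginv X y a b * theta X y ord_max a * theta X y ord_max b.

Definition up3 (y : pt4) : pt4 := \row_mu \sum_nu ginv X y mu nu * theta X y ord_max nu.

Lemma gprod_up3 y v : gprod X y (up3 y) v = \sum_mu theta X y ord_max mu * v ord0 mu.
Proof.
rewrite /gprod exchange_big /=; apply: eq_bigr => nu _.
rewrite -mulr_suml; congr (_ * _).
under eq_bigr do rewrite mxE (g_symE hA1) mulr_sumr.
rewrite exchange_big /=.
transitivity (\sum_c (nu == c)%:R * theta X y ord_max c).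
  apply: eq_bigr => c _; rewrite -(g_ginvE hA1 y) mulr_suml.
  by apply: eq_bigr => a _; rewrite mulrA.
rewrite (bigD1 nu) // eqxx mul1r big1; first exact: addr0.
by move=> i /andP[_]; rewrite eq_sym => /negbTE ->; rewrite mul0r.
Qed.

Lemma theta3_up3 y : \sum_mu theta X y ord_max mu * up3 y ord0 mu = theta3_sq y.
Proof.
apply: eq_bigr => a _; rewrite mxE mulr_sumr; apply: eq_bigr => b _.
by rewrite mulrA; congr (_ * _); exact: mulrC.
Qed.

(** The vector dual to [theta^3] is orthogonal to the timelike w because [theta^3(e_0) = 0], and
    nonzero because [theta^3(e_3) = 1]; hence it is spacelike. *)
Lemma theta3_sq_gt0 y : N y -> 0 < theta3_sq y.
Proof.
move=> Ny; have th i : \sum_mu theta X y ord_max mu * e X i y ord0 mu = (ord_max == i)%:R.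
  exact: (theta_e uE ord_max i Ny).
rewrite -theta3_up3 -gprod_up3; apply: (timelike_orthogonal_spacelike hA1 (u := w X y)).
- by rewrite -oppr_gt0; exact: (g_w2 G).
- by rewrite (gprodC hA1) gprod_up3 -e0E th.
apply/negP => /eqP H; have := th ord_max; rewrite -gprod_up3 H eqxx /gprod.
rewrite big1 => [/eqP|a _]; first by rewrite eq_sym oner_eq0.
by apply: big1 => b _; rewrite mxE mulr0 mul0r.
Qed.

Lemma gprodZl y (a : R) u v : gprod X y (a *: u) v = a * gprod X y u v.
Proof.
rewrite /gprod mulr_sumr; apply: eq_bigr => mu _; rewrite mulr_sumr.
by apply: eq_bigr => nu _; rewrite mxE; ring.
Qed.

Definition theta3_normal (y : pt4) : pt4 := (Num.sqrt (theta3_sq y))^-1 *: up3 y.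

Lemma theta3_theta3_normal y : N y -> \sum_mu theta X y ord_max mu * theta3_normal y ord0 mu = Num.sqrt (theta3_sq y).
Proof.
move=> Ny; have Q0 := theta3_sq_gt0 Ny.
transitivity ((Num.sqrt (theta3_sq y))^-1 * theta3_sq y).
  rewrite -[X in _ = _ * X]theta3_up3 [RHS]mulr_sumr; apply: eq_bigr => mu _.
  by rewrite [theta3_normal _ _ _]mxE mulrCA.
have S0 : Num.sqrt (theta3_sq y) != 0 by rewrite gt_eqF // sqrtr_gt0.
by rewrite -[X in _ * X = _](sqr_sqrtr (ltW Q0)) expr2 mulKf.
Qed.

Lemma pushE x u mu : push X x u ord0 mu = \sum_b J X x mu b * u ord0 b.
Proof. by rewrite mxE; apply: eq_bigr => b _; rewrite [_^T _ _]mxE mulrC. Qed.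

Lemma push_sum_ebar x (c : 'I_4 -> R) : M x ->
  push X x (\sum_i c i *: ebar X i x) = \sum_i c i *: e X i (phi X x).
Proof.
move=> Mx; apply/rowP => mu; rewrite pushE summxE.
transitivity (\sum_b \sum_i J X x mu b * (c i * ebar X i x ord0 b)).
  by apply: eq_bigr => b _; rewrite summxE mulr_sumr; apply: eq_bigr => i _; congr (_ * _); exact: mxE.
rewrite exchange_big /=; apply: eq_bigr => i _; rewrite mxE -push_ebar // mulr_sumr.
by apply: eq_bigr => b _; rewrite mulrCA.
Qed.

Lemma frame_expand y (v : pt4) : N y ->
  \sum_i (\sum_mu theta X y i mu * v ord0 mu) *: e X i y = v.
Proof.
move=> Ny; apply/rowP => nu; rewrite summxE.
transitivity (\sum_mu (\sum_i e X i y ord0 nu * theta X y i mu) * v ord0 mu).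
  under [RHS]eq_bigr do rewrite mulr_suml.
  rewrite [RHS]exchange_big /=; apply: eq_bigr => i _; rewrite mxE mulr_suml.
  by apply: eq_bigr => mu _; rewrite mulrAC; congr (_ * _); exact: mulrC.
under eq_bigr do rewrite (e_theta uE _ _ Ny).
rewrite (bigD1 nu) // eqxx mul1r big1; first exact: addr0.
by move=> i /andP[_]; rewrite eq_sym => /negbTE ->; rewrite mul0r.
Qed.

(** The Taylor sign condition speaks of the geometric normal, which is here identified with the
    normalized dual of [theta^3]. Orthogonality holds because tangent vectors have no [e_3]
    component. *)
Lemma theta3_normal_outward x : Gamma_T X x -> outward_unit_normal X x (theta3_normal (phi X x)).
Proof.
move=> Gx; have Hx : Omega_Gamma_T X x by right. have Mx := OGM Hx; have Ny := MN Mx.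
have Q0 := theta3_sq_gt0 Ny.
case: hFrame => _ _ _ /(_ x Gx) [HT Hout].
split.
- move=> _ [u /HT [c [c0 ->]] <-]; rewrite push_sum_ebar // gprodZl gprod_up3.
  rewrite [X in _ * X](_ : _ = 0) ?mulr0 //.
  transitivity (\sum_i c i * \sum_mu theta X (phi X x) ord_max mu * e X i (phi X x) ord0 mu).
    under [RHS]eq_bigr do rewrite mulr_sumr.
    rewrite [RHS]exchange_big /=; apply: eq_bigr => mu _; rewrite summxE mulr_sumr.
    by apply: eq_bigr => i _; rewrite mxE mulrCA.
  rewrite big1 // => i _; rewrite (theta_e uE ord_max i Ny).
  by case: eqP => [<-|_]; rewrite ?c0 ?mul0r ?mulr0.
- by rewrite gprodZl gprod_up3 theta3_theta3_normal // mulVf // gt_eqF // sqrtr_gt0.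
(* The preimage of the normal has the same components in the pulled-back frame. Its [ebar_3]
   component is the positive number [|theta^3|]; the other [ebar_i] are tangent and do not affect
   the outward direction. *)
exists (\sum_i (\sum_mu theta X (phi X x) i mu * theta3_normal (phi X x) ord0 mu) *: ebar X i x); last first.
  by rewrite push_sum_ebar // frame_expand.
move=> h bh; have dh : differentiable h (space x).
  by have [_ [N' [_ Ny' sh _]]] := bh; exact: (Ck_diff (sh 1%N) Ny').
set c := fun i => \sum_mu theta X (phi X x) i mu * theta3_normal (phi X x) ord0 mu.
have -> : space (\sum_i c i *: ebar X i x) = \sum_i c i *: space (ebar X i x).
  apply/rowP => K; rewrite !mxE !summxE; apply: eq_bigr => i _.
  by rewrite !mxE.
rewrite dlin_sum // (bigD1 ord_max) //= big1.
  rewrite addr0; apply: mulr_gt0; last exact: Hout.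
  by rewrite /c theta3_theta3_normal // sqrtr_gt0.
by move=> i im; rewrite (TGamma_ebar Gx im bh) scaler0.
Qed.

(** On the unit normal [theta^3] takes the value [|theta^3|], so the Taylor sign condition bounds
    [- dp_e3 |theta^3|] below by a positive constant. *)
Lemma dp_e3_lt0 x : Gamma_T X x -> dp_e3 x < 0.
Proof.
move=> Gx; have Hx : Omega_Gamma_T X x by right. have Mx := OGM Hx; have Ny := MN Mx.
have Q0 := theta3_sq_gt0 Ny; have S0 : 0 < Num.sqrt (theta3_sq (phi X x)) by rewrite sqrtr_gt0.
have [cp0 _ H] := hA7; have := H x _ Gx (theta3_normal_outward Gx).
rewrite (dlin_row _ (dq Ny)).
have -> : \sum_i theta3_normal (phi X x) ord0 i *: 'D_(delta_mx ord0 i) q (phi X x) =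
    dp_e3 x * Num.sqrt (theta3_sq (phi X x)).
  rewrite -theta3_theta3_normal // mulr_sumr; apply: eq_bigr => i _.
  rewrite -/(pd i q (phi X x)) pd_q_theta3 //.
  by rewrite -[LHS]/(_ * _) mulrC mulrA.
move=> H1; have : dp_e3 x * Num.sqrt (theta3_sq (phi X x)) < 0.
  by rewrite -oppr_gt0; exact: lt_le_trans cp0 H1.
by rewrite pmulr_llt0.
Qed.

Lemma psi_theta3 x nu : Gamma_T X x ->
  psi X nu x = dp_e3 x / rho0 X * theta_t X ord_max nu x.
Proof.
move=> Gx; have Hx : Omega_Gamma_T X x by right. have Mx := OGM Hx; have Ny := MN Mx.
have [r0 _ _ rX0 _] := hEos.
have := pd_pz hA1 oN (g_cw G) (g_w2 G) (g_NZ G) (g_Hz G) nu Ny.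
have q0 : p X (zeta X (phi X x)) = 0 by exact: q_Gamma.
rewrite pd_q_theta3 // q0 rX0 addr0 -mulrA -psiE // => H.
rewrite mulrAC -/(theta_t X ord_max nu x) in H *.
rewrite H mulrAC mulfV ?mul1r //; by rewrite gt_eqF.
Qed.

Lemma theta_w x l : M x -> l != ord0 ->
  \sum_mu theta X (phi X x) l mu * w X (phi X x) ord0 mu = 0.
Proof. by move=> Mx l0; rewrite -e0E (theta_e uE l ord0 (MN Mx)) (negbTE l0). Qed.

(** The metrics m and g differ by a multiple of [w w], which a multiple of [theta^3] does not see
    because [theta^3(w) = 0]. *)
Lemma psi_sqE x : Gamma_T X x -> psi_sq X x = (dp_e3 x / rho0 X) ^+ 2 * theta3_sq (phi X x).
Proof.
move=> Gx; have Hx : Omega_Gamma_T X x by right. have Mx := OGM Hx.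
rewrite /psi_sq.
transitivity ((dp_e3 x / rho0 X) ^+ 2 * theta3_sq (phi X x)
  - 2 / gamma_t X ord0 ord0 x * (dp_e3 x / rho0 X) ^+ 2 *
    ((\sum_a theta X (phi X x) ord_max a * w X (phi X x) ord0 a) *
    \sum_b theta X (phi X x) ord_max b * w X (phi X x) ord0 b)); last first.
  by rewrite theta_w // mul0r mulr0 subr0.
rewrite [X in X - _]mulr_sumr [X in _ - X](_ : _ = \sum_a \sum_b 2 / gamma_t X ord0 ord0 x *
    (dp_e3 x / rho0 X) ^+ 2 * ((theta X (phi X x) ord_max a * w X (phi X x) ord0 a) *
    (theta X (phi X x) ord_max b * w X (phi X x) ord0 b))); last first.
  rewrite mulr_suml mulr_sumr; apply: eq_bigr => a _; rewrite !mulr_sumr.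
  by apply: eq_bigr => b _.
rewrite -sumrB; apply: eq_bigr => a _; rewrite mulr_sumr -sumrB; apply: eq_bigr => b _.
rewrite !psi_theta3 // /m_t /ginv_t /e0_t e0E /theta_t.
move: (theta _ _ _ _) (theta _ _ _ _) (w _ _ _ _) (w _ _ _ _) (ginv _ _ _ _) (dp_e3 _ / _) (2 / _).
by move=> a1 a2 a3 a4 a5 a6 a7; ring.
Qed.
End FreeBoundary.

(** * The acoustic boundary condition *)

Section AcousticBoundary.
Set Implicit Arguments.
Unset Strict Implicit.
Variables (R : realType) (X : body R) (c_p : R).
Notation pt4 := 'rV[R]_4.
Hypotheses (hEos : equation_of_state X) (hp : pressure_function X)
  (hA1 : lorentzian X) (hA2 : cylinder_domain X) (hA3 : fluid_solution X)
  (hA4 : flow_invariant X) (hA7 : taylor_sign X c_p) (hFrame : adapted_frame X).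
Variables (NZ : set R) (N M : set pt4).
Hypotheses (G : regular_data X NZ N M) (uE : forall y, N y -> E X y \in unitmx).

Let oN : open N := g_oN G.
Let oM : open M := g_oM G.
Let ce := g_ce G.
Let cphi := g_cphi G.
Let uJ := g_uJ G.
Let MN := g_MN G.
Let OGM := g_OG G.
Let T0 := T_gt0 hA4.

Let dp_e3_rho0 x : Gamma_T X x -> dp_e3 X x / rho0 X < 0.
Proof.
move=> Gx; have [r0 _ _ _ _] := hEos; rewrite pmulr_llt0 ?invr_gt0 //.
exact: (dp_e3_lt0 hEos hp hA1 hA2 hA3 hA4 hA7 hFrame G uE Gx).
Qed.

Let theta3_sq_gt0' x : Gamma_T X x -> 0 < theta3_sq X (phi X x).
Proof. by move=> Gx; apply: (theta3_sq_gt0 hA1 G uE); apply: MN; apply: OGM; right. Qed.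

Lemma psi_sq_gt0 x : Gamma_T X x -> 0 < psi_sq X x.
Proof.
move=> Gx; rewrite (psi_sqE hEos hp hA1 hA2 hA3 hA4 hA7 hFrame G uE Gx).
apply: mulr_gt0; last exact: theta3_sq_gt0'.
by rewrite lt0r sqr_ge0 andbT expf_neq0 // lt_eqF // dp_e3_rho0.
Qed.

Lemma theta3_norm_psi_hat x nu : Gamma_T X x ->
  theta3_norm X x * psi_hat X nu x = - theta_t X ord_max nu x.
Proof.
move=> Gx; have k0 := dp_e3_rho0 Gx; have Q0 := theta3_sq_gt0' Gx.
rewrite /psi_hat (psi_sqE hEos hp hA1 hA2 hA3 hA4 hA7 hFrame G uE Gx).
rewrite (psi_theta3 hEos hp hA1 hA2 hA3 hA4 hA7 hFrame G uE nu Gx).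
rewrite sqrtrM ?sqr_ge0 // sqrtr_sqr ltr0_norm //.
rewrite [theta3_norm X x](_ : _ = Num.sqrt (theta3_sq X (phi X x))) //.
have S0 : Num.sqrt (theta3_sq X (phi X x)) != 0 by rewrite gt_eqF // sqrtr_gt0.
have k1 : dp_e3 X x / rho0 X != 0 by rewrite lt_eqF.
move: (Num.sqrt _) (dp_e3 X x / rho0 X) (theta_t _ _ _ _) S0 k1 => s c t s0 c0.
by field; rewrite c0 s0.
Qed.

Let cth l nu : Ck_on 2 N (fun y => theta X y l nu) := Ck_theta oN ce uE l nu.

Let dphi x : M x -> differentiable (phi X) x.
Proof. by move=> Mx; exact: (Ck_diff cphi Mx). Qed.

Let d_phi (h : pt4 -> R) n x : M x -> Ck_on n.+1 N h -> differentiable (fun z => h (phi X z)) x.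
Proof.
move=> Mx ch; apply: (diffble_comp (u := phi X) (f := h)); first exact: dphi.
exact: (Ck_diff ch (MN Mx)).
Qed.

Let cgi a b : Ck_on 1 N (fun y => ginv X y a b) := Ck_ginv hA1 1 N a b.

Let d_beta l nu x : M x -> differentiable (beta X l nu) x.
Proof.
move=> Mx; apply: diffble_opp; apply: diffble_sum => c; apply: diffble_mul.
  apply: (d_phi (h := fun y => e X ord0 y ord0 c) Mx).
  exact: (Ck_coord ord0 c oN (ce ord0)).
by apply: (d_phi (h := Gam X l c nu) (n := 0) Mx); exact: Ck_Gam.
Qed.

Lemma diffble_psi nu x : M x -> differentiable (psi X nu) x.
Proof.
move=> Mx; apply: diffble_add.
  have ct : Ck_on 2 M (theta_t X ord0 nu).
    exact: (Ck_comp oM MN (cth ord0 nu) (Ck_le (isT : (2 <= 3)%N) cphi)).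
  exact: (Ck_diff (Ck_D (delta_mx ord0 ord0) ct) Mx).
apply: diffble_sum => l; apply: diffble_mul; first exact: d_beta.
exact: (dtheta_t G uE).
Qed.

Lemma diffble_m a b x : M x -> differentiable (m_t X a b) x.
Proof.
move=> Mx; have de c : differentiable (e0_t X c) x.
  apply: (d_phi (h := fun y => e X ord0 y ord0 c) Mx).
  exact: (Ck_coord ord0 c oN (ce ord0)).
apply: diffble_add.
  exact: (d_phi (h := fun y => ginv X y a b) (n := 0) Mx (cgi a b)).
apply: diffble_opp; apply: diffble_mul; last exact: de.
apply: diffble_mul; last exact: de.
apply: diffble_mul; first exact: diffble_cst.
apply: diffble_inv.
  exact: (d_phi (h := fun y => gamma X y ord0 ord0) Mx (Ck_gamma hA1 G ord0 ord0)).
by rewrite /gamma_t gamma00E oppr_eq0 gt_eqF // (g_w2 G (MN Mx)).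
Qed.

Let diffble_sqrt (u : pt4 -> R) x : differentiable u x -> 0 < u x ->
  differentiable (fun z => Num.sqrt (u z)) x.
Proof.
by move=> du u0; apply: (diffble_comp1 du); have [] := is_derive1_sqrt u0.
Qed.

(** Off [Gamma_T] the product is not known to equal [- theta^3], so its differentiability is proved
    factor by factor; the roots and the inverse use positivity of their arguments at x. *)
Lemma diffble_theta3_norm_psi_hat nu x : Gamma_T X x ->
  differentiable (fun z => theta3_norm X z * psi_hat X nu z) x.
Proof.
move=> Gx; have Mx : M x by apply: OGM; right.
apply: diffble_mul.
  apply: diffble_sqrt; last exact: theta3_sq_gt0'.
  apply: diffble_sum => a; apply: diffble_sum => b.
  apply: diffble_mul; last exact: (dtheta_t G uE).
  apply: diffble_mul; last exact: (dtheta_t G uE).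
  exact: (d_phi (h := fun y => ginv X y a b) (n := 0) Mx (cgi a b)).
apply: diffble_mul; first exact: diffble_psi.
have P0 := psi_sq_gt0 Gx.
apply: diffble_inv; last by rewrite gt_eqF // sqrtr_gt0.
apply: diffble_sqrt P0.
apply: diffble_sum => a; apply: diffble_sum => b.
apply: diffble_mul; last exact: diffble_psi.
by apply: diffble_mul; [exact: diffble_m|exact: diffble_psi].
Qed.

(** The identity with [- theta^3] holds only on [Gamma_T], but [D0] differentiates in time alone,
    and boundary points stay on the boundary as time varies. *)
Lemma D0_theta3_norm_psi_hat nu x : Gamma_T X x ->
  D0 X (fun la z => theta3_norm X z * psi_hat X la z) nu x =
  \sum_c theta X (phi X x) ord_max c * nabla_w X nu c (phi X x).
Proof.
move=> Gx; have Hx : Omega_Gamma_T X x by right. have Mx := OGM Hx.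
have [ht hb] := Gx.
have dH := diffble_theta3_norm_psi_hat nu Gx.
have dt := dtheta_t G uE ord_max nu Mx.
have : pd ord0 (fun z => theta3_norm X z * psi_hat X nu z + theta_t X ord_max nu z) x = 0.
  apply: (vanish_pd0 T0 (S := bd (Omega X)) _ ht hb (diffble_add dH dt)) => z h1 h2.
  by rewrite (theta3_norm_psi_hat nu (conj h1 h2)) addNr.
rewrite /pd (dadd _ dH dt) => /eqP; rewrite addr_eq0 => /eqP H.
have := D0_theta hA1 hFrame G uE ord_max nu Hx => /(congr1 -%R); rewrite opprK => <-.
rewrite /D0 /pd H opprD; congr (_ + _); rewrite -sumrN; apply: eq_bigr => l _.
by rewrite theta3_norm_psi_hat // mulrN.
Qed.

(** Contraction with [theta_bar^3] undoes the inverse Jacobian in the Piola transform. In the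
    derivative of the current the term carrying the sound speed is proportional to w, and
    [theta^3(w) = 0] removes it. *)
Lemma boundary_flux nu x : Gamma_T X x ->
  \sum_al theta_bar X x ord_max al * flux X al nu x =
  - (\det (J X x) / (f_t X x * gamma_t X ord0 ord0 x)) *
  \sum_c theta X (phi X x) ord_max c * nabla_w X nu c (phi X x).
Proof.
move=> Gx; have Hx : Omega_Gamma_T X x by right. have Mx := OGM Hx; have Ny := MN Mx.
have w0 : w2 X (phi X x) != 0 by rewrite gt_eqF // (g_w2 G Ny).
have f0 := fz_neq0 (g_NZ G) (g_Hz G) Ny.
have TJ mu : \sum_al theta_bar X x ord_max al * Jinv X x al mu = theta X (phi X x) ord_max mu.
  transitivity (\sum_om theta X (phi X x) ord_max om * (om == mu)%:R); last first.
    rewrite (bigD1 mu) // eqxx mulr1 big1; first exact: addr0.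
    by move=> i /andP[_ /negbTE ->]; rewrite mulr0.
  under eq_bigr do rewrite (theta_barE uJ _ _ Mx (uE Ny)) mulr_suml.
  rewrite exchange_big /=; apply: eq_bigr => om _.
  rewrite -(J_Jinv uJ om mu Mx) mulr_sumr; apply: eq_bigr => al _; exact: (esym (mulrA _ _ _)).
transitivity (- \det (J X x) * \sum_mu theta X (phi X x) ord_max mu * Yc X mu nu (phi X x)).
  transitivity (\sum_al \sum_mu - \det (J X x) *
     (theta_bar X x ord_max al * Jinv X x al mu * Yc X mu nu (phi X x))).
    apply: eq_bigr => al _; rewrite (fluxE G uE al nu Mx).
    rewrite -mulNr mulrCA -mulr_sumr; congr (_ * _); rewrite mulr_sumr.
    by apply: eq_bigr => mu _; exact: mulrA.
  rewrite exchange_big mulr_sumr; apply: eq_bigr => mu _.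
  by rewrite -mulr_sumr -mulr_suml TJ.
transitivity (- \det (J X x) * - ((\sum_c theta X (phi X x) ord_max c * nabla_w X nu c (phi X x))
    / (w2 X (phi X x) * fz X (phi X x)))); last first.
  rewrite f_tE /gamma_t gamma00E.
  move: (\sum_c _) (\det _) (w2 _ _) (fz _ _) w0 f0 => s d a b a0 b0.
  by field; rewrite a0 b0.
congr (_ * _).
transitivity (- ((\sum_c theta X (phi X x) ord_max c * nabla_w X nu c (phi X x))
    / (w2 X (phi X x) * fz X (phi X x)))
    - (1 + rs X (phi X x)) * w_grad X nu (phi X x) / (w2 X (phi X x) ^+ 2 * fz X (phi X x))
    * \sum_mu theta X (phi X x) ord_max mu * w X (phi X x) ord0 mu); last first.
  by rewrite (theta_w G uE Mx) // mulr0 subr0.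
rewrite mulr_suml -sumrN mulr_sumr -sumrB; apply: eq_bigr => mu _.
rewrite (Yc_nabla hA1 hA2 hA3 hA4 hFrame G uE mu nu Hx).
rewrite (nabla_lamE hA1 oN (g_cw G) (g_w2 G) (g_NZ G) (g_Hz G) (g_Cz G) nu mu Ny).
move: (theta _ _ _ _) (nabla_w _ _ _ _) (rs _ _) (w_grad _ _ _) (w _ _ _ _) => a1 a2 a3 a4 a5.
move: (_^-1) (_^-1) => a6 a7; ring.
Qed.
End AcousticBoundary.

Theorem mainTheorem3 (R : realType) (X : body R) (cs_minus cs_plus c_p : R)
  (hEos : equation_of_state X) (hp : pressure_function X) (hF : F_function X)
  (hA1 : lorentzian X)
  (hA2 : cylinder_domain X)
  (hA3 : fluid_solution X)
  (hA4 : flow_invariant X)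
  (hLag : lagrangian_coordinates X)
  (hA5 : w_tangent X)
  (hA6 : sound_speed_bounds X cs_minus cs_plus)
  (hA7 : taylor_sign X c_p)
  (hFrame : adapted_frame X) :
  [/\ forall x, Omega_T X x \/ Gamma_T X x ->
        differentiable (phi X) x /\
        forall nu, differentiable (theta_t X ord0 nu) x,
      forall x nu, Omega_T X x ->
        (forall al, derivable
           (fun z => \sum_be A_t X al be z * pd be (theta_t X ord0 nu) z
                     + L_t X al nu z) x (delta_mx ord0 al)) /\
        \sum_al pd al
          (fun z => \sum_be A_t X al be z * pd be (theta_t X ord0 nu) z
                    + L_t X al nu z) x = F_t X nu x,
      forall x mu, Omega_T X x ->
        pd ord0 (fun z => phi X z ord0 mu) x
        = gamma_t X ord0 ord0 x * \sum_nu ginv_t X mu nu x * theta_t X ord0 nu x,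
      forall x i l j, Omega_T X x \/ Gamma_T X x ->
        sigma_t X i l j x = sigma X i l j (pt 0 (space x)) &
      forall x nu, Gamma_T X x ->
        [/\ 0 < psi_sq X x,
            derivable (fun z => theta3_norm X z * psi_hat X nu z) x
              (delta_mx ord0 ord0) &
            \sum_al theta_bar X x ord_max al *
              (\sum_be A_t X al be x * pd be (theta_t X ord0 nu) x
               + L_t X al nu x)
            = - (\det (J X x) / (f_t X x * gamma_t X ord0 ord0 x))
              * D0 X (fun la z => theta3_norm X z * psi_hat X la z) nu x]].
Proof.
have [NZ [N [M [G uE]]]] := regular_frame_data_exists hEos hp hF hA1 hA3 hA4 hLag hFrame.
have OGM := g_OG G.
split.
- move=> x Hx; have Mx := OGM x Hx; split; first exact: (Ck_diff (g_cphi G) Mx).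
  by move=> nu; exact: (dtheta_t G uE).
- move=> x nu Ox; have Mx : M x by apply: OGM; left.
  split; last exact: (wave_equation hA1 hA2 hA3 hA4 hFrame G uE nu Ox).
  by move=> al; apply: diff_derivable; exact: (diffble_flux hA1 G uE al nu Mx).
- by move=> x mu; exact: (flow_equation hA1 hA3 hA4 hFrame G uE).
- by move=> x i l j; exact: (sigma_const hA2 hA4 hFrame G uE).
move=> x nu Gx; split.
- exact: (psi_sq_gt0 hEos hp hA1 hA2 hA3 hA4 hA7 hFrame G uE Gx).
- apply: diff_derivable.
  exact: (diffble_theta3_norm_psi_hat hEos hp hA1 hA2 hA3 hA4 hA7 hFrame G uE nu Gx).
rewrite (D0_theta3_norm_psi_hat hEos hp hA1 hA2 hA3 hA4 hA7 hFrame G uE nu Gx).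
exact: (boundary_flux hA1 hA2 hA3 hA4 hFrame G uE nu Gx).
Qed.
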